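(* Let $S_*>0$ and let $\psi:\mathbb{R}\to(0,\infty)$ be positive, continuously differentiable at the point $0$, with $\psi(0)=1$ and $\dot\psi(0)>0$. Then the family of measures is locally asymptotically quadratic under the hypothesis $u=0$: for every $u\ge0$, under $\mathbf{P}_0$, as $T\to\infty$, $$Z_T(u)\Longrightarrow Z(u)=\exp\Bigl\{-u\int_0^1W(s)\,dW(s)-\frac{u^2}{2}\int_0^1W(s)^2\,ds\Bigr\}$$ in distribution, where $W$ is a standard Wiener process on $[0,1]$. Moreover, for any bounded sequence $u_T\in\mathbb{U}_T$, $$l_T^*(u_T)-l_T(u_T)\longrightarrow0$$ in $\mathbf{P}_0$-probability as $T\to\infty$.
   Context: Under $\mathbf{P}_0$ the counting process $X^T=\{X_t,0\le t\le T\}$ is a Poisson process of constant intensity $S_*$. ''Continuously differentiable at $0$'' means that $\psi$ is differentiable in a neighbourhood of $0$ with derivative $\dot\psi$ continuous at $0$. Put $\gamma=S_*\dot\psi(0)$ and let $$L(\vartheta,X^T)=\exp\Bigl\{\int_0^T\ln\psi\bigl(\vartheta(S_*t-X_{t-})\bigr)\,[dX_t-S_*dt]-\int_0^T\bigl[\psi\bigl(\vartheta(S_*t-X_t)\bigr)-1-\ln\psi\bigl(\vartheta(S_*t-X_t)\bigr)\bigr]S_*\,dt\Bigr\}$$ ($X_{t-}$ is the left limit of $X$ at $t$) be the likelihood ratio, with respect to $\mathbf{P}_0$, of the point process with intensity $S_*\psi(\vartheta[S_*t-X_t])$ on $[0,T]$. For $u\ge0$ set $$Z_T(u)=L\Bigl(\frac{u}{\gamma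 T},X^T\Bigr),\qquad l_T(u)=\ln Z_T(u),\qquad l_T^*(u)=u\,\Delta_T(X^T)-\frac{u^2}{2}J_T(X^T),$$ where $$\Delta_T(X^T)=\frac{1}{S_*T}\int_0^T(S_*t-X_{t-})\,[dX_t-S_*dt],\qquad J_T(X^T)=\frac{1}{S_*T^2}\int_0^T(S_*t-X_t)^2\,dt,$$ and $\mathbb{U}_T=\{u:\ 0\le u<\sqrt{S_*T}/\ln T\}$. *)

(* Defs.v *)
From HB Require Import structures.
From mathcomp Require Export all_boot all_order all_algebra.
From mathcomp Require Export all_classical all_reals all_analysis.
Export Order.TTheory GRing.Theory Num.Theory.
Export numFieldNormedType.Exports.

Set Implicit Arguments.
Unset Strict Implicit.
Unset Printing Implicit Defensive.

#[export] Set Implicit Arguments.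
#[export] Unset Strict Implicit.
#[export] Unset Printing Implicit Defensive.

Global Open Scope classical_set_scope.
Global Open Scope ring_scope.

(* Mutual independence of the increments over every finite grid in [0, T];
   the product rule over subfamilies is obtained by taking some of the B i
   to be setT. *)
Definition independent_increments (R : realType) d (Omega : measurableType d)
    (P : probability Omega R) (T : R) (Y : R -> Omega -> R) :=
  forall (n : nat) (t : nat -> R) (B : nat -> set R),
    0 <= t 0%N -> (forall i, (i < n)%N -> t i <= t i.+1) -> t n <= T ->
    (forall i, measurable (B i)) ->
    P [set w | forall i, (i < n)%N -> B i (Y (t i.+1) w - Y (t i) w)] =
    (\prod_(i < n) P [set w | B i (Y (t i.+1) w - Y (t i) w)%R])%E.

Definition left_limit (R : realType) (x : R -> nat) (t : R) : R :=
  lim (((x s)%:R : R) @[s --> t^'-]).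

Definition counting_path (R : realType) (T : R) (x : R -> nat) :=
  [/\ x 0 = 0%N,
      (forall s t, 0 <= s -> s <= t -> t <= T -> (x s <= x t)%N),
      (forall t, 0 <= t < T -> ((x s)%:R : R) @[s --> t^'+] --> ((x t)%:R : R)) &
      (forall t, 0 < t <= T -> (x t)%:R - left_limit x t <= 1)].

(* The increment law only constrains s < t: [poisson_pmf] is the Poisson mass
   function for positive parameters only. *)
Definition poisson_process (R : realType) d (Omega : measurableType d)
    (P : probability Omega R) (S T : R) (X : R -> Omega -> nat) :=
  [/\ (forall t, 0 <= t <= T -> measurable_fun setT (X t)),
      (forall w, counting_path T (X ^~ w)),
      independent_increments P T (fun t w => (X t w)%:R) &
      (forall s t k, 0 <= s -> s < t -> t <= T ->
        P [set w | X t w = (X s w + k)%N] = (poisson_pmf (S * (t - s)) k)%:E)].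

(* [normal_prob m s] is parametrised by the standard deviation s. *)
Definition wiener_process (R : realType) d (Omega : measurableType d)
    (P : probability Omega R) (W : R -> Omega -> R) :=
  [/\ (forall t, 0 <= t <= 1 -> measurable_fun setT (W t)) /\
      (forall w, {within `[0, 1], continuous (W ^~ w)}),
      {ae P, forall w, W 0 w = 0},
      independent_increments P 1 W &
      (forall s t B, 0 <= s -> s < t -> t <= 1 -> measurable B ->
        P [set w | B (W t w - W s w)] = normal_prob 0 (Num.sqrt (t - s)) B)].

Definition natural_filtration (R : realType) d (Omega : measurableType d)
    (W : R -> Omega -> R) (t : R) : set (set Omega) :=
  <<s [set A | exists s B,
        [/\ 0 <= s <= t, measurable B & A = W s @^-1` B] ]>>.

(* The process s |-> \sum_(i < n) xi_i 1_(t_i, t_(i+1)] (s). *)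
Record step_process (R : realType) (Omega : Type) := StepProcess {
  step_size : nat ;
  step_time : nat -> R ;
  step_coef : nat -> Omega -> R }.

Definition step_eval (R : realType) (Omega : Type) (h : step_process R Omega)
    (s : R) (w : Omega) : R :=
  \sum_(i < step_size h)
     step_coef h i w * \1_(`]step_time h i, step_time h i.+1]) s.

Definition step_integral (R : realType) (Omega : Type) (W : R -> Omega -> R)
    (h : step_process R Omega) (w : Omega) : R :=
  \sum_(i < step_size h)
     step_coef h i w * (W (step_time h i.+1) w - W (step_time h i) w).

Definition step_admissible (R : realType) d (Omega : measurableType d)
    (W : R -> Omega -> R) (h : step_process R Omega) :=
  [/\ 0 <= step_time h 0%N, step_time h (step_size h) <= 1,
      (forall i, (i < step_size h)%N -> step_time h i <= step_time h i.+1) &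
      (forall i, (i < step_size h)%N ->
        (forall B, measurable B ->
           natural_filtration W (step_time h i) (step_coef h i @^-1` B)) /\
        (exists C, forall w, `|step_coef h i w| <= C))].

(* I is (a version of) the Ito integral of H over [0, 1] against W: the limit in
   L^2(P) of the integrals of adapted bounded step processes converging to H in
   L^2(P (x) ds).  The distances are extended-real integrals, so convergence to
   0 includes their eventual finiteness. *)
Definition is_ito_integral (R : realType) d (Omega : measurableType d)
    (P : probability Omega R) (W H : R -> Omega -> R) (I : Omega -> R) :=
  measurable_fun setT I /\
  exists h : nat -> step_process R Omega,
    [/\ (forall m, step_admissible W (h m)),
        (\int[P]_w \int[lebesgue_measure]_(s in `[0%R, 1%R])
           ((step_eval (h m) s w - H s w) ^+ 2)%R%:E)%E @[m --> \oo] --> 0%E &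
        (\int[P]_w ((step_integral W (h m) w - I w) ^+ 2)%R%:E)%E
           @[m --> \oo] --> 0%E].

(* Weak convergence, as T -> +oo, of Y T (defined on its own probability space)
   to Z: convergence of expectations of bounded continuous functions. *)
Definition cvg_in_distribution (R : realType)
    d (Omega : R -> measurableType d) (P : forall T, probability (Omega T) R)
    (Y : forall T, Omega T -> R)
    d' (Omega' : measurableType d') (P' : probability Omega' R)
    (Z : Omega' -> R) :=
  forall f : R -> R, continuous f -> (exists C, forall x, `|f x| <= C) ->
    'E_(P T)[f \o Y T]%E @[T --> +oo] --> 'E_P'[f \o Z]%E.

(* Convergence to 0 in probability as T -> +oo.  [mu ^*] is the outer measure,
   which coincides with mu on measurable sets: since a measure is unconstrained
   outside the measurable sets, this keeps the notion meaningful when Y T is not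
   known to be measurable. *)
Definition cvg0_in_probability (R : realType)
    d (Omega : R -> measurableType d) (P : forall T, probability (Omega T) R)
    (Y : forall T, Omega T -> R) :=
  forall e : R, 0 < e ->
    ((P T) ^*)%mu [set w | e < `|Y T w|] @[T --> +oo] --> 0%E.

Definition continuously_differentiable_at (R : realType) (f : R -> R) (a : R) :=
  (\forall x \near a, derivable f x 1) /\ {for a, continuous (f^`())%classic}.

(* The Stieltjes integral over (0, T] of h against the pure jump path x; the
   sum has finite support when x is a counting path. *)
Definition int_dX (R : realType) (T : R) (x : R -> nat) (h : R -> R) : R :=
  \sum_(t \in `]0, T]) h t * ((x t)%:R - left_limit x t).

(* The integral of h against dX_t - S dt. *)
Definition int_dM (R : realType) (S T : R) (x : R -> nat) (h : R -> R) : R :=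
  int_dX T x h - \int[lebesgue_measure]_(t in `[0, T]) (h t * S).

Definition likelihood_ratio (R : realType) (S : R) (psi : R -> R)
    (T theta : R) (x : R -> nat) : R :=
  expR (int_dM S T x (fun t => ln (psi (theta * (S * t - left_limit x t))))
        - \int[lebesgue_measure]_(t in `[0, T])
            ((psi (theta * (S * t - (x t)%:R)) - 1
              - ln (psi (theta * (S * t - (x t)%:R)))) * S)).

(* Z_T(u), with the local parametrisation theta = u / (gamma T),
   gamma = S psi'(0). *)
Definition local_LR (R : realType) (S : R) (psi : R -> R)
    (T u : R) (x : R -> nat) : R :=
  likelihood_ratio S psi T (u / (S * (psi^`())%classic 0 * T)) x.

Definition local_logLR (R : realType) (S : R) (psi : R -> R)
    (T u : R) (x : R -> nat) : R :=
  ln (local_LR S psi T u x).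

(* Delta_T and J_T. *)
Definition score_stat (R : realType) (S T : R) (x : R -> nat) : R :=
  (S * T)^-1 * int_dM S T x (fun t => S * t - left_limit x t).

Definition info_stat (R : realType) (S T : R) (x : R -> nat) : R :=
  (S * T ^+ 2)^-1 *
    \int[lebesgue_measure]_(t in `[0, T]) (S * t - (x t)%:R) ^+ 2.

Definition quadratic_logLR (R : realType) (S T u : R) (x : R -> nat) : R :=
  u * score_stat S T x - u ^+ 2 / 2 * info_stat S T x.

Definition local_param_set (R : realType) (S T : R) : set R :=
  [set u | 0 <= u < Num.sqrt (S * T) / ln T].

(* Main.v *)
Require Import Defs.
From HB Require Import structures.
From mathcomp Require Import measurable_realfun ring lra zify.

(** Write M_t = X_t - S t for the compensated process.  Along a counting path an
    integral of g(M_{t-}) against dM is computed by a primitive G of g: it is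
    G(M_T) - G(0) minus the sum over the jumps of the second order remainders
    G(m + 1) - G(m) - g(m) ([int_dM_primitive]).  For a linear g this gives the
    score exactly, (X_T - M_T^2) / (2 S T) ([score_statE]).  For an L-Lipschitz g
    vanishing at 0 the integral is at most L (M_T^2 + X_T) ([int_dM_lipschitz]).

    The parameter is of order 1/T, so that the argument of psi is small as soon as
    sup |M| / T is.  As psi is continuously differentiable at 0, the function
    ln psi(y) - psi'(0) y is e-Lipschitz near 0 with e arbitrarily small
    ([psi_modulus]).  Hence the log-likelihood differs from its quadratic form by at
    most e times quantities bounded in probability ([logLR_expansion]), all of which
    are controlled by Markov inequalities, the supremum of M being reached through a
    finite grid because X is monotone ([good_event], [logLR_event]).  This is the
    second assertion.

    For the limit law, put m_i = M_{iT/N} / sqrt(S T), with N close to T.  The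
    quadratic form is close to u/2 - (u/2) m_N^2 - (u^2/2) (1/N) sum_{i<N} m_i^2, so
    Z_T(u) is close to exp(u/2) V_T with V_T in the unit interval.  The law of V_T is
    determined by its moments, which are Laplace transforms
    E exp(-a m_N^2 - (b/N) sum_{i<N} m_i^2).  For any process with centred
    independent increments of variance 1/N and fourth moments of order 1/N^2, such an
    expectation equals exp(-r) up to O(N^{-1/2}), where r comes from a deterministic
    Riccati recursion depending on a, b and N only ([lindeberg_riccati]).  The same
    estimate applied to the Wiener process identifies the limit
    ([wiener_riccati], [factor_moments]) without solving the recursion, and the
    Bernstein polynomials turn moments into expectations of continuous functions
    ([moments_cvg]).  The result has the announced form because the Ito integral of W
    against itself is almost surely (W_1^2 - 1) / 2 ([ito_wienerE]).

    The likelihood ratio is not known to be measurable.  Convergence in probability is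
    therefore obtained through measurable exceptional events, and expectations of
    bounded functions of the likelihood ratio are squeezed between those of measurable
    functions ([expectation_close]). *)

(** * Derivatives of real functions *)

Section derive_pointwise.
Context (R : realType).
Implicit Types (f g : R -> R) (x a b : R).

Lemma der_cst c x : is_derive x 1 (fun=> c : R) 0.
Proof. exact: is_derive_cst. Qed.

Lemma der_id x : is_derive x 1 (fun y => y : R) 1.
Proof. exact: is_derive_id. Qed.

Lemma derD f g x a b : is_derive x 1 f a -> is_derive x 1 g b ->
  is_derive x 1 (fun y => f y + g y) (a + b).
Proof. by move=> fa gb; exact: is_deriveD. Qed.

Lemma derN f x a : is_derive x 1 f a -> is_derive x 1 (fun y => - f y) (- a).
Proof. by move=> fa; exact: is_deriveN. Qed.

Lemma derM f g x a b : is_derive x 1 f a -> is_derive x 1 g b ->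
  is_derive x 1 (fun y => f y * g y) (f x * b + g x * a).
Proof. by move=> fa gb; exact: is_deriveM. Qed.

Lemma derZ c f x a : is_derive x 1 f a -> is_derive x 1 (fun y => c * f y) (c * a).
Proof. by move=> fa; exact: is_deriveZ. Qed.

Lemma der_comp f g x a b : is_derive (g x) 1 f a -> is_derive x 1 g b ->
  is_derive x 1 (fun y => f (g y)) (a * b).
Proof. by move=> fa gb; exact: is_derive1_comp. Qed.

Lemma der_exp g x b : is_derive x 1 g b ->
  is_derive x 1 (fun y => expR (g y)) (expR (g x) * b).
Proof. by move=> gb; apply: der_comp => //; exact: is_derive_expR. Qed.

Lemma der_continuous f (df : R -> R) : (forall x : R, is_derive x 1 f (df x)) ->
  continuous f.
Proof.
by move=> h x; apply/differentiable_continuous/derivable1_diffP; exact: ex_derive.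
Qed.

Lemma der_mvt f (df : R -> R) x y (C : R) : (forall z : R, is_derive z 1 f (df z)) ->
  (forall z, Num.min x y <= z <= Num.max x y -> `|df z| <= C) ->
  `|f y - f x| <= C * `|y - x|.
Proof.
move=> h dC; wlog xy : x y dC / x <= y.
  move=> wl; have [/wl->//|/ltW yx] := leP x y.
  rewrite distrC [`|y - x|]distrC; apply: wl => //.
  by move=> z; rewrite minC maxC; exact: dC.
have [z zxy ->] := @MVT_segment R f df x y xy (fun z _ => h z)
  (continuous_subspaceT (der_continuous h)).
rewrite normrM ler_wpM2r//; apply: dC.
by rewrite (min_idPl xy) (max_idPr xy); move: zxy; rewrite in_itv.
Qed.

Lemma der_FTC f (df : R -> R) a b : a <= b -> (forall z : R, is_derive z 1 f (df z)) ->
  continuous df ->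
  \int[lebesgue_measure]_(x in `[a, b]) df x = f b - f a.
Proof.
rewrite le_eqVlt => /predU1P[<-|ab] h cdf.
  by rewrite set_itv1 Rintegral_set1 subrr.
have cf := der_continuous h.
rewrite /Rintegral (@continuous_FTC2 _ df f)//=.
- exact: continuous_subspaceT.
- split.
  + by move=> x _; exact: ex_derive.
  + exact/cvg_at_right_filter/cf.
  + exact/cvg_at_left_filter/cf.
- by move=> x _; rewrite derive1E; exact: derive_val.
Qed.
End derive_pointwise.

(** * Integrable random variables *)

Lemma sqr_le_pow4 (R : realFieldType) (x : R) : x ^+ 2 <= 1 + x ^+ 4.
Proof. have := sqr_ge0 (x ^+ 2 - 2^-1); nra. Qed.

Lemma normr_le_pow4 (R : realFieldType) (x : R) : `|x| <= 1 + x ^+ 4.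
Proof.
have x2 : `|x| <= 4^-1 + x ^+ 2.
  have h1 := sqr_ge0 (x - 2^-1); have h2 := sqr_ge0 (x + 2^-1).
  by rewrite ler_norml; apply/andP; split; nra.
have := sqr_ge0 (x ^+ 2 - 2^-1); nra.
Qed.

Section bigsum_integral.
Context (R : realType) d (T : measurableType d) (mu : {measure set T -> \bar R}).
Variables (D : set T) (mD : measurable D).
Variables (I : Type) (r : seq I) (p : pred I) (F : I -> T -> R).
Hypothesis iF : forall i, p i -> mu.-integrable D (EFin \o F i).

Lemma integrable_bigsum :
  mu.-integrable D (EFin \o (fun w => \sum_(i <- r | p i) F i w)).
Proof.
elim: r => [|i s IH].
  apply: (eq_integrable _ (cst 0%E)) => //; last exact: integrable0.
  by move=> w _ /=; rewrite big_nil.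
case: (boolP (p i)) => pi.
- apply: (eq_integrable _ (EFin \o (fun w => F i w + \sum_(i <- s | p i) F i w))) => //.
    by move=> w _ /=; rewrite big_cons pi.
  by have := integrableD mD (iF pi) IH.
- apply: (eq_integrable _ (EFin \o (fun w => \sum_(i <- s | p i) F i w))) => //.
  by move=> w _ /=; rewrite big_cons (negbTE pi).
Qed.

End bigsum_integral.

Lemma Rintegral_bigsum (R : realType) d (T : measurableType d)
  (mu : {measure set T -> \bar R}) (D : set T) (mD : measurable D)
  (I : Type) (r : seq I) (p : pred I) (F : I -> T -> R) :
  (forall i, p i -> mu.-integrable D (EFin \o F i)) ->
  \int[mu]_(w in D) (\sum_(i <- r | p i) F i w) =
  \sum_(i <- r | p i) \int[mu]_(w in D) F i w.
Proof.
move=> iF; elim: r => [|i r IH].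
  rewrite big_nil (@eq_Rintegral _ _ _ mu _ (cst 0)).
    by rewrite Rintegral_cst// mul0r.
  by move=> w _ /=; rewrite big_nil.
rewrite big_cons; under eq_Rintegral do rewrite big_cons.
case: ifPn => pi; last exact: IH.
by rewrite RintegralD ?IH//; [exact: iF|exact: integrable_bigsum].
Qed.

Section integrable_rv.
Context (R : realType) d (Omega : measurableType d) (P : probability Omega R).
Implicit Types X Y : Omega -> R.

Notation L1 X := (P.-integrable setT (EFin \o X)).

Lemma integrable_dom X Y : measurable_fun setT X -> L1 Y ->
  (forall w, `|X w| <= Y w) -> L1 X.
Proof.
move=> mX iY XY; apply: (le_integrable measurableT _ _ iY).
  exact/measurable_EFinP.
by move=> w _ /=; rewrite lee_fin (le_trans (XY w))// ler_norm.
Qed.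

Lemma integrable_bounded X C : measurable_fun setT X ->
  (forall w, `|X w| <= C) -> L1 X.
Proof.
move=> mX XC; apply: (@integrable_dom X (cst C)) => //.
exact: finite_measure_integrable_cst.
Qed.

Lemma measurable_integrable X : L1 X -> measurable_fun setT X.
Proof. by case/integrableP => /measurable_EFinP. Qed.

Lemma integrable_add X Y : L1 X -> L1 Y -> L1 (fun w => X w + Y w).
Proof. by move=> iX iY; have := integrableD measurableT iX iY. Qed.

Lemma integrable_sub X Y : L1 X -> L1 Y -> L1 (fun w => X w - Y w).
Proof. by move=> iX iY; have := integrableB measurableT iX iY. Qed.

Lemma integrable_scale c X : L1 X -> L1 (fun w => c * X w).
Proof.
by move=> iX; have := integrableZl measurableT c iX.
Qed.

Lemma Rintegral_prob_cst c : \int[P]_w c = c.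
Proof. by rewrite Rintegral_cst//= probability_setT/= mulr1. Qed.

Lemma Rintegral_bounded X C : measurable_fun setT X ->
  (forall w, `|X w| <= C) -> `|\int[P]_w X w| <= C.
Proof.
move=> mX XC; have iX := integrable_bounded mX XC.
apply: (le_trans (le_normr_Rintegral measurableT iX)).
rewrite -[leRHS]Rintegral_prob_cst; apply: le_Rintegral => //.
  by apply: (@integrable_bounded _ C);
    [exact: measurableT_comp|move=> w; rewrite normr_id].
exact: finite_measure_integrable_cst.
Qed.

End integrable_rv.

Section independence.
Context (R : realType) d (Omega : measurableType d) (P : probability Omega R).

Lemma indep_integral_mul (X Y : Omega -> R) :
  (forall A B, measurable A -> measurable B ->
    P (X @^-1` A `&` Y @^-1` B) = (P (X @^-1` A) * P (Y @^-1` B))%E) ->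
  P.-integrable setT (EFin \o X) -> P.-integrable setT (EFin \o Y) ->
  P.-integrable setT (EFin \o (fun w => X w * Y w)) /\
  \int[P]_w (X w * Y w) = \int[P]_w X w * \int[P]_w Y w.
Proof.
move=> XY iX iY.
have mX := measurable_integrable iX.
have mY := measurable_integrable iY.
pose Z w := (X w, Y w).
have mZ : measurable_fun setT Z by exact: measurable_fun_pair.
pose X' : {mfun Omega >-> R} := HB.pack X (isMeasurableFun.Build _ _ _ _ X mX).
pose Y' : {mfun Omega >-> R} := HB.pack Y (isMeasurableFun.Build _ _ _ _ Y mY).
pose Z' : {mfun Omega >-> (R * R)%type} :=
  HB.pack Z (isMeasurableFun.Build _ _ _ _ Z mZ).
pose mu : probability R R := distribution P X'.
pose nu : probability R R := distribution P Y'.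
have E : forall C, measurable C -> (mu \x nu)%E C = distribution P Z' C.
  by apply: product_measure_unique => A B mA mB; exact: XY.
pose f (z : R * R) := (z.1 * z.2)%:E.
have mf : measurable_fun setT f.
  by apply/measurable_EFinP/measurable_funM;
    [exact: measurable_fst|exact: measurable_snd].
have iX1 : mu.-integrable setT (EFin : R -> \bar R).
  by apply: (@integrable_pushforward _ _ _ _ _ X' mX P).
have iY1 : nu.-integrable setT (EFin : R -> \bar R).
  by apply: (@integrable_pushforward _ _ _ _ _ Y' mY P).
have EX : (\int[mu]_x x%:E = (\int[P]_w X w)%:E)%E.
  rewrite /Rintegral fineK; last exact: integrable_fin_num.
  by rewrite (@integral_pushforward _ _ _ _ _ X' mX P).
have EY : (\int[nu]_x x%:E = (\int[P]_w Y w)%:E)%E.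
  rewrite /Rintegral fineK; last exact: integrable_fin_num.
  by rewrite (@integral_pushforward _ _ _ _ _ Y' mY P).
have if_ : (mu \x nu)%E.-integrable setT f.
  apply/integrable12ltyP => //.
  rewrite (eq_integral (fun x : R => (`|x%:E| * \int[nu]_y `|y%:E|)%E)); last first.
    move=> x _; rewrite -ge0_integralZl//.
      by apply: eq_integral => y _; rewrite /f/= -EFinM normrM.
    exact: measurableT_comp.
  move/integrableP : iX1 => [_ iX1]; move/integrableP : iY1 => [_ iY1].
  rewrite ge0_integralZr//; [|exact: measurableT_comp|exact: integral_ge0].
  by rewrite lte_mul_pinfty//; [exact: integral_ge0|rewrite ge0_fin_numE ?integral_ge0].
have iZ : (distribution P Z').-integrable setT f.
  apply/integrableP; split => //; move/integrableP : if_ => [_].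
  apply: le_lt_trans; rewrite le_eqVlt; apply/orP; left; apply/eqP.
  by apply: eq_measure_integral => C mC _; exact: esym (E C mC).
have iXY : P.-integrable setT (EFin \o (fun w => X w * Y w)).
  apply/integrableP; split; first exact/measurable_EFinP/measurable_funM.
  move/integrableP : iZ => [_].
  by rewrite ge0_integral_distribution//; exact: measurableT_comp.
split => //; apply: EFin_inj.
rewrite {1}/Rintegral fineK; last exact: integrable_fin_num.
rewrite -[LHS]/(\int[P]_w (f \o Z') w)%E -integral_distribution//.
rewrite (eq_measure_integral (mu \x nu)%E); last by move=> C mC _; exact: esym (E C mC).
rewrite -integral12_prod_meas1//= /fubini_F/=.
rewrite (eq_integral (fun x : R => (x%:E * (\int[P]_w Y w)%:E)%E)); last first.
  move=> x _; rewrite -EY -integralZl//.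
by rewrite integralZr// EX EFinM.
Qed.
End independence.

(** * Independence from the past *)

Section past_independence.
Context (R : realType) d (Omega : measurableType d) (P : probability Omega R).

(** Dynkin's argument: both sides are finite measures in [A], and they agree on a
    family stable under intersection. *)
Lemma indep_sigma_pi (G : set (set Omega)) (E : set Omega) :
  measurable E -> setI_closed G -> G `<=` measurable ->
  (forall A, G A -> P (A `&` E) = (P A * P E)%E) ->
  forall A, <<s G >> A -> measurable A /\ P (A `&` E) = (P A * P E)%E.
Proof.
move=> mE GI Gm GE A; rewrite -setI_closed_g_dynkin_g_sigma_algebra//.
have [e eE] : exists e, P E = e%:E.
  by exists (fine (P E)); rewrite fineK// fin_num_measure.
suff dH : dynkin [set A | measurable A /\ P (A `&` E) = (P A * P E)%E].
  by apply: (smallest_sub dH) => B GB; split; [exact: Gm|exact: GE].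
split.
- by split => //; rewrite setTI probability_setT mul1e.
- move=> B [mB BE]; split; first exact: measurableC.
  rewrite probability_setC// muleBl ?fin_num_measure// mul1e -BE.
  by rewrite setIC -setDE measureD// ?ltey_eq ?fin_num_measure// setIC.
- move=> F tF FE; split; first by apply: bigcupT_measurable => n; case: (FE n).
  rewrite setI_bigcupl measure_bigcup//; last 2 first.
  + by move=> n _; apply: measurableI => //; case: (FE n).
  + apply: trivIset_setIr => //.
  rewrite measure_bigcup//; last by move=> n _; case: (FE n).
  rewrite muleC eE -nneseriesZl//.
  by apply: eq_eseriesr => n _; rewrite muleC -eE; case: (FE n).
Qed.

Lemma ae_measure_eq (A B : set Omega) : measurable A -> measurable B ->
  {ae P, forall w, A w <-> B w} -> P A = P B.
Proof.
move=> mA mB AB; rewrite -(setIT A) -(setIT B) -!integral_indic//.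
apply: ae_eq_integral => //.
- exact/measurable_EFinP/measurable_indic.
- exact/measurable_EFinP/measurable_indic.
- apply: filterS AB => w AB _; rewrite !indicE; congr (_%:R%:E).
  by congr nat_of_bool; apply/idP/idP; rewrite !inE => /AB.
Qed.

Variables (T : R) (Y : R -> Omega -> R).
Hypothesis mY : forall t, 0 <= t <= T -> measurable_fun setT (Y t).
Hypothesis indY : independent_increments P T Y.

(** The events that concern finitely many increments over consecutive intervals of a
    grid: the given product rule makes them independent of the next increment. *)
Let incr_rect (g : nat -> R) n : set (set Omega) := [set A | exists C : nat -> set R,
  (forall i, measurable (C i)) /\
  A = [set w | forall i, (i < n)%N -> C i (Y (g i.+1) w - Y (g i) w)]].

Let measurable_incr_event s t B : 0 <= s <= T -> 0 <= t <= T -> measurable B ->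
  measurable [set w | B (Y t w - Y s w)].
Proof.
move=> s0T t0T mB; rewrite -[X in measurable X]setTI.
by apply: (measurable_funB (mY t0T) (mY s0T)).
Qed.

Let grid_le (g : nat -> R) n : (forall i, (i < n)%N -> g i <= g i.+1) ->
  forall i j, (i <= j <= n)%N -> g i <= g j.
Proof.
move=> gle i j; elim: j => [|j IH]; first by rewrite leqn0 => /andP[/eqP->].
case/andP; rewrite leq_eqVlt => /predU1P[->//|ij jn].
by apply: le_trans (gle _ jn); apply: IH; rewrite -ltnS ij (ltnW jn).
Qed.

Let incr_rect_measurable (g : nat -> R) n : 0 <= g 0%N ->
  (forall i, (i < n)%N -> g i <= g i.+1) -> g n <= T ->
  incr_rect g n `<=` measurable.
Proof.
move=> g0 gle gn A [C [mC ->]].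
rewrite [X in measurable X](_ : _ = \bigcap_(i < n)
    [set w | C i (Y (g i.+1) w - Y (g i) w)]); last first.
  by apply/seteqP; split => w /= h i /h.
apply: bigcap_measurableType => //= i /= ni; apply: measurable_incr_event => //.
  apply/andP; split; first by rewrite (le_trans g0)// (grid_le gle)// (ltnW ni).
  by apply: le_trans gn; rewrite (grid_le gle)// leqnn (ltnW ni).
apply/andP; split; first by rewrite (le_trans g0)// (grid_le gle).
by apply: le_trans gn; rewrite (grid_le gle)// leqnn ni.
Qed.

Let incr_sigma_indep (g : nat -> R) n t B : 0 <= g 0%N ->
  (forall i, (i < n)%N -> g i <= g i.+1) -> g n <= t -> t <= T ->
  measurable B -> forall A, <<s incr_rect g n >> A ->
  measurable A /\ P (A `&` [set w | B (Y t w - Y (g n) w)]) =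
                  (P A * P [set w | B (Y t w - Y (g n) w)%R])%E.
Proof.
move=> g0 gle gnt tT mB.
have gn0 : 0 <= g n by rewrite (le_trans g0)// (grid_le gle)//= leqnn.
apply: indep_sigma_pi.
- apply: measurable_incr_event => //; first by rewrite gn0 (le_trans gnt).
  by rewrite tT (le_trans gn0).
- move=> _ _ [C [mC ->]] [D [mD ->]]; exists (fun i => C i `&` D i); split.
    by move=> i; exact: measurableI.
  apply/seteqP; split=> w /=; first by case=> hC hD i ni; split; [exact: hC|exact: hD].
  by move=> h; split=> i /h[].
- exact: incr_rect_measurable g0 gle (le_trans gnt tT).
move=> _ [C [mC ->]].
pose g' i := if (i <= n)%N then g i else t.
pose B' i := if (i < n)%N then C i else B.
have g'n i : (i <= n)%N -> g' i = g i by rewrite /g' => ->.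
have g't : g' n.+1 = t by rewrite /g' ltnn.
have g'le i : (i < n.+1)%N -> g' i <= g' i.+1.
  rewrite ltnS leq_eqVlt => /predU1P[->|ni]; first by rewrite g't g'n.
  by rewrite !g'n ?(ltnW ni)// gle.
have mB' i : measurable (B' i) by rewrite /B'; case: ifP.
have := @indY n.+1 g' B'; rewrite g'n// g't => /(_ g0 g'le tT mB').
rewrite big_ord_recr/= g't g'n// {3}/B' ltnn => h.
have := @indY n g C g0 gle (le_trans gnt tT) mC => ->.
rewrite (_ : _ `&` _ = [set w | forall i, (i < n.+1)%N ->
    B' i (Y (g' i.+1) w - Y (g' i) w)]); last first.
  apply/seteqP; split=> w /=.
    move=> [hC hB] i; rewrite ltnS leq_eqVlt => /predU1P[->|ni].
      by rewrite g't g'n// /B' ltnn.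
    by rewrite !g'n ?(ltnW ni)// /B' ni; exact: hC.
  move=> hB; split=> [i ni|].
    by have := hB i; rewrite !g'n ?(ltnW ni)// /B' ni ltnS (ltnW ni); exact.
  by have := hB n; rewrite g't g'n// /B' ltnn ltnSn; exact.
rewrite h; congr (_ * _)%E; apply: eq_bigr => i _.
by rewrite !g'n ?(ltnW (ltn_ord i))// /B' ltn_ord.
Qed.

(** The past up to time [s] is generated by these events, which constrain the values of
    the process at finitely many, possibly unordered, times. *)
Let cyl s : set (set Omega) := [set A | exists n (tt : nat -> R) (D : nat -> set R),
  [/\ (forall i, (i < n)%N -> 0 <= tt i <= s), (forall i, measurable (D i)) &
  A = [set w | forall i, (i < n)%N -> D i (Y (tt i) w)]]].

Let incr_sigma_measurable (g : nat -> R) n (k : nat) : (k <= n)%N ->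
  @measurable_fun _ _ (g_sigma_algebraType (incr_rect g n)) R setT
    (fun w => Y (g k) w - Y (g 0%N) w).
Proof.
move=> kn.
have -> : (fun w => Y (g k) w - Y (g 0%N) w) =
    (fun w => \sum_(j < k) (Y (g j.+1) w - Y (g j) w)).
  apply/funext => w.
  by rewrite -(big_mkord xpredT (fun j => Y (g j.+1) w - Y (g j) w)) telescope_sumr.
apply: measurable_sum => j _ B mB; rewrite setTI; apply: sub_sigma_algebra.
exists (fun i => if i == j :> nat then B else setT); split.
  by move=> i; case: ifP.
apply/seteqP; split=> w /= h => [i ni|].
  by case: eqP => // ->.
by have := h j; rewrite eqxx; apply; exact: leq_trans (ltn_ord j) kn.
Qed.

Hypothesis Y0 : {ae P, forall w, Y 0 w = 0}.

(** Sorting the times and adding [0] and [s] turns the values of the process into sums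
    of increments over a grid, because the process starts from [0] almost surely. *)
Let cyl_indep s t B : 0 <= s -> s <= t -> t <= T -> measurable B ->
  forall A, cyl s A -> P (A `&` [set w | B (Y t w - Y s w)]) =
     (P A * P [set w | B (Y t w - Y s w)%R])%E.
Proof.
move=> s0 st tT mB _ [n [tt [D [tt0 mD ->]]]].
pose ts := sort <=%R [seq tt i | i <- iota 0 n].
pose L := 0 :: rcons ts s.
pose g i := nth s L i.
have sts : size ts = n by rewrite size_sort size_map size_iota.
have tsP r : r \in ts -> 0 <= r <= s.
  rewrite mem_sort => /mapP[i]; rewrite mem_iota add0n => /= ni ->; exact: tt0.
have sL : sorted <=%R L.
  rewrite /L /= rcons_path; apply/andP; split.
    rewrite path_sortedE; last exact: le_trans.
    rewrite sort_le_sorted andbT; apply/allP => r /tsP/andP[]//.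
  have : last 0 ts \in 0 :: ts by exact: mem_last.
  by rewrite inE => /predU1P[->//|/tsP/andP[]].
have gn : g n.+1 = s by rewrite /g /L /= nth_rcons sts ltnn eqxx.
have gle i : (i < n.+1)%N -> g i <= g i.+1.
  move=> ni; apply: (sorted_leq_nth le_trans lexx _ sL) => //;
   by rewrite inE /= size_rcons sts ltnS // ltnW.
have gtt i : (i < n)%N -> exists k, (k <= n.+1)%N /\ tt i = g k.
  move=> ni; have tin : tt i \in L.
    rewrite inE mem_rcons inE mem_sort; apply/orP; right; apply/orP; right.
    by apply/mapP; exists i => //; rewrite mem_iota.
  exists (index (tt i) L); rewrite /g nth_index//; split => //.
  by rewrite -ltnS; move: tin; rewrite -index_mem /= size_rcons sts.
pose A0 := [set w | forall i, (i < n)%N -> D i (Y (tt i) w)].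
pose A1 := [set w | forall i, (i < n)%N -> D i (Y (tt i) w - Y 0 w)].
have T0 : 0 <= T by rewrite (le_trans s0)// (le_trans st).
have mA0 : measurable A0.
  rewrite (_ : A0 = \bigcap_(i < n) (Y (tt i) @^-1` D i)).
    apply: bigcap_measurableType => //= i ni; rewrite -[X in measurable X]setTI.
    have /andP[? ?] := tt0 i ni.
    by apply: mY => //; apply/andP; split => //; rewrite (le_trans _ (le_trans st tT)).
  by apply/seteqP; split=> w /= h i /h.
have sA1 : <<s incr_rect g n.+1 >> A1.
  suff : @measurable _ (g_sigma_algebraType (incr_rect g n.+1)) A1 by [].
  rewrite (_ : A1 = \bigcap_(i < n) ((fun w => Y (tt i) w - Y 0 w) @^-1` D i)).
    apply: bigcap_measurableType => //= i ni.
    have [k [kn ->]] := gtt i ni.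
    rewrite -[X in measurable X]setTI.
    exact: (incr_sigma_measurable kn measurableT (mD i)).
  by apply/seteqP; split=> w /= h i /h.
have := incr_sigma_indep (lexx 0) gle _ tT mB sA1.
rewrite gn => /(_ st)[mA1 E].
have mE : measurable [set w | B (Y t w - Y s w)].
  apply: measurable_incr_event => //; first by rewrite s0 (le_trans st).
  by rewrite tT (le_trans s0).
have PA X : measurable X -> P (A0 `&` X) = P (A1 `&` X).
  move=> mX; apply: ae_measure_eq; [exact: measurableI..|].
  apply: filterS Y0 => w Y0w; rewrite /A0 /A1 /=.
  by under [X in _ <-> (X /\ _)]eq_forall do rewrite Y0w subr0.
rewrite PA// E; congr (_ * _)%E; apply/esym.
by have := PA setT measurableT; rewrite !setIT.
Qed.

Let cylI s : setI_closed (cyl s).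
Proof.
move=> _ _ [n [t1 [C [t1s mC ->]]]] [m [t2 [D [t2s mD ->]]]].
exists (n + m)%N, (fun i => if (i < n)%N then t1 i else t2 (i - n)%N),
  (fun i => if (i < n)%N then C i else D (i - n)%N); split.
- move=> i inm; case: ltnP => ni; first exact: t1s.
  by apply: t2s; rewrite ltn_subLR.
- by move=> i; case: ifP.
apply/seteqP; split=> w /=.
  move=> [hC hD] i inm; case: ltnP => ni; first exact: hC.
  by apply: hD; rewrite ltn_subLR.
move=> h; split=> i ni; first by have := h i; rewrite ni; apply; rewrite ltn_addr.
have := h (n + i)%N; rewrite ltn_add2l => /(_ ni).
by rewrite ltnNge leq_addr/= addKn.
Qed.

(** The cylinder events are stable under intersection and generate the past. *)
Lemma past_indep s t B : 0 <= s -> s <= t -> t <= T -> measurable B ->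
  forall A, natural_filtration Y s A -> measurable A /\
    P (A `&` [set w | B (Y t w - Y s w)]) =
     (P A * P [set w | B (Y t w - Y s w)%R])%E.
Proof.
move=> s0 st tT mB A sA; apply: (@indep_sigma_pi (cyl s)).
- apply: measurable_incr_event => //; first by rewrite s0 (le_trans st).
  by rewrite tT (le_trans s0).
- exact: cylI.
- move=> _ [n [tt [D [tt0 mD ->]]]].
  rewrite (_ : mkset _ = \bigcap_(i < n) (Y (tt i) @^-1` D i)).
    apply: bigcap_measurableType => //= i ni; rewrite -[X in measurable X]setTI.
    have /andP[? ?] := tt0 i ni.
    by apply: mY => //; apply/andP; split => //; rewrite (le_trans _ (le_trans st tT)).
  by apply/seteqP; split=> w /= h i /h.
- exact: cyl_indep.
move: A sA; apply: sub_sigma_algebra2 => _ [r [C [r0s mC ->]]].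
exists 1%N, (fun=> r), (fun=> C); split => //.
by apply/seteqP; split=> w /= h //; exact: (h 0%N).
Qed.

Definition adapted (s : R) (eta : Omega -> R) :=
  forall B, measurable B -> natural_filtration Y s (eta @^-1` B).

Lemma adapted_measurable s eta : 0 <= s <= T -> adapted s eta ->
  measurable_fun setT eta.
Proof.
move=> /andP[s0 sT] ad _ B mB; rewrite setTI.
by have [] := past_indep s0 (lexx s) sT mB (ad _ mB).
Qed.

(** [eta] depends on the past only, so it is independent of the increment. *)
Lemma adapted_indep s t (eta : Omega -> R) (h : R -> R) :
  0 <= s -> s <= t -> t <= T -> adapted s eta ->
  measurable_fun setT h ->
  P.-integrable setT (EFin \o eta) ->
  P.-integrable setT (EFin \o (fun w => h (Y t w - Y s w))) ->
  P.-integrable setT (EFin \o (fun w => eta w * h (Y t w - Y s w))) /\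
  \int[P]_w (eta w * h (Y t w - Y s w)) =
  \int[P]_w eta w * \int[P]_w h (Y t w - Y s w).
Proof.
move=> s0 st tT ad mh ie ih; apply: indep_integral_mul => // A B mA mB.
have mhB : measurable (h @^-1` B) by rewrite -[X in measurable X]setTI; exact: mh.
by have [] := past_indep s0 st tT mhB (ad _ mA).
Qed.

(* natural_filtration as the sigma-algebra of a measurable type, so that the
   closure properties of measurable functions apply. *)
Let past_gen s : set (set Omega) := [set A | exists r B,
  [/\ 0 <= r <= s, measurable B & A = Y r @^-1` B]].

Lemma adaptedP s eta : adapted s eta <->
  @measurable_fun _ _ (g_sigma_algebraType (past_gen s)) R setT eta.
Proof.
split=> [ad _ B mB|mf B mB]; first by rewrite setTI; exact: ad.
by have := mf measurableT B mB; rewrite setTI.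
Qed.

Lemma adapted_process s r : 0 <= r <= s -> adapted s (Y r).
Proof. by move=> rs B mB; apply: sub_sigma_algebra; exists r, B. Qed.

Lemma adapted_cst s c : adapted s (cst c).
Proof. by apply/adaptedP; exact: measurable_cst. Qed.

Lemma adaptedD s e1 e2 : adapted s e1 -> adapted s e2 ->
  adapted s (fun w => e1 w + e2 w).
Proof. by move=> /adaptedP h1 /adaptedP h2; apply/adaptedP; exact: measurable_funD. Qed.

Lemma adaptedM s e1 e2 : adapted s e1 -> adapted s e2 ->
  adapted s (fun w => e1 w * e2 w).
Proof. by move=> /adaptedP h1 /adaptedP h2; apply/adaptedP; exact: measurable_funM. Qed.

Lemma adapted_comp s (h : R -> R) eta : measurable_fun setT h -> adapted s eta ->
  adapted s (fun w => h (eta w)).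
Proof.
by move=> mh /adaptedP h1; apply/adaptedP; exact: measurableT_comp.
Qed.

Lemma adapted_le s t eta : s <= t -> adapted s eta -> adapted t eta.
Proof.
move=> st ad B mB; have := ad _ mB; apply: sub_sigma_algebra2.
move=> _ [r [C [/andP[r0 rs] mC ->]]].
by exists r, C; rewrite r0 (le_trans rs).
Qed.

End past_independence.

(** * Moments of the Poisson law *)

Section poisson_moments.
Context (R : realType) d (Omega : measurableType d) (P : probability Omega R).
Variables (N : Omega -> nat) (l : R).
Hypotheses (l_gt0 : 0 < l) (mN : measurable_fun setT N).
Hypothesis PN : forall k, P [set w | N w = k] = (poisson_pmf l k)%:E.

Let ge0_integral_poisson (h : nat -> R) : (forall k, 0 <= h k) ->
  (\int[P]_w (h (N w))%:E = \sum_(k <oo) (h k * poisson_pmf l k)%:E)%E.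
Proof.
move=> h0.
have mNk k : measurable [set w | N w = k].
  by rewrite -[X in measurable X]setTI; have := @mN measurableT [set k]; apply.
have U : setT = \bigcup_k [set w | N w = k].
  by apply/seteqP; split=> w // _; exists (N w).
have mh : measurable_fun setT (fun w => (h (N w))%:E).
  by apply/measurable_EFinP; apply: (measurableT_comp (f := h)).
rewrite {1}U ge0_integral_bigcup//; last 3 first.
- by rewrite -U.
- by move=> w _; rewrite lee_fin.
- by move=> i j _ _ [w [/= <- <-]].
apply: eq_eseriesr => k _.
rewrite (eq_integral (cst (h k)%:E)); last by move=> w; rewrite inE /= => ->.
rewrite integral_cst// EFinM; congr (_ * _)%E; exact: PN.
Qed.

(** The falling factorial cancels the first factors of [k`!] in the Poisson weights;
    what is left is the total mass, shifted by [j]. *)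
Let ffact_moment j : (\int[P]_w ((N w ^_ j)%:R%:E : \bar R) = (l ^+ j)%:E)%E.
Proof.
rewrite (ge0_integral_poisson (h := fun k => (k ^_ j)%:R))//.
elim: j => [|j IH].
  under eq_eseriesr do rewrite ffactn0.
  rewrite -(ge0_integral_poisson (h := fun=> 1))//.
  by rewrite integral_cst//= probability_setT mule1.
rewrite nneseries_recl//; last first.
  by move=> k _; rewrite lee_fin mulr_ge0// poisson_pmf_ge0.
rewrite ffact0n/= mul0r add0e -nneseries_addn; last first.
  by move=> k; rewrite lee_fin mulr_ge0// poisson_pmf_ge0.
rewrite exprS EFinM -IH -nneseriesZl; last first.
  by move=> k _; rewrite lee_fin mulr_ge0// poisson_pmf_ge0.
apply: eq_eseriesr => k _; rewrite addn1 ffactSS natrM -EFinM /poisson_pmf l_gt0.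
congr EFin; rewrite factS natrM invfM exprS.
have : (k.+1%:R : R) != 0 by rewrite pnatr_eq0.
by move: (k.+1%:R) (k`!%:R^-1) => c f c0; field.
Qed.

Let integrable_ffact j : P.-integrable setT (EFin \o (fun w => ((N w) ^_ j)%:R : R)).
Proof.
apply/integrableP; split.
  by apply/measurable_EFinP; apply: (measurableT_comp (f := fun k : nat => ((k ^_ j)%:R : R))).
by under eq_integral do rewrite /= ger0_norm//; rewrite ffact_moment ltry.
Qed.

Let Rffact_moment j : \int[P]_w ((N w ^_ j)%:R) = l ^+ j.
Proof. by rewrite /Rintegral ffact_moment. Qed.

Let ffactE (k : nat) : [/\ (k%:R = (k ^_ 1)%:R :> R),
  (k%:R ^+ 2 = (k ^_ 2)%:R + (k ^_ 1)%:R :> R),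
  (k%:R ^+ 3 = (k ^_ 3)%:R + 3 * (k ^_ 2)%:R + (k ^_ 1)%:R :> R) &
  (k%:R ^+ 4 = (k ^_ 4)%:R + 6 * (k ^_ 3)%:R + 7 * (k ^_ 2)%:R + (k ^_ 1)%:R :> R)].
Proof.
have E j : ((k ^_ j.+1)%:R = (k ^_ j)%:R * (k%:R - j%:R) :> R).
  rewrite ffactnSr; have [jk|kj] := leqP j k; first by rewrite natrM natrB.
  by rewrite ffact_small// mul0n mul0r.
by rewrite !E ffactn0; split; ring.
Qed.

(** Centred powers are linear combinations of falling factorials, whose means are the
    powers of the parameter. *)
Lemma poisson_centered_moments :
  [/\ P.-integrable setT (EFin \o (fun w => ((N w)%:R - l) ^+ 4)),
  \int[P]_w ((N w)%:R - l) = 0,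
  \int[P]_w (((N w)%:R - l) ^+ 2) = l &
  \int[P]_w (((N w)%:R - l) ^+ 4) = l + 3 * l ^+ 2].
Proof.
pose F (j : 'I_5) w : R := ((N w) ^_ j)%:R.
have key (c : 'I_5 -> R) (h : Omega -> R) : (forall w, h w = \sum_j c j * F j w) ->
   P.-integrable setT (EFin \o h) /\ \int[P]_w h w = \sum_j c j * l ^+ j.
  move=> hE; have -> : h = fun w => \sum_j c j * F j w by apply/funext.
  have iF j : P.-integrable setT (EFin \o (fun w => c j * F j w)).
    exact: integrable_scale (integrable_ffact j).
  split; first exact: integrable_bigsum.
  rewrite Rintegral_bigsum//; apply: eq_bigr => j _.
  by rewrite RintegralZl//; [rewrite Rffact_moment|exact: integrable_ffact].
pose c1 (j : 'I_5) : R := nth 0 [:: - l; 1; 0; 0; 0] j.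
pose c2 (j : 'I_5) : R := nth 0 [:: l ^+ 2; 1 - 2 * l; 1; 0; 0] j.
pose c4 (j : 'I_5) : R := nth 0 [:: l ^+ 4; 1 - 4 * l + 6 * l ^+ 2 - 4 * l ^+ 3;
  7 - 12 * l + 6 * l ^+ 2; 6 - 4 * l; 1] j.
have [_ E1] : P.-integrable setT (EFin \o (fun w => (N w)%:R - l)) /\
    \int[P]_w ((N w)%:R - l) = \sum_j c1 j * l ^+ j.
  apply: key => w; have [-> _ _ _] := ffactE (N w).
  by rewrite !big_ord_recr big_ord0 /F /c1/= ffactn0; ring.
have [_ E2] : P.-integrable setT (EFin \o (fun w => ((N w)%:R - l) ^+ 2)) /\
    \int[P]_w (((N w)%:R - l) ^+ 2) = \sum_j c2 j * l ^+ j.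
  apply: key => w; have [e1 e2 _ _] := ffactE (N w).
  by rewrite sqrrB e2 {1}e1 !big_ord_recr big_ord0 /F /c2/= ffactn0; ring.
have [i4 E4] : P.-integrable setT (EFin \o (fun w => ((N w)%:R - l) ^+ 4)) /\
    \int[P]_w (((N w)%:R - l) ^+ 4) = \sum_j c4 j * l ^+ j.
  apply: key => w; have [e1 e2 e3 e4] := ffactE (N w).
  have -> : ((N w)%:R - l) ^+ 4 = (N w)%:R ^+ 4 - 4 * l * (N w)%:R ^+ 3
     + 6 * l ^+ 2 * (N w)%:R ^+ 2 - 4 * l ^+ 3 * (N w)%:R + l ^+ 4 by ring.
  by rewrite e4 e3 e2 {1}e1 !big_ord_recr big_ord0 /F /c4/= ffactn0; ring.
split => //; rewrite ?E1 ?E2 ?E4 !big_ord_recr big_ord0 /c1 /c2 /c4 /=; ring.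
Qed.

End poisson_moments.

(** * Moments of the normal law *)

Section gaussian_moments.
Context (R : realType).
Variable s : R.
Hypothesis s_gt0 : 0 < s.
Let mu := @lebesgue_measure R.
Let p := normal_pdf 0 s.

Let p_ge0 x : 0 <= p x. Proof. exact: normal_pdf_ge0. Qed.
Let mp : measurable_fun setT p. Proof. exact: measurable_normal_pdf. Qed.
Let s_neq0 : s != 0. Proof. by rewrite gt_eqF. Qed.

Let ge0_integral_normal (f : R -> R) : measurable_fun setT f ->
  (forall x, 0 <= f x) ->
  (\int[normal_prob 0%R s]_x (f x)%:E = \int[mu]_x (f x * p x)%:E)%E.
Proof.
move=> mf f0; have dom := @normal_prob_dominates R 0 s.
have f0' x : (0 <= (f x)%:E)%E by rewrite lee_fin.
have mf' : measurable_fun setT (fun x => (f x)%:E) by exact/measurable_EFinP.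
rewrite -(Radon_Nikodym_SigmaFinite.change_of_variables dom f0' measurableT mf').
have mRN := measurable_int _ (Radon_Nikodym_SigmaFinite.f_integrable dom).
apply: ae_eq_integral => //.
- by apply: emeasurable_funM => //; exact/measurable_EFinP.
- by apply/measurable_EFinP/measurable_funM.
suff h : ae_eq mu setT (Radon_Nikodym_SigmaFinite.f (normal_prob 0 s) mu) (EFin \o p).
  by apply: filterS h => x /= /[apply] ->.
apply: integral_ae_eq => //.
- exact: Radon_Nikodym_SigmaFinite.f_integrable.
- exact/measurable_EFinP.
- by move=> E _ mE; rewrite -Radon_Nikodym_SigmaFinite.f_integral.
Qed.

Let pE : p = fun x => normal_peak s * expR (- (s ^+ 2 *+ 2)^-1 * (x * x)).
Proof.
apply/funext => x; rewrite /p normal_pdfE// /normal_fun subr0 -expr2.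
by congr (_ * expR _); rewrite mulNr mulNr mulrC.
Qed.

(** The density satisfies [p' = - (x / s^2) p], so that moments follow by integration by
    parts. *)
Let der_p (x : R) : is_derive x 1 p (- (x / s ^+ 2) * p x).
Proof.
rewrite pE.
apply: is_derive_eq (derZ _ (der_exp (derZ _ (derM (der_id x) (der_id x))))) _.
by rewrite -mulr_natl; field; rewrite s_neq0.
Qed.

Let cp : continuous p. Proof. exact: continuous_normal_pdf. Qed.

(** This makes the boundary terms of the integrations by parts vanish. *)
Let p_decay (n : R) : 0 < n -> n * p n <= normal_peak s * (2 * s ^+ 2) / n.
Proof.
move=> n0; rewrite pE mulrCA -mulrA ler_wpM2l ?normal_peak_ge0// ler_pdivlMr// mulrAC -expr2.
rewrite mulNr expRN [_^-1 * _]mulrC.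
rewrite ler_pdivrMr ?expR_gt0//.
have := expR_ge1Dx (n ^+ 2 / (s ^+ 2 *+ 2)).
set e := expR _ => le_e.
have s2 : 0 < s ^+ 2 by rewrite exprn_gt0.
apply: (@le_trans _ _ (2 * s ^+ 2 * (1 + n ^+ 2 / (s ^+ 2 *+ 2)))).
  have -> : 2 * s ^+ 2 * (1 + n ^+ 2 / (s ^+ 2 *+ 2)) = 2 * s ^+ 2 + n ^+ 2.
    by rewrite -mulr_natl; field; rewrite s_neq0.
  by rewrite lerDr mulr_ge0// ltW.
by rewrite ler_wpM2l// mulr_ge0// ltW.
Qed.

Local Notation itv n := [set` `[- (n%:R : R), n%:R]%R].

Let bigcup_itv : \bigcup_n (itv n) = setT.
Proof.
apply/seteqP; split => // x _; exists (Num.truncn `|x|).+1 => //.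
rewrite /= in_itv/= -ler_norml ltW//.
by have /andP[] := Num.Theory.truncn_itv (normr_ge0 x).
Qed.

Let nd_itv : nondecreasing_seq (fun n => itv n).
Proof.
move=> m n mn; apply/subsetPset => x; rewrite /= !in_itv/= => /andP[xm mx].
have : (m%:R <= n%:R :> R) by rewrite ler_nat.
by move=> ?; apply/andP; split; lra.
Qed.

(** Moments truncated to [[-n, n]]: there every integrand is continuous and the
    fundamental theorem of calculus applies. *)
Let RI (q : R -> R) n := \int[mu]_(x in itv n) (q x * p x).

Let integrable_itv (q : R -> R) n : continuous q ->
  mu.-integrable (itv n) (EFin \o (fun x => q x * p x)).
Proof.
move=> cq; apply: continuous_compact_integrable; first exact: segment_compact.
by apply: continuous_subspaceT => x; apply: cvgM; [exact: cq|exact: cp].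
Qed.

Let RIE (q : R -> R) n : continuous q ->
  (\int[mu]_(x in itv n) (q x * p x)%:E = (RI q n)%:E)%E.
Proof.
move=> cq; rewrite /RI /Rintegral fineK//.
by apply: integrable_fin_num => //; exact: (integrable_itv n cq).
Qed.

Let RI_FTC (q F : R -> R) n : continuous q ->
  (forall x : R, is_derive x 1 F (q x * p x)) -> RI q n = F n%:R - F (- n%:R).
Proof.
move=> cq dF; apply: der_FTC => //.
  by rewrite -subr_ge0 opprK addr_ge0.
by move=> x; apply: cvgM; [exact: cq|exact: cp].
Qed.

Let RI_split (q r : R -> R) c n : continuous q -> continuous r ->
  RI (fun x => q x + c * r x) n = RI q n + c * RI r n.
Proof.
move=> cq cr; rewrite -RintegralZl//; last exact: (integrable_itv n cr).
rewrite -RintegralD//; [|exact: (integrable_itv n cq)|].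
  by apply: eq_Rintegral => x _; rewrite mulrDl mulrA.
have ccr : continuous (fun x => c * r x).
  by move=> x; apply: cvgM; [exact: cvg_cst|exact: cr].
apply: eq_integrable (integrable_itv n ccr) => //.
by move=> x _ /=; rewrite mulrA.
Qed.

Let continuous_pow k : continuous (fun x : R => x ^+ k).
Proof. exact: exprn_continuous. Qed.

Let mpow k : measurable_fun setT (fun x : R => x ^+ k).
Proof. exact: measurable_funX. Qed.

Let cst1 : continuous (fun _ : R => 1 : R). Proof. by move=> x; exact: cvg_cst. Qed.

Let p_even x : p (- x) = p x. Proof. by rewrite pE mulrNN. Qed.

Let cvg_itv (q : R -> R) : measurable_fun setT q -> continuous q ->
  (forall x, 0 <= q x) ->
  (RI q n)%:E @[n --> \oo] --> (\int[mu]_x (q x * p x)%:E)%E.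
Proof.
move=> mq cq q0; rewrite -[in X in _ --> X]bigcup_itv.
under eq_fun do rewrite -RIE//.
apply: ge0_nondecreasing_set_cvg_integral => //.
- by move=> n; apply: measurable_funTS; apply/measurable_EFinP/measurable_funM.
- by move=> n x _; rewrite lee_fin mulr_ge0.
Qed.

Let cvg_int_p : RI (fun _ : R => 1) n @[n --> \oo] --> (1 : R).
Proof.
have := cvg_itv (measurable_cst _) cst1 (fun=> ler01).
under [X in _ --> X -> _]eq_integral do rewrite mul1r.
rewrite integral_normal_pdf => h; exact: (fine_cvg h).
Qed.

Let RI1_le1 n : RI (fun _ : R => 1) n <= 1.
Proof.
rewrite -lee_fin -RIE// -(integral_normal_pdf 0 s).
under eq_integral do rewrite mul1r.
apply: ge0_subset_integral => //=.
- exact/measurable_EFinP.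
- by move=> x _; rewrite lee_fin.
Qed.

Let RI2 n : RI (fun x => x ^+ 2) n =
  s ^+ 2 * RI (fun _ : R => 1) n - 2 * s ^+ 2 * (n%:R * p n%:R).
Proof.
have c2 : continuous (fun x : R => x ^+ 2 + - s ^+ 2 * 1).
  move=> x; apply: cvgD; first exact: exprn_continuous.
  by apply: cvgM; exact: cvg_cst.
have dF (x : R) : is_derive x 1 (fun y => - s ^+ 2 * (y * p y))
    ((x ^+ 2 + - s ^+ 2 * 1) * p x).
  apply: is_derive_eq (derZ _ (derM (der_id x) (der_p x))) _.
  by field; rewrite s_neq0.
have := RI_FTC n c2 dF.
rewrite (RI_split _ _ (@continuous_pow 2) cst1) p_even => E.
rewrite [LHS](_ : _ = (RI (fun x => x ^+ 2) n + - s ^+ 2 * RI (fun _ : R => 1) n)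
  + s ^+ 2 * RI (fun _ : R => 1) n); last by ring.
by rewrite E; ring.
Qed.

(** The boundary term is nonpositive and is dropped, whence an inequality. *)
Let RI4 n : RI (fun x => x ^+ 4) n <= 3 * s ^+ 4.
Proof.
have c4 : continuous (fun x : R => x ^+ 4 + - (3 * s ^+ 4) * 1).
  move=> x; apply: cvgD; first exact: exprn_continuous.
  by apply: cvgM; exact: cvg_cst.
have dF (x : R) : is_derive x 1
    (fun y => - s ^+ 2 * (y * (y * y + 3 * s ^+ 2) * p y))
    ((x ^+ 4 + - (3 * s ^+ 4) * 1) * p x).
  apply: is_derive_eq (derZ _ (derM (derM (der_id x)
    (derD (derM (der_id x) (der_id x)) (der_cst _ x))) (der_p x))) _.
  by field; rewrite s_neq0.
have := RI_FTC n c4 dF.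
rewrite (RI_split _ _ (@continuous_pow 4) cst1) p_even => E.
rewrite [leLHS](_ : _ = (RI (fun x => x ^+ 4) n + - (3 * s ^+ 4) * RI (fun _ : R => 1) n)
  + 3 * s ^+ 4 * RI (fun _ : R => 1) n); last by ring.
rewrite E.
have : 0 <= 2 * s ^+ 2 * (n%:R * (n%:R * n%:R + 3 * s ^+ 2) * p n%:R).
  have n0 : 0 <= n%:R :> R by [].
  have s0 := sqr_ge0 s.
  have pn0 := p_ge0 n%:R.
  by apply: mulr_ge0; [nra|apply: mulr_ge0 => //; apply: mulr_ge0 => //; nra].
have : 3 * s ^+ 4 * RI (fun _ : R => 1) n <= 3 * s ^+ 4.
  by rewrite ler_piMr// mulr_ge0// exprn_ge0// ltW.
nra.
Qed.

Let moment4 : (\int[mu]_x (x ^+ 4 * p x)%:E <= (3 * s ^+ 4)%:E)%E.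
Proof.
have x4 (x : R) : 0 <= x ^+ 4 by rewrite exprn_even_ge0.
have h := cvg_itv (@mpow 4) (@continuous_pow 4) x4.
rewrite -(cvg_lim _ h)//; apply: lime_le; first exact: (cvgP _ h).
by apply: nearW => n; rewrite lee_fin RI4.
Qed.

Let moment2 : (\int[mu]_x (x ^+ 2 * p x)%:E = (s ^+ 2)%:E)%E.
Proof.
have h := cvg_itv (@mpow 2) (@continuous_pow 2) (@sqr_ge0 R).
apply: (cvg_unique _ h) => //; apply: cvg_EFin; first exact: nearW.
rewrite [X in X @ _ --> _](_ : _ =
    (fun n => s ^+ 2 * RI (fun _ : R => 1) n - 2 * s ^+ 2 * (n%:R * p n%:R))); last first.
  by apply/funext => n /=; rewrite RI2.
rewrite -[X in _ --> X]subr0 -[X in _ --> X - _](mulr1 (s ^+ 2)).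
apply: cvgB; first by apply: cvgM => //; exact: cvg_cst.
rewrite -[X in _ --> X](mulr0 (2 * s ^+ 2)); apply: cvgM; first exact: cvg_cst.
pose K := normal_peak s * (2 * s ^+ 2).
rewrite -cvg_shiftS.
apply: (@squeeze_cvgr _ _ _ _ (fun=> 0) (fun n => K * n.+1%:R^-1)).
- apply: nearW => n; rewrite mulr_ge0//=.
  exact: p_decay.
- exact: cvg_cst.
rewrite -[X in _ --> X](mulr0 K); apply: cvgM; first exact: cvg_cst.
exact: cvg_harmonic.
Qed.

Let RI1 n : RI id n = 0.
Proof.
have dF (x : R) : is_derive x 1 (fun y => - s ^+ 2 * p y) (id x * p x).
  apply: is_derive_eq (derZ _ (der_p x)) _.
  by rewrite /id; field; rewrite s_neq0.
have cid : continuous (id : R -> R) by move=> x; exact: cvg_id.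
by rewrite (RI_FTC n cid dF) p_even subrr.
Qed.

(** The truncated moments increase to the moments by monotone convergence. *)
Lemma gaussian_moments d (Omega : measurableType d) (P : probability Omega R)
    (X : Omega -> R) : measurable_fun setT X ->
  (forall B, measurable B -> P [set w | B (X w)] = normal_prob 0 s B) ->
  [/\ P.-integrable setT (EFin \o (fun w => X w ^+ 4)),
  \int[P]_w X w = 0, \int[P]_w (X w ^+ 2) = s ^+ 2 &
  \int[P]_w (X w ^+ 4) <= 3 * s ^+ 4].
Proof.
move=> mX XE.
have ge0E (f : R -> R) : measurable_fun setT f -> (forall x, 0 <= f x) ->
  (\int[P]_w (f (X w))%:E = \int[mu]_x (f x * p x)%:E)%E.
  move=> mf f0; rewrite -ge0_integral_normal//.
  pose X0 : Omega -> measurableTypeR R := X.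
  have mX0 : measurable_fun setT X0 by exact: mX.
  pose X' : {mfun Omega >-> measurableTypeR R} :=
    HB.pack X0 (isMeasurableFun.Build _ _ _ _ X0 mX0).
  rewrite -[LHS]/(\int[P]_w ((EFin \o f) \o X') w)%E.
  have mf' : @measurable_fun _ _ (measurableTypeR R) _ setT (EFin \o f).
    by exact/measurable_EFinP.
  rewrite -(ge0_integral_distribution X' mf'); last by move=> y; rewrite /= lee_fin.
  by apply: eq_measure_integral => B mB _; exact: XE.
have x4 (x : R) : 0 <= x ^+ 4 by rewrite exprn_even_ge0.
have m4 := @mpow 4.
have m2 := @mpow 2.
have i4 : P.-integrable setT (EFin \o (fun w => X w ^+ 4)).
  apply/integrableP; split.
    by apply/measurable_EFinP; apply: (measurableT_comp m4 mX).
  under eq_integral do rewrite /= ger0_norm//.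
  by rewrite (ge0E _ m4)// (le_lt_trans moment4)// ltry.
have i1 : P.-integrable setT (EFin \o X).
  apply: (@integrable_dom _ _ _ P _ (fun w => 1 + X w ^+ 4)) => //.
    by apply: integrable_add => //; exact: finite_measure_integrable_cst.
  by move=> w; exact: normr_le_pow4.
split => //; last 2 first.
- by rewrite /Rintegral (ge0E _ m2) ?moment2// => x; exact: sqr_ge0.
- rewrite /Rintegral (ge0E _ m4)// -lee_fin fineK ?moment4//.
  rewrite ge0_fin_numE; first by rewrite (le_lt_trans moment4)// ltry.
  by apply: integral_ge0 => x _; rewrite lee_fin mulr_ge0.
pose hp (x : R) := (`|x| + x) / 2; pose hn (x : R) := (`|x| - x) / 2.
have chn : continuous hn.
  by move=> x; apply: cvgM; [apply: cvgB; [exact: norm_continuous|exact: cvg_id]|exact: cvg_cst].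
have chp : continuous hp.
  by move=> x; apply: cvgM; [apply: cvgD; [exact: norm_continuous|exact: cvg_id]|exact: cvg_cst].
have hp0 x : 0 <= hp x.
  by rewrite divr_ge0// -lerBlDr sub0r -normrN ler_norm.
have hn0 x : 0 <= hn x by rewrite divr_ge0// subr_ge0 ler_norm.
have mhp : measurable_fun setT hp by exact: continuous_measurable_fun.
have mhn : measurable_fun setT hn by exact: continuous_measurable_fun.
have cid : continuous (id : R -> R) by move=> x; exact: cvg_id.
have Ehp : (\int[P]_w (hp (X w))%:E = \int[P]_w (hn (X w))%:E)%E.
  rewrite (ge0E _ mhp hp0) (ge0E _ mhn hn0).
  have h := cvg_itv mhn chn hn0.
  apply: (cvg_unique _ (cvg_itv mhp chp hp0)) => //.
  suff E : RI hp = RI hn by rewrite E.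
  apply/funext => n.
  have -> : hp = (fun x => hn x + 1 * id x).
    by apply/funext => x; rewrite /hp /hn mul1r; field.
  by rewrite (RI_split _ _ chn cid) RI1 mulr0 addr0.
have abs_hp w : `|hp (X w)| <= `|X w|.
  by rewrite ger0_norm// /hp ler_pdivrMr// mulr_natr mulr2n lerD2l ler_norm.
have abs_hn w : `|hn (X w)| <= `|X w|.
  by rewrite ger0_norm// /hn ler_pdivrMr// mulr_natr mulr2n lerD2l -normrN ler_norm.
have i1' : P.-integrable setT (EFin \o (fun w => `|X w|)) by exact: integrable_norm i1.
rewrite (@eq_Rintegral _ _ _ P _ (fun w => hp (X w) - hn (X w))); last first.
  by move=> w _; rewrite /hp /hn; field.
rewrite RintegralB//; last 2 first.
- by apply: (integrable_dom _ i1') => //; exact: (measurableT_comp mhp mX).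
- by apply: (integrable_dom _ i1') => //; exact: (measurableT_comp mhn mX).
by rewrite /Rintegral Ehp subrr.
Qed.

End gaussian_moments.

(** * Taylor bounds *)

Section taylor.
Context (R : realType).

Lemma between0_normr (h t : R) : Num.min 0 h <= t <= Num.max 0 h -> `|t| <= `|h|.
Proof.
have [h0|/ltW h0] := leP 0 h => /andP[t1 t2]; first by rewrite !ger0_norm ?(le_trans t1).
by rewrite !ler0_norm// lerN2.
Qed.

Lemma der_shift (f : R -> R) (s t df : R) : is_derive (s + t) 1 f df ->
  is_derive t 1 (fun y => f (s + y)) df.
Proof.
move=> h; have := der_comp (g := fun y => s + y) (x := t) h
  (derD (der_cst s t) (der_id t)).
by rewrite add0r mulr1.
Qed.

(** Three applications of the mean value inequality, one for each derivative. *)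
Lemma taylor2_bound (f f1 f2 f3 : R -> R) (C s h : R) :
  (forall x : R, is_derive x 1 f (f1 x)) ->
  (forall x : R, is_derive x 1 f1 (f2 x)) ->
  (forall x : R, is_derive x 1 f2 (f3 x)) -> (forall x, `|f3 x| <= C) ->
  `|f (s + h) - f s - f1 s * h - f2 s / 2 * h ^+ 2| <= C * `|h| ^+ 3.
Proof.
move=> d0 d1 d2 f3C.
have C0 : 0 <= C := le_trans (normr_ge0 _) (f3C 0).
have D2 t : `|t| <= `|h| -> `|f2 (s + t) - f2 s| <= C * `|h|.
  move=> th; apply: le_trans (der_mvt d2 (fun z _ => f3C z)) _.
  by rewrite addrAC subrr add0r ler_wpM2l.
have D1 t : `|t| <= `|h| -> `|f1 (s + t) - f1 s - f2 s * t| <= C * `|h| ^+ 2.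
  move=> th; pose F y := f1 (s + y) + (- f1 s) + (- (f2 s)) * y.
  have dF (y : R) : is_derive y 1 F (f2 (s + y) - f2 s).
    apply: is_derive_eq (derD (derD (der_shift (d1 _)) (der_cst _ _)) (derZ _ (der_id _))) _.
    by ring.
  have := @der_mvt _ F _ 0 t (C * `|h|) dF.
  have -> : F t - F 0 = f1 (s + t) - f1 s - f2 s * t by rewrite /F addr0; ring.
  move=> /(_ _)/le_trans; apply.
    by move=> z /between0_normr zt; apply/D2/(le_trans zt).
  by rewrite subr0 expr2 mulrA ler_wpM2l// mulr_ge0.
pose F y := f (s + y) + (- f s) + (- (f1 s)) * y + (- (f2 s / 2)) * (y * y).
have dF (y : R) : is_derive y 1 F (f1 (s + y) - f1 s - f2 s * y).
  apply: is_derive_eq (derD (derD (derD (der_shift (d0 _)) (der_cst _ _))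
    (derZ _ (der_id _))) (derZ _ (derM (der_id _) (der_id _)))) _.
  by field.
have := @der_mvt _ F _ 0 h (C * `|h| ^+ 2) dF.
have -> : F h - F 0 = f (s + h) - f s - f1 s * h - f2 s / 2 * h ^+ 2.
  by rewrite /F addr0; ring.
move=> /(_ _)/le_trans; apply.
  by move=> z /between0_normr zt; apply/D1.
by rewrite subr0 -mulrA -exprSr.
Qed.

Lemma expR_rem2 (y : R) : `|expR y - 1 - y| <= y ^+ 2 * expR `|y|.
Proof.
have e1 t : `|t| <= `|y| -> `|expR t - 1| <= `|y| * expR `|y|.
  move=> ty.
  have := @der_mvt _ expR expR 0 t (expR `|y|) (fun z => is_derive_expR z).
  rewrite expR0 subr0 => /(_ _)/le_trans; apply.
    move=> z /between0_normr zt; rewrite ger0_norm ?expR_ge0// ler_expR.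
    by rewrite (le_trans (ler_norm z))// (le_trans zt).
  by rewrite mulrC ler_wpM2r// expR_ge0.
pose F x := expR x + (- 1) * x :> R.
have dF (x : R) : is_derive x 1 F (expR x - 1).
  by apply: is_derive_eq (derD (is_derive_expR x) (derZ _ (der_id _))) _; rewrite mulr1.
have := @der_mvt _ F _ 0 y (`|y| * expR `|y|) dF.
have -> : F y - F 0 = expR y - 1 - y by rewrite /F expR0; ring.
move=> /(_ _)/le_trans; apply.
  by move=> z /between0_normr zt; exact: e1.
by rewrite subr0 mulrAC -expr2 real_normK ?num_real.
Qed.

Lemma le_expR (z : R) : z <= expR z.
Proof. by have := expR_ge1Dx z; lra. Qed.

Lemma sqr_le_expR (z : R) : 0 <= z -> z ^+ 2 <= 4 * expR z.
Proof.
move=> z0; have -> : expR z = expR (z / 2) ^+ 2.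
  by rewrite -expRM_natr; congr expR; field.
have := expR_ge1Dx (z / 2); move: (expR _) => e h.
nra.
Qed.

End taylor.

Section gaussian_bump.
Context (R : realType).
Variables (A al : R).
Hypotheses (al0 : 0 <= al) (alA : al <= A).

Let g (s : R) := expR (- al * (s * s)).

Let g_ge0 s : 0 <= g s. Proof. exact: expR_ge0. Qed.

Let zg s : al * (s * s) * g s <= 1.
Proof. by rewrite /g mulNr expRN ler_pdivrMr ?expR_gt0// mul1r le_expR. Qed.

Let z2g s : (al * (s * s)) ^+ 2 * g s <= 4.
Proof.
rewrite /g mulNr expRN ler_pdivrMr ?expR_gt0//; apply: sqr_le_expR.
by rewrite mulr_ge0// -expr2 sqr_ge0.
Qed.

Let g_le1 s : g s <= 1.
Proof. by rewrite -expR0 ler_expR mulNr oppr_le0 mulr_ge0// -expr2 sqr_ge0. Qed.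

(** It comes from [|s| <= 1 + s^2] and [|s|^3 <= 1 + s^4], with the bounds on
    [z exp(-z)] and [z^2 exp(-z)] at [z = al s^2]. *)
Definition bump_d3_bound : R := 12 * (A ^+ 2 + A) + 8 * (A ^+ 3 + 4 * A).

(** The Gaussian factor absorbs the polynomial in [s] of the third derivative, so the
    bound does not depend on [s]. *)
Lemma bump_taylor s h :
  `|g (s + h) - g s - (- 2 * al * s * g s) * h
    - ((4 * al ^+ 2 * (s * s) - 2 * al) * g s) / 2 * h ^+ 2|
  <= bump_d3_bound * `|h| ^+ 3.
Proof.
have dg (x : R) : is_derive x 1 g (- 2 * al * x * g x).
  apply: is_derive_eq (der_exp (derZ _ (derM (der_id _) (der_id _)))) _.
  by rewrite /g; ring.
apply: (@taylor2_bound _ g (fun x => - 2 * al * x * g x)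
  (fun x => (4 * al ^+ 2 * (x * x) - 2 * al) * g x)
  (fun x => (12 * al ^+ 2 * x - 8 * al ^+ 3 * x ^+ 3) * g x)) => //.
- move=> x; apply: is_derive_eq (derM (derZ (- 2 * al) (der_id _)) (dg x)) _; ring.
- move=> x.
  apply: is_derive_eq (derM (derD (derZ (4 * al ^+ 2) (derM (der_id x) (der_id _)))
    (der_cst (- (2 * al)) x)) (dg x)) _.
  by ring.
move=> x; rewrite normrM (ger0_norm (g_ge0 x)).
have xxE : x * x = `|x| ^+ 2 by rewrite real_normK ?num_real// expr2.
have a2 : al ^+ 2 * `|x| * g x <= A ^+ 2 + A.
  have x1 : `|x| <= 1 + x * x.
    rewrite xxE; move: `|x| => y; have := sqr_ge0 (y - 2^-1); nra.
  apply: (@le_trans _ _ (al ^+ 2 * (1 + x * x) * g x)).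
    by rewrite ler_wpM2r// ler_wpM2l// sqr_ge0.
  have -> : al ^+ 2 * (1 + x * x) * g x = al ^+ 2 * g x + al * (al * (x * x) * g x) by ring.
  apply: lerD.
    by rewrite (le_trans (ler_piMr _ (g_le1 x))) ?sqr_ge0// lerXn2r ?nnegrE// (le_trans al0).
  by rewrite (le_trans (ler_piMr _ (zg x))).
have a3 : al ^+ 3 * `|x| ^+ 3 * g x <= A ^+ 3 + 4 * A.
  have x1 : `|x| ^+ 3 <= 1 + (x * x) ^+ 2.
    rewrite xxE; move: `|x| => y.
    have h1 := sqr_ge0 (y ^+ 2 - 2^-1 * y); have h2 := sqr_ge0 (y ^+ 2 - 1).
    have -> : 1 + (y ^+ 2) ^+ 2 = y ^+ 3 + (y ^+ 2 - 2^-1 * y) ^+ 2 +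
      (1 - 4^-1 * y ^+ 2) by field.
    nra.
  apply: (@le_trans _ _ (al ^+ 3 * (1 + (x * x) ^+ 2) * g x)).
    by rewrite ler_wpM2r// ler_wpM2l// exprn_ge0.
  have -> : al ^+ 3 * (1 + (x * x) ^+ 2) * g x =
    al ^+ 3 * g x + al * ((al * (x * x)) ^+ 2 * g x) by ring.
  apply: lerD.
    by rewrite (le_trans (ler_piMr _ (g_le1 x))) ?exprn_ge0// lerXn2r ?nnegrE// (le_trans al0).
  rewrite (@le_trans _ _ (al * 4))//; first by rewrite ler_wpM2l.
  by rewrite mulrC ler_wpM2l.
apply: (@le_trans _ _ ((12 * (al ^+ 2 * `|x|) + 8 * (al ^+ 3 * `|x| ^+ 3)) * g x)).
  rewrite ler_wpM2r// (le_trans (ler_normB _ _))//.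
  have c2 : 0 <= 12 * al ^+ 2 by rewrite mulr_ge0// sqr_ge0.
  have c3 : 0 <= 8 * al ^+ 3 by rewrite mulr_ge0// exprn_ge0.
  by rewrite (normrM (12 * _)) (normrM (8 * _)) (ger0_norm c2) (ger0_norm c3) normrX !mulrA.
rewrite /bump_d3_bound; move: a2 a3; nra.
Qed.

Definition bump_heat_bound : R := 64 * A ^+ 2 * expR 1.

(** One time step of the heat flow on the bump [exp(-al s^2)], with the second
    derivative absorbed in a change of [al] and of the total mass. *)
Lemma bump_heat (N s : R) : 4 * A + 1 <= N ->
  `|g s * expR ((2 * al ^+ 2 * (s * s) - al) / N) - g s
     - g s * ((2 * al ^+ 2 * (s * s) - al) / N)| <= bump_heat_bound / N ^+ 2.
Proof.
move=> NA; set y := (_ / N).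
have A0 : 0 <= A := le_trans al0 alA.
have N0 : 0 < N by lra.
pose z := al * (s * s).
have z0 : 0 <= z by rewrite mulr_ge0// -expr2 sqr_ge0.
have -> : g s * expR y - g s - g s * y = g s * (expR y - 1 - y) by ring.
rewrite normrM ger0_norm//.
apply: (le_trans (ler_wpM2l (g_ge0 s) (expR_rem2 y))).
have yE : `|y| <= al * (2 * z + 1) / N.
  have -> : y = al * (2 * z - 1) / N by rewrite /y /z; congr (_ / _); ring.
  rewrite normrM normfV (gtr0_norm N0) ler_wpM2r ?invr_ge0 ?(ltW N0)//.
  rewrite normrM (ger0_norm al0) ler_wpM2l// ler_norml; apply/andP; split; lra.
have y2 : y ^+ 2 <= A ^+ 2 * (2 * z + 1) ^+ 2 / N ^+ 2.
  rewrite -real_normK ?num_real// -exprMn -expr_div_n lerXn2r ?nnegrE//.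
    by apply: divr_ge0; [apply: mulr_ge0 => //; lra|exact: ltW].
  rewrite (le_trans yE)// ler_wpM2r ?invr_ge0 ?(ltW N0)// ler_wpM2r//; lra.
have yz : `|y| <= 1 + z / 2.
  rewrite (le_trans yE)// ler_pdivrMr//.
  have : (1 + z / 2) * (4 * al + 1) <= (1 + z / 2) * N.
    rewrite ler_wpM2l//; first by rewrite addr_ge0// divr_ge0.
    by apply: le_trans NA; rewrite lerD2r ler_pM2l.
  have : 0 <= al * z by rewrite mulr_ge0.
  clearbody y z; nra.
have gE : g s * expR `|y| <= expR 1 * expR (- (z / 2)).
  by rewrite -!expRD ler_expR mulNr -/z; lra.
have z2E : (2 * z + 1) ^+ 2 * expR (- (z / 2)) <= 64.
  rewrite expRN ler_pdivrMr ?expR_gt0//.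
  have -> : expR (z / 2) = expR (z / 4) ^+ 2 by rewrite -expRM_natr; congr expR; field.
  have := expR_ge1Dx (z / 4); move: (expR _) => e h.
  nra.
apply: (@le_trans _ _ (A ^+ 2 * (2 * z + 1) ^+ 2 / N ^+ 2 * (expR 1 * expR (- (z / 2))))).
  rewrite mulrCA; apply: ler_pM => //; first exact: sqr_ge0.
  by rewrite mulr_ge0// expR_ge0.
have -> : A ^+ 2 * (2 * z + 1) ^+ 2 / N ^+ 2 * (expR 1 * expR (- (z / 2))) =
  (A ^+ 2 * expR 1 / N ^+ 2) * ((2 * z + 1) ^+ 2 * expR (- (z / 2))) by ring.
have -> : bump_heat_bound / N ^+ 2 = (A ^+ 2 * expR 1 / N ^+ 2) * 64.
  by rewrite /bump_heat_bound; ring.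
rewrite ler_wpM2l// divr_ge0 ?sqr_ge0//.
by rewrite mulr_ge0 ?expR_ge0 ?sqr_ge0.
Qed.

End gaussian_bump.

(** * A Lindeberg estimate for quadratic functionals *)

Section riccati.
Context (R : realType).
Variables (a b N : R).

(** The Euler scheme, with step [1/N], of the Riccati equation [r' = b - 2 r^2] started
    from [a]. *)
Fixpoint riccati (k : nat) : R :=
  if k is k'.+1 then riccati k' - 2 * riccati k' ^+ 2 / N + b / N else a.

Definition riccati_sum (k : nat) : R := \sum_(i < k) riccati i / N.

Lemma riccati_bound k : 0 <= a -> 0 <= b -> 4 * (a + b) + 1 <= N -> k%:R <= N ->
  0 <= riccati k <= a + b.
Proof.
move=> a0 b0 Nab kN.
have N0 : 0 < N by lra.
suff : 0 <= riccati k <= a + b * (k%:R / N).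
  case/andP => -> /= /le_trans; apply; rewrite lerD2l ler_piMr//.
  by rewrite ler_pdivrMr// mul1r.
elim: k kN => [|k IH] kN; first by rewrite /= mul0r mulr0 addr0 a0 lexx.
have kN' : k%:R <= N by rewrite (le_trans _ kN)// ler_nat.
have /andP[r0 r1] := IH kN'.
have r2 : riccati k <= a + b.
  by rewrite (le_trans r1)// lerD2l ler_piMr// ler_pdivrMr// mul1r.
rewrite [riccati _]/=; move: (riccati k) r0 r1 r2 => r r0 r1 r2.
have q : 0 <= 2 * r ^+ 2 / N <= r.
  rewrite divr_ge0 ?mulr_ge0 ?sqr_ge0 ?(ltW N0)//= ler_pdivrMr//; nra.
have bN : 0 <= b / N by rewrite divr_ge0// ltW.
have -> : b * (k.+1%:R / N) = b * (k%:R / N) + b / N.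
  by rewrite -[k.+1]addn1 natrD; ring.
case/andP: q => q0 q1; apply/andP; split; lra.
Qed.

End riccati.

Section lindeberg.
Context (R : realType) d (Omega : measurableType d) (P : probability Omega R).
Variables (T : R) (Y : R -> Omega -> R) (c m : R) (N : nat) (K : R).
Hypothesis T0 : 0 <= T.
Hypothesis mY : forall t, 0 <= t <= T -> measurable_fun setT (Y t).
Hypothesis indY : independent_increments P T Y.
Hypothesis Y0 : {ae P, forall w, Y 0 w = 0}.
Hypothesis N_gt0 : (0 < N)%N.

Definition grid (i : nat) : R := i%:R * (T / N%:R).
Definition scaled (i : nat) (w : Omega) : R := c * (Y (grid i) w - m * grid i).
Let xi i w := scaled i.+1 w - scaled i w.

Hypothesis xi4 : forall i, (i < N)%N ->
  P.-integrable setT (EFin \o (fun w => xi i w ^+ 4)).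
Hypothesis xi_mean : forall i, (i < N)%N -> \int[P]_w xi i w = 0.
Hypothesis xi_var : forall i, (i < N)%N -> \int[P]_w (xi i w ^+ 2) = N%:R^-1.
Hypothesis xi_mom4 : forall i, (i < N)%N -> \int[P]_w (xi i w ^+ 4) <= K / N%:R ^+ 2.

Let NR0 : 0 < N%:R :> R. Proof. by rewrite ltr0n. Qed.

Lemma grid_bounds i : (i <= N)%N -> 0 <= grid i <= T.
Proof.
move=> iN; rewrite /grid mulr_ge0 ?divr_ge0//=.
by rewrite mulrCA -[leRHS]mulr1 ler_wpM2l// ler_pdivrMr// mul1r ler_nat.
Qed.

Lemma grid_le i j : (i <= j)%N -> grid i <= grid j.
Proof. by move=> ij; rewrite /grid ler_wpM2r ?divr_ge0// ler_nat. Qed.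

Let ad_scaled i j : (i <= j)%N -> adapted Y (grid j) (scaled i).
Proof.
move=> ij; rewrite /scaled.
apply: (adapted_comp (h := fun y => c * (y - m * grid i))).
  by apply: measurable_funM => //; exact: measurable_funB.
apply: adapted_process; rewrite grid_le// andbT /grid mulr_ge0 ?divr_ge0//.
Qed.

Lemma measurable_scaled i : (i <= N)%N -> measurable_fun setT (scaled i).
Proof.
by move=> iN; apply: (adapted_measurable mY indY Y0 (grid_bounds iN)); exact: ad_scaled.
Qed.

Let xi_indep i (eta : Omega -> R) (h : R -> R) B : (i < N)%N ->
  adapted Y (grid i) eta -> (forall w, `|eta w| <= B) -> measurable_fun setT h ->
  P.-integrable setT (EFin \o (fun w => h (xi i w))) ->
  P.-integrable setT (EFin \o (fun w => eta w * h (xi i w))) /\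
  \int[P]_w (eta w * h (xi i w)) = \int[P]_w eta w * \int[P]_w h (xi i w).
Proof.
move=> iN ad etaB mh ih.
pose h' y := h (c * (y - m * (grid i.+1 - grid i))).
have E w : h (xi i w) = h' (Y (grid i.+1) w - Y (grid i) w).
  by rewrite /h' /xi /scaled; congr h; ring.
have mh' : measurable_fun setT h'.
  apply: (measurableT_comp mh); apply: measurable_funM => //.
  exact: measurable_funB.
have ieta : P.-integrable setT (EFin \o eta).
  apply: integrable_bounded etaB.
  exact: (adapted_measurable mY indY Y0 (grid_bounds (ltnW iN))).
have /andP[gi0 _] := grid_bounds (ltnW iN).
have /andP[_ gi1] := grid_bounds iN.
have ih' : P.-integrable setT
    (EFin \o (fun w => h' (Y (grid i.+1) w - Y (grid i) w))).
  by apply: eq_integrable ih => // w _ /=; rewrite E.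
have [i1 e1] := adapted_indep mY indY Y0 gi0 (grid_le (leqnSn i)) gi1 ad mh' ieta ih'.
split; first by apply: eq_integrable i1 => // w _ /=; rewrite E.
under eq_Rintegral do rewrite E.
by rewrite e1; congr (_ * _); apply: eq_Rintegral => w _; rewrite E.
Qed.

Variables (a b : R).
Hypotheses (a0 : 0 <= a) (b0 : 0 <= b) (Nab : 4 * (a + b) + 1 <= N%:R).

Let al := riccati a b N%:R.
Let be := riccati_sum a b N%:R.
Let A := a + b.

(** The functional is transformed one step at a time: [Fj j] keeps the first [j] values
    of the process and replaces the effect of the later increments by the Riccati
    coefficients.  [Fj N] is the functional and [Fj 0] is deterministic. *)
Let Fj j w := expR (- (b / N%:R) * (\sum_(i < j) scaled i w ^+ 2)
  - al (N - j) * scaled j w ^+ 2 - be (N - j)).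

Let adapted_sum j k (e : nat -> Omega -> R) :
  (forall i, (i < k)%N -> adapted Y (grid j) (e i)) ->
  adapted Y (grid j) (fun w => \sum_(i < k) e i w).
Proof.
elim: k => [|k IH] h.
  rewrite (_ : (fun _ => _) = cst 0); first exact: adapted_cst.
  by apply/funext => w; rewrite big_ord0.
rewrite (_ : (fun _ => _) = (fun w => \sum_(i < k) e i w + e k w)).
  apply: adaptedD; last exact: h.
  by apply: IH => i ik; apply: h; exact: leq_trans ik (leqnSn k).
by apply/funext => w; rewrite big_ord_recr.
Qed.

Definition lindeberg_const : R := bump_d3_bound A * (K + 1) + bump_heat_bound A.

Let A0 : 0 <= A. Proof. by rewrite addr_ge0. Qed.
Let C3_ge0 : 0 <= bump_d3_bound A.
Proof. by rewrite /bump_d3_bound; do ?(apply: addr_ge0 || apply: mulr_ge0 || apply: exprn_ge0) => //. Qed.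
Let C2_ge0 : 0 <= bump_heat_bound A.
Proof. by rewrite /bump_heat_bound !mulr_ge0 ?expR_ge0 ?sqr_ge0. Qed.

Let r := Num.sqrt (N%:R : R).
Let r_gt0 : 0 < r. Proof. by rewrite sqrtr_gt0. Qed.
Let rr : r * r = N%:R. Proof. by rewrite -expr2 sqr_sqrtr// ltW. Qed.

(** A third absolute moment is interpolated between the second and the fourth, with the
    weight [sqrt N] that balances the two. *)
Let cube_le (x : R) : `|x| ^+ 3 <= (r * x ^+ 4 + x ^+ 2 / r) / 2.
Proof.
have -> : x ^+ 4 = `|x| ^+ 4.
  by rewrite -[4%N]/(2 * 2)%N !exprM real_normK ?num_real.
have -> : x ^+ 2 = `|x| ^+ 2 by rewrite real_normK ?num_real.
move: `|x| (normr_ge0 x) => y y0.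
have -> : (r * y ^+ 4 + y ^+ 2 / r) / 2 = y ^+ 3 + (y * (r * y - 1)) ^+ 2 / r / 2.
  by field; rewrite gt_eqF.
by rewrite lerDl divr_ge0// divr_ge0 ?sqr_ge0// ltW.
Qed.

Let mF j : (j <= N)%N -> measurable_fun setT (Fj j).
Proof.
move=> jN; apply: (adapted_measurable mY indY Y0 (grid_bounds jN)).
apply: (adapted_comp (h := expR)) => //.
apply: (@adaptedD _ _ _ _ _ (fun w => - (b / N%:R) * (\sum_(i < j) scaled i w ^+ 2)
  - al (N - j) * scaled j w ^+ 2) (fun=> - be (N - j))); last exact: adapted_cst.
apply: (@adaptedD _ _ _ _ _ (fun w => - (b / N%:R) * (\sum_(i < j) scaled i w ^+ 2))
  (fun w => - (al (N - j) * scaled j w ^+ 2))).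
  apply: (@adaptedM _ _ _ _ _ (fun=> - (b / N%:R)) (fun w => \sum_(i < j) scaled i w ^+ 2)).
    exact: adapted_cst.
  apply: (adapted_sum (e := fun i w => scaled i w ^+ 2)) => i ij.
  apply: (adapted_comp (h := fun y => y ^+ 2)); first exact: measurable_funX.
  by apply: ad_scaled; exact: ltnW.
apply: (adapted_comp (h := fun y => - (al (N - j) * y ^+ 2))).
  by apply: measurableT_comp => //; apply: measurable_funM => //; exact: measurable_funX.
exact: ad_scaled.
Qed.

(** Taylor expansion in the increment, which is independent of the past, centred and of
    variance [1/N]: the linear term vanishes, the quadratic term is compensated by the
    Riccati step up to [1/N^2], and the cubic term is of order [N^(-3/2)]. *)
Let step j : (j < N)%N ->
  `|\int[P]_w Fj j.+1 w - \int[P]_w Fj j w| <= lindeberg_const / (N%:R * r).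
Proof.
move=> jN; pose k := (N - j.+1)%N.
have Nj : (N - j = k.+1)%N by rewrite /k subnSK.
have /andP[al0 alA] : 0 <= al k <= A.
  by apply: riccati_bound => //; rewrite ler_nat leq_subr.
pose al_k := al k.
pose g s := expR (- al_k * (s * s)).
pose eta w := expR (- (b / N%:R) * (\sum_(i < j.+1) scaled i w ^+ 2) - be k).
pose S w := scaled j w.
pose x w := xi j w.
pose y s := (2 * al_k ^+ 2 * (s * s) - al_k) / N%:R.
pose g1 s := - 2 * al_k * s * g s.
pose g2 s := (4 * al_k ^+ 2 * (s * s) - 2 * al_k) * g s.
have F1 w : Fj j.+1 w = eta w * g (S w + x w).
  have -> : S w + x w = scaled j.+1 w by rewrite /S /x /xi addrC subrK.
  by rewrite /Fj /eta /g -expRD; congr expR; rewrite -/k /al_k expr2; ring.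
have F0 w : Fj j w = eta w * (g (S w) * expR (y (S w))).
  rewrite /Fj /eta /g -!expRD; congr expR; rewrite Nj big_ord_recr/=.
  rewrite /be /riccati_sum big_ord_recr/= -/(riccati_sum a b N%:R k) -/(al k).
  rewrite /al /= -/(al k) -/al_k /y /S expr2.
  by field; rewrite gt_eqF.
have eta01 w : 0 <= eta w <= 1.
  rewrite expR_ge0 /= -expR0 ler_expR subr_le0 mulNr.
  apply: (@le_trans _ _ 0); first by rewrite oppr_le0 mulr_ge0 ?divr_ge0// sumr_ge0// => i _; exact: sqr_ge0.
  apply: sumr_ge0 => i _; rewrite divr_ge0//.
  suff /andP[] : 0 <= al i <= A by [].
  apply: riccati_bound => //; rewrite ler_nat (leq_trans (ltnW (ltn_ord i)))// leq_subr//.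
have g01 s : 0 <= g s <= 1.
  rewrite expR_ge0 /= -expR0 ler_expR mulNr oppr_le0 mulr_ge0// -expr2 sqr_ge0//.
have ag s : al_k * (s * s) * g s <= 1.
  by rewrite /g mulNr expRN ler_pdivrMr ?expR_gt0// mul1r le_expR.
have mg : measurable_fun setT g.
  by apply: measurableT_comp => //; apply: measurable_funM => //; exact: measurable_funM.
have mg1 : measurable_fun setT g1.
  by apply: measurable_funM => //; exact: measurable_funM.
have mg2 : measurable_fun setT g2.
  apply: measurable_funM => //; apply: measurable_funB => //.
  by apply: measurable_funM => //; exact: measurable_funM.
have g1_bd s : `|g1 s| <= 2 * (al_k + 1).
  have /andP[gs0 gs1] := g01 s; have := ag s.
  rewrite /g1 normrM (ger0_norm gs0) normrM normrM normrN (ger0_norm al0) normr_nat => h.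
  have s1 : `|s| <= 1 + s * s.
    have -> : s * s = `|s| ^+ 2 by rewrite real_normK ?num_real// expr2.
    by move: `|s| => z; have := sqr_ge0 (z - 2^-1); nra.
  have : 2 * al_k * `|s| * g s <= 2 * al_k * (1 + s * s) * g s.
    by rewrite ler_wpM2r// ler_wpM2l// mulr_ge0.
  have h2 : al_k * g s <= al_k by rewrite ler_piMr.
  move=> /le_trans; apply.
  have -> : 2 * al_k * (1 + s * s) * g s = 2 * (al_k * g s + al_k * (s * s) * g s) by ring.
  by rewrite ler_pM2l// lerD.
have g2_bd s : `|g2 s| <= 4 * al_k + 2 * al_k.
  have /andP[gs0 gs1] := g01 s; have := ag s => h.
  have h2 : al_k * g s <= al_k by rewrite ler_piMr.
  have h3 : 0 <= al_k * g s by rewrite mulr_ge0.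
  have h4 : 0 <= al_k * (al_k * (s * s) * g s).
    by rewrite mulr_ge0// mulr_ge0// mulr_ge0// -expr2 sqr_ge0.
  have h5 : al_k * (al_k * (s * s) * g s) <= al_k by rewrite ler_piMr.
  have -> : g2 s = 4 * (al_k * (al_k * (s * s) * g s)) - 2 * (al_k * g s) by rewrite /g2; ring.
  move: (al_k * (al_k * (s * s) * g s)) (al_k * g s) h2 h3 h4 h5 => u v h2 h3 h4 h5.
  by rewrite ler_norml; apply/andP; split; lra.
have ad_S : adapted Y (grid j) S by exact: ad_scaled.
have ad_eta : adapted Y (grid j) eta.
  apply: (adapted_comp (h := fun z => expR (- (b / N%:R) * z - be k))
    (eta := fun w => \sum_(i < j.+1) scaled i w ^+ 2)).
    apply: measurableT_comp => //; apply: measurable_funB => //.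
  apply: (adapted_sum (e := fun i w => scaled i w ^+ 2)) => i ij.
  apply: (adapted_comp (h := fun y => y ^+ 2)); first exact: measurable_funX.
  by apply: ad_scaled.
have mx : measurable_fun setT x.
  by apply: measurable_funB; apply: measurable_scaled => //; exact: ltnW.
have ix4 := xi4 jN.
have ix2 : P.-integrable setT (EFin \o (fun w => x w ^+ 2)).
  apply: (@integrable_dom _ _ _ P _ (fun w => 1 + x w ^+ 4)).
  - exact: measurable_funX.
  - by apply: integrable_add => //; exact: finite_measure_integrable_cst.
  - by move=> w; rewrite ger0_norm ?sqr_ge0// sqr_le_pow4.
have ix1 : P.-integrable setT (EFin \o x).
  apply: (@integrable_dom _ _ _ P _ (fun w => 1 + x w ^+ 4)) => //.
  - by apply: integrable_add => //; exact: finite_measure_integrable_cst.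
  - by move=> w; exact: normr_le_pow4.
have eta_bd (G : R -> R) B : measurable_fun setT G -> (forall s, `|G s| <= B) ->
    adapted Y (grid j) (fun w => eta w * G (S w)) /\
    (forall w, `|eta w * G (S w)| <= B).
  move=> mG GB; split.
    by apply: adaptedM => //; exact: (adapted_comp mG ad_S).
  move=> w; have /andP[e0 e1] := eta01 w.
  rewrite normrM (ger0_norm e0) (le_trans _ (GB (S w)))// ler_piMl//.
have [ad1 bd1] := eta_bd _ _ mg1 g1_bd.
have [ad2 bd2] := eta_bd _ _ mg2 g2_bd.
have [i3 e3] := xi_indep jN ad1 bd1 (@measurable_id _ _ setT) ix1.
have ix2' : P.-integrable setT (EFin \o (fun w => (x w ^+ 2 - N%:R^-1) / 2)).
  apply: eq_integrable (integrable_scale 2^-1 (integrable_sub ix2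
    (finite_measure_integrable_cst P N%:R^-1 measurableT))) => //.
  by move=> w _ /=; rewrite mulrC.
have m2 : measurable_fun setT (fun z : R => (z ^+ 2 - N%:R^-1) / 2).
  by apply: measurable_funM => //; apply: measurable_funB => //; exact: measurable_funX.
have [i4 e4] := xi_indep jN ad2 bd2 m2 ix2'.
have E3 : \int[P]_w (eta w * g1 (S w) * x w) = 0.
  by rewrite e3 (xi_mean jN) mulr0.
have E4 : \int[P]_w (eta w * g2 (S w) * ((x w ^+ 2 - N%:R^-1) / 2)) = 0.
  rewrite e4 RintegralZr//; last first.
    by apply: integrable_sub => //; exact: finite_measure_integrable_cst.
  rewrite RintegralB//; last exact: finite_measure_integrable_cst.
  by rewrite (xi_var jN) Rintegral_prob_cst subrr mul0r mulr0.
pose D w := Fj j.+1 w - Fj j w - eta w * g1 (S w) * x w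
   - eta w * g2 (S w) * ((x w ^+ 2 - N%:R^-1) / 2).
have iF i : (i <= N)%N -> P.-integrable setT (EFin \o Fj i).
  move=> iN; apply: (@integrable_bounded _ _ _ P _ 1); first exact: mF.
  move=> w; rewrite ger0_norm ?expR_ge0// -expR0 ler_expR.
  have : 0 <= be (N - i).
    apply: sumr_ge0 => l _; rewrite divr_ge0//.
    suff /andP[] : 0 <= al l <= A by [].
    apply: riccati_bound => //; rewrite ler_nat (leq_trans (ltnW (ltn_ord l)))// leq_subr//.
  have : 0 <= al (N - i) * scaled i w ^+ 2.
    rewrite mulr_ge0 ?sqr_ge0//.
    suff /andP[] : 0 <= al (N - i) <= A by [].
    by apply: riccati_bound => //; rewrite ler_nat leq_subr.
  have : 0 <= b / N%:R * \sum_(i0 < i) scaled i0 w ^+ 2.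
    by rewrite mulr_ge0 ?divr_ge0// sumr_ge0// => l _; exact: sqr_ge0.
  rewrite mulNr; lra.
have iF1 := iF _ jN; have iF0 := iF _ (ltnW jN).
have iD0 := integrable_sub iF1 iF0.
have iD1 := integrable_sub iD0 i3.
have iD : P.-integrable setT (EFin \o D) by exact: integrable_sub iD1 i4.
have -> : \int[P]_w Fj j.+1 w - \int[P]_w Fj j w = \int[P]_w D w.
  rewrite /D RintegralB// RintegralB// RintegralB//.
  by rewrite -/x in E3 E4 *; rewrite E3 E4 !subr0.
pose B w := bump_d3_bound A / 2 * (r * x w ^+ 4 + r^-1 * x w ^+ 2)
  + bump_heat_bound A / N%:R ^+ 2.
have DB w : `|D w| <= B w.
  have /andP[e0 e1] := eta01 w.
  have -> : D w = eta w * ((g (S w + x w) - g (S w) - g1 (S w) * x w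
     - g2 (S w) / 2 * x w ^+ 2) -
     (g (S w) * expR (y (S w)) - g (S w) - g (S w) * y (S w))).
    by rewrite /D F1 F0 /g2 /y; field; rewrite gt_eqF.
  rewrite normrM (ger0_norm e0); apply: (le_trans (ler_piMl _ e1)) => //.
  apply: (le_trans (ler_normB _ _)); apply: lerD; last first.
    exact: (bump_heat al0 alA (S w) Nab).
  apply: (le_trans (bump_taylor al0 alA (S w) (x w))).
  rewrite -mulrA ler_wpM2l// (le_trans (cube_le _))//.
  by rewrite mulrC [_ / r]mulrC.
have iB0 : P.-integrable setT
    (EFin \o (fun w => r * x w ^+ 4 + r^-1 * x w ^+ 2)).
  by apply: integrable_add; exact: integrable_scale.
have iB1 := integrable_scale (bump_d3_bound A / 2) iB0.
have icst := finite_measure_integrable_cst P (bump_heat_bound A / N%:R ^+ 2) measurableT.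
have iB : P.-integrable setT (EFin \o B) by exact: integrable_add iB1 icst.
apply: (le_trans (le_normr_Rintegral measurableT iD)).
apply: (@le_trans _ _ (\int[P]_w B w)).
  by apply: le_Rintegral => //; exact: integrable_norm.
rewrite RintegralD// RintegralZl// RintegralD//; last 2 first.
- exact: integrable_scale.
- exact: integrable_scale.
rewrite (@RintegralZl _ _ _ P setT (fun w => x w ^+ 4))//.
rewrite (@RintegralZl _ _ _ P setT (fun w => x w ^+ 2))// (xi_var jN) Rintegral_prob_cst.
have h4 := xi_mom4 jN.
have r1 : 1 <= r.
  by rewrite -(@sqrtr1 R) ler_sqrt// ler1n.
have rN : (N%:R ^+ 2)^-1 <= (N%:R * r)^-1.
  rewrite lef_pV2 ?posrE ?mulr_gt0 ?exprn_gt0// expr2 ler_wpM2l ?(ltW NR0)//.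
  by rewrite -rr ler_peMl// ltW.
have rK : r * (K / N%:R ^+ 2) = K / (N%:R * r).
  by rewrite -rr; field; rewrite gt_eqF.
have r4 : r * \int[P]_w xi j w ^+ 4 <= K / (N%:R * r).
  by rewrite -rK ler_wpM2l// ltW.
rewrite /lindeberg_const [leRHS]mulrDl; apply: lerD; last by rewrite ler_wpM2l.
have -> : bump_d3_bound A * (K + 1) / (N%:R * r) =
  bump_d3_bound A * (K / (N%:R * r) + (N%:R * r)^-1) by field; rewrite !gt_eqF.
have rV : r^-1 * N%:R^-1 = (N%:R * r)^-1 by field; rewrite !gt_eqF.
have K0 : 0 <= r * \int[P]_w xi j w ^+ 4.
  rewrite mulr_ge0 ?(ltW r_gt0)// Rintegral_ge0// => w _.
  by rewrite exprn_even_ge0.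
have Q0 : 0 <= (N%:R * r)^-1 by rewrite invr_ge0 mulr_ge0// ltW.
rewrite rV -mulrA ler_wpM2l//.
lra.
Qed.

(** There are [N] steps, each costing [N^(-3/2)]. *)
Lemma lindeberg_riccati :
  `|\int[P]_w expR (- a * scaled N w ^+ 2
      - b / N%:R * (\sum_(i < N) scaled i w ^+ 2)) - expR (- be N)|
  <= lindeberg_const / Num.sqrt N%:R.
Proof.
have S0 : {ae P, forall w, scaled 0 w = 0}.
  apply: filterS Y0 => w Y0w.
  by rewrite /scaled /grid mul0r Y0w mulr0 subrr mulr0.
have -> : expR (- be N) = \int[P]_w Fj 0 w.
  rewrite -[LHS](Rintegral_prob_cst P); congr fine.
  apply: ae_eq_integral => //; first exact/measurable_EFinP/mF.
  apply: filterS S0 => w S0w _; congr (_%:E).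
  by rewrite /Fj S0w big_ord0 subn0 expr0n/= !mulr0 subr0 add0r.
rewrite (@eq_Rintegral _ _ _ P _ (Fj N)); last first.
  move=> w _; rewrite /Fj subnn /be /riccati_sum big_ord0 /al/= subr0.
  by congr expR; ring.
have -> : \int[P]_w Fj N w - \int[P]_w Fj 0 w =
    \sum_(j < N) (\int[P]_w Fj j.+1 w - \int[P]_w Fj j w).
  by rewrite -(big_mkord xpredT (fun j => \int[P]_w Fj j.+1 w - \int[P]_w Fj j w)) telescope_sumr.
apply: (le_trans (ler_norm_sum _ _ _)).
apply: (@le_trans _ _ (\sum_(j < N) lindeberg_const / (N%:R * r))).
  by apply: ler_sum => j _; exact: step.
rewrite sumr_const card_ord -[leLHS]mulr_natl.
have -> // : N%:R * (lindeberg_const / (N%:R * r)) = lindeberg_const / r.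
by field; rewrite !gt_eqF.
Qed.

End lindeberg.

(** * Sampling a continuous path *)

Section sampled_path.
Context (R : realType).
Notation mu := (@lebesgue_measure R).
Notation I01 := ([set` `]0%R, 1%R]] : set R).

Definition sampled (x : R -> R) (n : nat) (s : R) : R :=
  \sum_(j < n) x (j%:R / n%:R) * \1_(`]j%:R / n%:R, j.+1%:R / n%:R]) s.

(** The cells are left-open, like the intervals of a step process. *)
Lemma sampled_cell (n : nat) (s : R) : (0 < n)%N -> 0 < s <= 1 ->
  exists j : 'I_n, j%:R / n%:R < s <= j.+1%:R / n%:R.
Proof.
move=> n0 /andP[s0 s1]; have nR : 0 < n%:R :> R by rewrite ltr0n.
have ex : exists j, s <= j.+1%:R / n%:R.
  by exists n.-1; rewrite prednK// divff// gt_eqF.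
have hj : s <= (ex_minn ex).+1%:R / n%:R by case: ex_minnP.
have jn : (ex_minn ex < n)%N.
  case: ex_minnP => m sm /(_ n.-1); rewrite prednK// divff ?gt_eqF// => /(_ s1).
  by move=> mn; rewrite (leq_ltn_trans mn)// ltn_predL.
exists (Ordinal jn); rewrite /= hj andbT.
case: ex_minnP {hj jn} => -[|m] sm mmin; first by rewrite mul0r.
by rewrite ltNge; apply/negP => /mmin; rewrite ltnn.
Qed.

Lemma sampledE (x : R -> R) (n : nat) (j : 'I_n) (s : R) :
  j%:R / n%:R < s <= j.+1%:R / n%:R -> sampled x n s = x (j%:R / n%:R).
Proof.
move=> /andP[js sj]; rewrite /sampled (bigD1 j)//= indicE mem_set/=; last first.
  by rewrite in_itv/= js sj.
rewrite mulr1 big1 ?addr0// => i ij; rewrite indicE memNset ?mulr0//=.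
rewrite in_itv/= => /andP[is_ si].
have n0 : 0 < n%:R :> R by rewrite ltr0n (leq_ltn_trans _ (ltn_ord j)).
have : i%:R / n%:R < j.+1%:R / n%:R := lt_le_trans is_ sj.
have : j%:R / n%:R < i.+1%:R / n%:R := lt_le_trans js si.
rewrite !ltr_pM2r ?invr_gt0// !ltr_nat !ltnS => ji ij'.
by move/eqP: ij; apply; apply/val_inj/eqP; rewrite eqn_leq ij' ji.
Qed.

Lemma measurable_sampled x n D : measurable_fun D (sampled x n).
Proof.
apply: measurable_funTS; rewrite /sampled; apply: measurable_sum => j.
by apply: measurable_funM => //; exact: measurable_indic.
Qed.

Lemma cell_node_itv n (j : 'I_n) : (j%:R / n%:R : R) \in `[0, 1].
Proof.
have n0 : 0 < n%:R :> R by rewrite ltr0n (leq_ltn_trans _ (ltn_ord j)).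
by rewrite in_itv/= divr_ge0//= ler_pdivrMr// mul1r ler_nat ltnW.
Qed.

Variable x : R -> R.
Hypothesis cx : {within `[0, 1], continuous x}.

Lemma path_bounded : exists2 B, 0 <= B & forall s, 0 <= s <= 1 -> `|x s| <= B.
Proof.
have [c _ cmax] := EVT_max ler01 cx; have [e _ emin] := EVT_min ler01 cx.
exists (`|x c| + `|x e|); first exact: addr_ge0.
move=> s s01; have := cmax s; have := emin s; rewrite in_itv/= => /(_ s01) h1 /(_ s01) h2.
have := ler_norm (x c); have := ler_norm (- x e); rewrite normrN.
have := normr_ge0 (x e); have := normr_ge0 (x c).
by move=> *; rewrite ler_norml; apply/andP; split; lra.
Qed.

Lemma measurable_path : measurable_fun ([set` `[0%R, 1%R]] : set R) x.
Proof. exact: subspace_continuous_measurable_fun. Qed.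

Lemma sampled_cvg (s : R) : 0 < s <= 1 -> sampled x n.+1 s @[n --> \oo] --> x s.
Proof.
move=> s01; have s01' : s \in `[0, 1] by rewrite in_itv/= ltW; case/andP: s01.
apply/cvgrPdist_lt => e e0.
have /subspace_continuousP/(_ s s01')/cvgrPdist_lt/(_ e e0) := cx.
rewrite near_withinE => /nbhs_ballP[dlt /= dlt0 dltP].
near=> n.
have [j js] := @sampled_cell n.+1 s (ltn0Sn n) s01.
rewrite (sampledE _ js); apply: dltP; last exact: cell_node_itv.
case/andP: js => js sj.
rewrite /ball/= gtr0_norm ?subr_gt0// (@le_lt_trans _ _ n.+1%:R^-1)//.
  by rewrite lerBlDl (le_trans sj)// -[j.+1]addn1 natrD mulrDl mul1r.
near: n; exact: near_infty_natSinv_lt (PosNum dlt0).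
Unshelve. all: by end_near. Qed.

Lemma sampled_bound B n s : 0 <= B -> (forall s, 0 <= s <= 1 -> `|x s| <= B) ->
  0 < s <= 1 -> `|sampled x n.+1 s| <= B.
Proof.
move=> B0 xB s01; have [j js] := @sampled_cell n.+1 s (ltn0Sn n) s01.
by rewrite (sampledE _ js) xB//; have := cell_node_itv j; rewrite in_itv.
Qed.

(** Dominated convergence for the left-point discretisations of a continuous
    path.  With [h = 0] it is the convergence of the Riemann sums of [x ^ 2]. *)
Lemma sampled_sqdist_cvg (h : R -> R) (C : R) :
  measurable_fun setT h -> (forall s, `|h s| <= C) ->
  (\int[mu]_(s in `]0%R, 1%R]) ((h s - sampled x n.+1 s) ^+ 2)%:E)%E @[n --> \oo] -->
  (\int[mu]_(s in `]0%R, 1%R]) ((h s - x s) ^+ 2)%:E)%E.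
Proof.
move=> mh hC; have [B B0 xB] := path_bounded.
have C0 : 0 <= C := le_trans (normr_ge0 _) (hC 0).
have mx : measurable_fun I01 x.
  apply: measurable_funS measurable_path => //.
  by apply: subset_itvr; rewrite bnd_simp.
have mhx : measurable_fun I01 (fun s => (h s - x s) ^+ 2).
  by apply: measurable_funX; apply: measurable_funB => //; exact: measurable_funTS.
have mhn n : measurable_fun I01 (fun s => (h s - sampled x n.+1 s) ^+ 2).
  apply: measurable_funX; apply: measurable_funB => //.
    exact: measurable_funTS.
  exact: measurable_sampled.
have [|||||_ _] := @dominated_convergence _ _ _ mu I01 (measurable_itv _)
  (fun n s => ((h s - sampled x n.+1 s) ^+ 2)%:E)
  (fun s => ((h s - x s) ^+ 2)%:E) (fun=> ((C + B) ^+ 2)%:E).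
- by move=> n; apply/measurable_EFinP; exact: mhn.
- by apply/measurable_EFinP; exact: mhx.
- apply: aeW => s /=; rewrite in_itv/= => s01.
  apply: cvg_EFin; first exact: nearW.
  have hd : h s - sampled x n.+1 s @[n --> \oo] --> h s - x s.
    by apply: cvgB; [exact: cvg_cst|exact: sampled_cvg].
  rewrite expr2 [X in X @ _ --> _](_ : _ = (fun n =>
      (h s - sampled x n.+1 s) * (h s - sampled x n.+1 s))); first exact: cvgM.
  by apply/funext => n /=; rewrite expr2.
- apply/integrableP; split => //.
  rewrite integral_cst//= lebesgue_measure_itv/= lte_fin ltr01.
  by rewrite -EFinB -EFinM ltry.
- apply: aeW => s n /=; rewrite in_itv/= => s01.
  rewrite lee_fin ger0_norm ?sqr_ge0// -[leLHS]real_normK ?num_real//.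
  rewrite lerXn2r ?nnegrE ?addr_ge0//.
  by rewrite (le_trans (ler_normB _ _))// lerD// sampled_bound.
- exact.
Qed.

End sampled_path.

(** * Isometry for sums of elementary integrals *)

Section fourth_moment.
Context (R : realType) d (Omega : measurableType d) (P : probability Omega R).
Implicit Types X Y : Omega -> R.

Definition rv4 X := measurable_fun setT X /\
  P.-integrable setT (EFin \o (fun w => X w ^+ 4)).

Lemma rv4D X Y : rv4 X -> rv4 Y -> rv4 (fun w => X w + Y w).
Proof.
move=> [mX iX] [mY iY]; have mXY := measurable_funD mX mY; split => //.
apply: (integrable_dom _ (integrable_scale 8 (integrable_add iX iY))).
  exact: measurable_funX.
move=> w; rewrite ger0_norm ?exprn_even_ge0//.
have h1 := sqr_ge0 (X w ^+ 2 - Y w ^+ 2); have h2 := sqr_ge0 (X w - Y w).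
have h3 := sqr_ge0 ((X w - Y w) * (X w + Y w)).
have h4 := sqr_ge0 ((X w - Y w) ^+ 2).
move: (X w) (Y w) h1 h2 h3 h4 => x y h1 h2 h3 h4; nra.
Qed.

Lemma rv4N X : rv4 X -> rv4 (fun w => - X w).
Proof.
move=> [mX iX]; split; first exact: measurableT_comp.
by apply: eq_integrable iX => // w _ /=; rewrite exprNn -signr_odd expr0 mul1r.
Qed.

Lemma rv4_bounded X C : measurable_fun setT X -> (forall w, `|X w| <= C) -> rv4 X.
Proof.
move=> mX XC; split => //; apply: (@integrable_bounded _ _ _ P _ (C ^+ 4)).
  exact: measurable_funX.
by move=> w; rewrite normrX lerXn2r ?nnegrE// (le_trans _ (XC w)).
Qed.

Lemma rv4_cst c : rv4 (fun=> c).
Proof. exact: (@rv4_bounded _ `|c|). Qed.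

Lemma rv4_mul4 X1 X2 X3 X4 : rv4 X1 -> rv4 X2 -> rv4 X3 -> rv4 X4 ->
  P.-integrable setT (EFin \o (fun w => X1 w * X2 w * (X3 w * X4 w))).
Proof.
move=> [m1 i1] [m2 i2] [m3 i3] [m4 i4].
apply: (integrable_dom _ (integrable_add (integrable_add i1 i2) (integrable_add i3 i4))).
  by apply: measurable_funM; exact: measurable_funM.
move=> w; move: (X1 w) (X2 w) (X3 w) (X4 w) => x y z t.
have E k (u : R) : `|u| ^+ (2 * k) = u ^+ (2 * k) by rewrite !exprM real_normK ?num_real.
rewrite !normrM -[x ^+ 4](E 2%N) -[y ^+ 4](E 2%N) -[z ^+ 4](E 2%N) -[t ^+ 4](E 2%N).
move: `|x| `|y| `|z| `|t| (normr_ge0 x) (normr_ge0 y) (normr_ge0 z) (normr_ge0 t).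
move=> {E} {}x {}y {}z {}t x0 y0 z0 t0.
have h1 := sqr_ge0 (x * y - z * t); have h2 := sqr_ge0 (x ^+ 2 - y ^+ 2).
have h3 := sqr_ge0 (z ^+ 2 - t ^+ 2); have h4 := sqr_ge0 (x ^+ 2); have h5 := sqr_ge0 (y ^+ 2).
have h6 := sqr_ge0 (z ^+ 2); have h7 := sqr_ge0 (t ^+ 2).
nra.
Qed.

Lemma rv4_mul3 X1 X2 X3 : rv4 X1 -> rv4 X2 -> rv4 X3 ->
  P.-integrable setT (EFin \o (fun w => X1 w * X2 w * X3 w)).
Proof.
move=> h1 h2 h3; apply: eq_integrable (rv4_mul4 h1 h2 h3 (rv4_cst 1)) => //.
by move=> w _ /=; rewrite mulr1.
Qed.

Lemma rv4_mul2 X1 X2 : rv4 X1 -> rv4 X2 ->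
  P.-integrable setT (EFin \o (fun w => X1 w * X2 w)).
Proof.
move=> h1 h2; apply: eq_integrable (rv4_mul3 h1 h2 (rv4_cst 1)) => //.
by move=> w _ /=; rewrite mulr1.
Qed.

Lemma rv4_integrable X : rv4 X -> P.-integrable setT (EFin \o X).
Proof.
move=> h1; apply: eq_integrable (rv4_mul2 h1 (rv4_cst 1)) => //.
by move=> w _ /=; rewrite mulr1.
Qed.

Lemma rv4_ae X Y : measurable_fun setT Y -> {ae P, forall w, X w = Y w} ->
  rv4 X -> rv4 Y.
Proof.
move=> mY XY [mX iX]; split => //.
have mY4 : measurable_fun setT (EFin \o (fun w => Y w ^+ 4)).
  by apply/measurable_EFinP; exact: measurable_funX.
have mX4 : measurable_fun setT (EFin \o (fun w => X w ^+ 4)).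
  by apply/measurable_EFinP; exact: measurable_funX.
apply/integrableP; split => //; move/integrableP : iX => [_].
apply: le_lt_trans; rewrite le_eqVlt; apply/orP; left; apply/eqP.
apply: ae_eq_integral => //; [exact: measurableT_comp..|].
by apply: filterS XY => w /= ->.
Qed.

End fourth_moment.

(** The step integrals that approximate an Ito integral are compared through
    sums of the form [\sum_i xi_i (W b_i - W a_i)] over an arbitrary finite index
    set, so that the difference of two step processes on different grids is
    again of this form. *)
Section ito_isometry.
Context (R : realType) d (Omega : measurableType d) (P : probability Omega R).
Variable W : R -> Omega -> R.
Hypothesis W_wiener : wiener_process P W.
Notation mu := (@lebesgue_measure R).

Let mW t : 0 <= t <= 1 -> measurable_fun setT (W t).
Proof. by case: W_wiener => -[h _] _ _ _; exact: h. Qed.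
Let cW w : {within `[0, 1], continuous (W ^~ w)}.
Proof. by case: W_wiener => -[_ h] _ _ _; exact: h. Qed.
Let W0 : {ae P, forall w, W 0 w = 0}. Proof. by case: W_wiener. Qed.
Let indW : independent_increments P 1 W. Proof. by case: W_wiener. Qed.

Let dW s t w := W t w - W s w.

Lemma wiener_increment s t : 0 <= s -> s <= t -> t <= 1 ->
  [/\ rv4 P (dW s t), \int[P]_w dW s t w = 0, \int[P]_w (dW s t w ^+ 2) = t - s &
  \int[P]_w (dW s t w ^+ 4) <= 3 * (t - s) ^+ 2].
Proof.
move=> s0; rewrite le_eqVlt => /predU1P[<- _|st t1].
  rewrite (_ : dW s s = fun=> 0); last by apply/funext => w; rewrite /dW subrr.
  split; first exact: rv4_cst.
  - by rewrite Rintegral_prob_cst.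
  - by rewrite Rintegral_prob_cst expr0n/= subrr.
  - by rewrite Rintegral_prob_cst subrr !expr0n/= mulr0.
have m : measurable_fun setT (dW s t).
  by apply: measurable_funB; apply: mW; rewrite ?s0 ?t1 ?(le_trans s0)//= ltW// (lt_le_trans st).
have sg : 0 < Num.sqrt (t - s) by rewrite sqrtr_gt0 subr_gt0.
have law B : measurable B -> P [set w | B (dW s t w)] = normal_prob 0 (Num.sqrt (t - s)) B.
  by case: W_wiener => _ _ _ h mB; exact: h.
have [i4 e1 e2 e4] := gaussian_moments sg m law.
have sq : Num.sqrt (t - s) ^+ 2 = t - s by rewrite sqr_sqrtr// subr_ge0 ltW.
split => //; first by rewrite e2 sq.
have s4 : Num.sqrt (t - s) ^+ 4 = (t - s) ^+ 2 by rewrite (exprM _ 2 2) sq.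
by rewrite -s4.
Qed.

Lemma wiener_rv4 t : 0 <= t <= 1 -> rv4 P (W t).
Proof.
move=> /andP[t0 t1]; have [h _ _ _] := wiener_increment (lexx 0) t0 t1.
apply: (rv4_ae (X := dW 0 t)) => //; first by apply: mW; rewrite t0.
by apply: filterS W0 => w W0w; rewrite /dW W0w subr0.
Qed.

Let zero_mean c e eta : 0 <= c -> c <= e -> e <= 1 -> adapted W c eta ->
  P.-integrable setT (EFin \o eta) -> \int[P]_w (eta w * dW c e w) = 0.
Proof.
move=> c0 ce e1 ad ie; have [h m0 _ _] := wiener_increment c0 ce e1.
have [_ ->] := adapted_indep mW indW W0 c0 ce e1 ad (@measurable_id _ _ setT) ie
  (rv4_integrable h).
by rewrite [X in _ * X]m0 mulr0.
Qed.

Let square_mean c e eta : 0 <= c -> c <= e -> e <= 1 -> adapted W c eta ->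
  P.-integrable setT (EFin \o eta) ->
  \int[P]_w (eta w * (dW c e w * dW c e w)) = (\int[P]_w eta w) * (e - c).
Proof.
move=> c0 ce e1 ad ie; have [h _ m2 _] := wiener_increment c0 ce e1.
have m : measurable_fun setT (fun y : R => y * y) by exact: measurable_funM.
have [_ ->] := adapted_indep mW indW W0 c0 ce e1 ad m ie (rv4_mul2 h h).
by rewrite -m2; congr (_ * _); apply: eq_Rintegral => w _; rewrite expr2.
Qed.

(** The length of the intersection of the intervals from [a] to [b] and from [c] to [e]. *)
Definition overlap (a b c e : R) : R := Num.max 0 (Num.min b e - Num.max a c).

Lemma overlapC a b c e : overlap a b c e = overlap c e a b.
Proof. by rewrite /overlap (minC b) (maxC a). Qed.

(** The intervals are cut at their end points.  On disjoint intervals the later increment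
    is centred and independent of the rest; on the common part its square has mean the
    length of the overlap. *)
Lemma ito_isometry_pair a b c e xi zeta :
  0 <= a -> a <= b -> b <= 1 -> 0 <= c -> c <= e -> e <= 1 ->
  adapted W a xi -> rv4 P xi -> adapted W c zeta -> rv4 P zeta ->
  \int[P]_w (xi w * dW a b w * (zeta w * dW c e w)) =
  (\int[P]_w (xi w * zeta w)) * overlap a b c e.
Proof.
wlog ac : a b c e xi zeta / a <= c.
  move=> wl a0 ab b1 c0 ce e1 ax rx az rz.
  have [ac|/ltW ca] := leP a c; first exact: wl.
  have := wl c e a b zeta xi ca c0 ce e1 a0 ab b1 az rz ax rx.
  rewrite overlapC => h; under eq_Rintegral do rewrite mulrC.
  by rewrite h; congr (_ * _); apply: eq_Rintegral => w _; rewrite mulrC.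
move=> a0 ab b1 c0 ce e1 ax rx az rz.
have [rab _ _ _] := wiener_increment a0 ab b1.
have [rce _ _ _] := wiener_increment c0 ce e1.
have ax' := adapted_le ac ax.
have addW s t u : 0 <= s <= u -> 0 <= t <= u -> adapted W u (dW s t).
  move=> su tu; apply: (adaptedD (e1 := W t) (e2 := fun w => - W s w)).
    exact: adapted_process.
  by apply: (adapted_comp (h := -%R)) => //; exact: adapted_process.
have axz : adapted W c (fun w => xi w * zeta w) by exact: adaptedM.
have [bc|/ltW cb] := leP b c.
  rewrite /overlap (max_idPl _); last first.
    by rewrite (max_idPr ac) subr_le0 (le_trans _ bc)// ge_min lexx.
  rewrite mulr0 -[RHS](@zero_mean c e (fun w => xi w * dW a b w * zeta w))//.
  - by apply: eq_Rintegral => w _; rewrite mulrA.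
  - by apply: adaptedM => //; apply: adaptedM => //; apply: addW; rewrite ?a0 ?(le_trans a0).
  - exact: rv4_mul3.
have [rac _ _ _] := wiener_increment a0 ac (le_trans ce e1).
have adac : adapted W c (fun w => xi w * zeta w * dW a c w).
  by apply: adaptedM => //; apply: addW; rewrite ?a0 ?c0 ?lexx.
have E0 := zero_mean c0 ce e1 adac (rv4_mul3 rx rz rac).
have i0 := rv4_mul4 (rv4D rx (rv4_cst P 0)) rz rac rce.
have {}i0 : P.-integrable setT (EFin \o (fun w => xi w * zeta w * dW a c w * dW c e w)).
  by apply: eq_integrable i0 => // w _ /=; rewrite addr0 mulrA.
have ixz := rv4_mul2 rx rz.
have [be|/ltW eb] := leP b e.
  have [rcb _ _ _] := wiener_increment c0 cb b1.
  have [rbe _ _ _] := wiener_increment (le_trans c0 cb) be e1.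
  have E1 := square_mean c0 cb b1 axz ixz.
  have ad2 : adapted W b (fun w => xi w * zeta w * dW c b w).
    apply: adaptedM; first exact: adapted_le axz.
    by apply: addW; rewrite ?c0 ?lexx ?(le_trans c0).
  have E2 := zero_mean (le_trans c0 cb) be e1 ad2 (rv4_mul3 rx rz rcb).
  have i1 := rv4_mul4 rx rz rcb rcb; have i2 := rv4_mul4 rx rz rcb rbe.
  have {}i2 : P.-integrable setT (EFin \o (fun w => xi w * zeta w * dW c b w * dW b e w)).
    by apply: eq_integrable i2 => // w _ /=; rewrite mulrA.
  rewrite (@eq_Rintegral _ _ _ P _ (fun w => xi w * zeta w * dW a c w * dW c e w +
    (xi w * zeta w * (dW c b w * dW c b w) + xi w * zeta w * dW c b w * dW b e w))); last first.
    by move=> w _; rewrite /dW; ring.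
  rewrite RintegralD//; last exact: integrable_add.
  rewrite RintegralD// E0 E1 E2 add0r addr0 /overlap (min_idPl be) (max_idPr ac).
  by rewrite (max_idPr _)// subr_ge0.
have [reb _ _ _] := wiener_increment (le_trans c0 ce) eb b1.
have E1 := square_mean c0 ce e1 axz ixz.
have ad2 : adapted W e (fun w => xi w * zeta w * dW c e w).
  apply: adaptedM; first exact: adapted_le axz.
  by apply: addW; rewrite ?c0 ?lexx ?(le_trans c0).
have E2 := zero_mean (le_trans c0 ce) eb b1 ad2 (rv4_mul3 rx rz rce).
have i1 := rv4_mul4 rx rz rce rce; have i2 := rv4_mul4 rx rz rce reb.
have {}i2 : P.-integrable setT (EFin \o (fun w => xi w * zeta w * dW c e w * dW e b w)).
  by apply: eq_integrable i2 => // w _ /=; rewrite mulrA.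
rewrite (@eq_Rintegral _ _ _ P _ (fun w => xi w * zeta w * dW a c w * dW c e w +
  (xi w * zeta w * (dW c e w * dW c e w) + xi w * zeta w * dW c e w * dW e b w))); last first.
  by move=> w _; rewrite /dW; ring.
rewrite RintegralD//; last exact: integrable_add.
rewrite RintegralD// E0 E1 E2 add0r addr0 /overlap (min_idPr eb) (max_idPr ac).
by rewrite (max_idPr _)// subr_ge0.
Qed.

Section elementary_sum.
Variables (I : finType) (a b : I -> R) (xi : I -> Omega -> R).
Hypothesis ab : forall i, [/\ 0 <= a i, a i <= b i & b i <= 1].
Hypothesis adxi : forall i, adapted W (a i) (xi i).
Hypothesis rxi : forall i, rv4 P (xi i).

Let Q w := \sum_(i : I) \sum_(j : I) xi i w * xi j w * overlap (a i) (b i) (a j) (b j).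

Let integral_indicM (a1 b1 a2 b2 : R) : 0 <= a1 -> b1 <= 1 ->
  mu.-integrable [set` `]0%R, 1%R]]
    (EFin \o (fun s : R => \1_(`]a1, b1]) s * \1_(`]a2, b2]) s)) /\
  \int[mu]_(s in `]0%R, 1%R]) (\1_(`]a1, b1]) s * \1_(`]a2, b2]) s) =
  overlap a1 b1 a2 b2.
Proof.
move=> a0 b0; pose lo := Num.max a1 a2; pose hi := Num.min b1 b2.
have E : (fun s : R => \1_(`]a1, b1]) s * \1_(`]a2, b2]) s) =
    (\1_(`]lo, hi]) : R -> R).
  apply/funext => s; rewrite !indicE -natrM mulnb; congr (nat_of_bool _)%:R.
  by apply/andP/idP; rewrite !inE /= !in_itv/= gt_max le_min;
    [case=> /andP[-> ->] /andP[-> ->]|case/andP => /andP[-> ->] /andP[-> ->]].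
rewrite E; split.
  apply/integrableP; split; first by apply/measurable_EFinP; exact: measurable_indic.
  under eq_integral do rewrite /= ger0_norm//.
  rewrite integral_indic//; apply: (@le_lt_trans _ _ (mu `]0%R, 1%R])).
    by apply: le_measure; rewrite ?inE//; exact: measurableI.
  by rewrite lebesgue_measure_itv/= lte_fin ltr01 -EFinB ltry.
rewrite /Rintegral integral_indic// setIidl; last first.
  move=> s /=; rewrite !in_itv/= gt_max le_min => /andP[/andP[s1 _] /andP[s2 _]].
  by rewrite (le_lt_trans a0 s1) (le_trans s2 b0).
rewrite -[LHS]/(fine (@lebesgue_measure R [set` `]lo, hi]%R])).
rewrite lebesgue_measure_itv/= lte_fin /overlap -/lo -/hi.
case: ltP => lh /=; first by rewrite (max_idPr _)// subr_ge0 ltW.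
by rewrite (max_idPl _)// subr_le0.
Qed.

(** Expanding the square of the elementary process gives the same double sum over
    overlaps as expanding the square of its stochastic integral. *)
Lemma elementary_path_integral w :
  \int[mu]_(s in `]0%R, 1%R]) ((\sum_(i : I) xi i w * \1_(`]a i, b i]) s) ^+ 2) = Q w /\
  mu.-integrable [set` `]0%R, 1%R]]
    (EFin \o (fun s : R => (\sum_(i : I) xi i w * \1_(`]a i, b i]) s) ^+ 2)).
Proof.
have E : (fun s : R => (\sum_(i : I) xi i w * \1_(`]a i, b i]) s) ^+ 2) =
  (fun s => \sum_(i : I) \sum_(j : I)
    xi i w * xi j w * (\1_(`]a i, b i]) s * \1_(`]a j, b j]) s)).
  apply/funext => s; rewrite expr2 big_distrlr/=; apply: eq_bigr => i _.
  by apply: eq_bigr => j _; ring.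
have ij i j : mu.-integrable [set` `]0%R, 1%R]] (EFin \o (fun s : R =>
    xi i w * xi j w * (\1_(`]a i, b i]) s * \1_(`]a j, b j]) s))).
  have [ai _ bi] := ab i; have [h _] := integral_indicM (a j) (b j) ai bi.
  by have := fun mD => integrableZl mD (xi i w * xi j w) h; apply.
rewrite E; split; last by apply: integrable_bigsum => // i _; apply: integrable_bigsum.
rewrite Rintegral_bigsum//; last by move=> i _; apply: integrable_bigsum.
apply: eq_bigr => i _; rewrite Rintegral_bigsum//; apply: eq_bigr => j _.
have [ai _ bi] := ab i; have [h e] := integral_indicM (a j) (b j) ai bi.
by rewrite RintegralZl// e.
Qed.

Let measurable_Q : measurable_fun setT Q.
Proof.
apply: measurable_sum => i; apply: measurable_sum => j.
apply: measurable_funM => //; apply: measurable_funM; [by case: (rxi i)|by case: (rxi j)].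
Qed.

Lemma elementary_isometry :
  (\int[P]_w ((\sum_(i : I) xi i w * (W (b i) w - W (a i) w)) ^+ 2)%:E =
   \int[P]_w (Q w)%:E)%E.
Proof.
have rW i : rv4 P (dW (a i) (b i)).
  by have [ai aib bi] := ab i; have [] := wiener_increment ai aib bi.
have ixx i j := rv4_mul2 (rxi i) (rxi j).
have iW i j := rv4_mul4 (rxi i) (rW i) (rxi j) (rW j).
have E : (fun w => (\sum_(i : I) xi i w * (W (b i) w - W (a i) w)) ^+ 2) =
  (fun w => \sum_(i : I) \sum_(j : I)
    xi i w * dW (a i) (b i) w * (xi j w * dW (a j) (b j) w)).
  by apply/funext => w; rewrite expr2 big_distrlr.
have iQ i j : P.-integrable setT (EFin \o (fun w => xi i w * xi j w * overlap (a i) (b i) (a j) (b j))).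
  apply: eq_integrable (integrable_scale (overlap (a i) (b i) (a j) (b j)) (ixx i j)) => //.
  by move=> w _ /=; rewrite mulrC.
rewrite -[LHS]fineK; last first.
  apply: integrable_fin_num => //.
  apply: (eq_integrable measurableT (EFin \o (fun w => \sum_(i : I) \sum_(j : I)
    xi i w * dW (a i) (b i) w * (xi j w * dW (a j) (b j) w)))).
    by move=> w _ /=; congr EFin; move: (congr1 (@^~ w) E) => /= ->.
  by apply: integrable_bigsum => // i _; exact: integrable_bigsum.
rewrite -[RHS]fineK; last first.
  apply: integrable_fin_num => //.
  by apply: integrable_bigsum => // i _; exact: integrable_bigsum.
congr EFin; rewrite -[LHS]/(\int[P]_w _)%R -[RHS]/(\int[P]_w Q w)%R E.
rewrite Rintegral_bigsum//; last by move=> i _; exact: integrable_bigsum.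
rewrite Rintegral_bigsum//; last by move=> i _; exact: integrable_bigsum.
apply: eq_bigr => i _; rewrite !Rintegral_bigsum//.
apply: eq_bigr => j _; rewrite RintegralZr//.
have [ai aib bi] := ab i; have [aj ajb bj] := ab j.
exact: ito_isometry_pair.
Qed.

End elementary_sum.

End ito_isometry.

(** * The Ito integral of a Wiener process against itself *)

Section ito_integral_of_wiener.
Context (R : realType) d (Omega : measurableType d) (P : probability Omega R).
Variable W : R -> Omega -> R.
Hypothesis W_wiener : wiener_process P W.
Notation mu := (@lebesgue_measure R).

Let mW t : 0 <= t <= 1 -> measurable_fun setT (W t).
Proof. by case: W_wiener => -[h _] _ _ _; exact: h. Qed.
Let cW w : {within `[0, 1], continuous (W ^~ w)}.
Proof. by case: W_wiener => -[_ h] _ _ _; exact: h. Qed.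
Let W0 : {ae P, forall w, W 0 w = 0}. Proof. by case: W_wiener. Qed.
Let indW : independent_increments P 1 W. Proof. by case: W_wiener. Qed.

(** Like [step_admissible], but with fourth moments instead of bounds on the
    coefficients, so that the discretisations of [W] itself are covered. *)
Definition step_rv4 (h : step_process R Omega) :=
  [/\ 0 <= step_time h 0%N, step_time h (step_size h) <= 1,
      (forall i, (i < step_size h)%N -> step_time h i <= step_time h i.+1) &
      (forall i, (i < step_size h)%N ->
        adapted W (step_time h i) (step_coef h i) /\ rv4 P (step_coef h i))].

Lemma step_times (g : nat -> R) n : 0 <= g 0%N -> g n <= 1 ->
  (forall i, (i < n)%N -> g i <= g i.+1) ->
  forall i, (i < n)%N -> [/\ 0 <= g i, g i <= g i.+1 & g i.+1 <= 1].
Proof.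
move=> g0 gn gle.
have le i j : (i <= j <= n)%N -> g i <= g j.
  elim: j => [|j IH]; first by rewrite leqn0 => /andP[/eqP->].
  case/andP; rewrite leq_eqVlt => /predU1P[->//|ij jn].
  by apply: le_trans (gle _ jn); apply: IH; rewrite -ltnS ij (ltnW jn).
move=> i ni; split; last by apply: le_trans gn; apply: le; rewrite ni leqnn.
- by apply: le_trans g0 _; apply: le; rewrite /= ltnW.
- exact: gle.
Qed.

Lemma step_admissible_rv4 h : step_admissible W h -> step_rv4 h.
Proof.
move=> [h0 h1 hle hc]; split => // i ni; have [ad [C hC]] := hc i ni.
have [ti0 ti ti1] := step_times h0 h1 hle ni.
split; first exact: ad.
apply: rv4_bounded hC; apply: (adapted_measurable mW indW W0 _ ad).
by rewrite ti0 (le_trans ti).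
Qed.

Definition step_sqdist (g h : step_process R Omega) (w : Omega) : \bar R :=
  (\int[mu]_(s in `]0%R, 1%R]) ((step_eval g s w - step_eval h s w) ^+ 2)%R%:E)%E.

(** The difference of two step processes is an elementary sum indexed by the disjoint
    union of both index sets; no common refinement of the grids has to be built. *)
Lemma step_isometry g h : step_rv4 g -> step_rv4 h ->
  measurable_fun setT (step_sqdist g h) /\
  (\int[P]_w ((step_integral W g w - step_integral W h w) ^+ 2)%:E =
   \int[P]_w step_sqdist g h w)%E.
Proof.
move=> [g0 g1 gle gc] [h0 h1 hle hc].
pose I := ('I_(step_size g) + 'I_(step_size h))%type.
pose a (i : I) := match i with inl i => step_time g i | inr j => step_time h j end.
pose b (i : I) := match i with inl i => step_time g i.+1 | inr j => step_time h j.+1 end.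
pose xi (i : I) : Omega -> R := match i with
  inl i => step_coef g i | inr j => fun w => - step_coef h j w end.
have ab i : [/\ 0 <= a i, a i <= b i & b i <= 1].
  by case: i => i; [exact: (step_times g0 g1 gle)|exact: (step_times h0 h1 hle)].
have ad i : adapted W (a i) (xi i).
  case: i => i; first by have [] := gc i (ltn_ord i).
  apply: (adapted_comp (h := -%R)) => //.
  by have [] := hc i (ltn_ord i).
have rxi i : rv4 P (xi i).
  case: i => i; first by have [] := gc i (ltn_ord i).
  by apply: rv4N; have [] := hc i (ltn_ord i).
have E1 w : step_integral W g w - step_integral W h w =
    \sum_(i : I) xi i w * (W (b i) w - W (a i) w).
  rewrite big_sumType /= -sumrN; congr (_ + _); apply: eq_bigr => j _.
  by rewrite mulNr.
have E2 w s : step_eval g s w - step_eval h s w =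
    \sum_(i : I) xi i w * \1_(`]a i, b i]) s.
  rewrite big_sumType /= -sumrN; congr (_ + _); apply: eq_bigr => j _.
  by rewrite mulNr.
have E3 w : step_sqdist g h w = (\sum_(i : I) \sum_(j : I)
    xi i w * xi j w * overlap (a i) (b i) (a j) (b j))%:E.
  have [e i] := elementary_path_integral xi ab w.
  rewrite -e /Rintegral fineK; last exact: integrable_fin_num.
  by apply: eq_integral => s _; rewrite E2.
split.
  apply: (eq_measurable_fun (fun w => (\sum_(i : I) \sum_(j : I)
    xi i w * xi j w * overlap (a i) (b i) (a j) (b j))%:E)).
    by move=> w _; rewrite E3.
  apply/measurable_EFinP; apply: measurable_sum => i; apply: measurable_sum => j.
  apply: measurable_funM => //; apply: measurable_funM; [by case: (rxi i)|by case: (rxi j)].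
under eq_integral do rewrite E1.
by under [RHS]eq_integral do rewrite E3; exact: elementary_isometry.
Qed.

Let node n i : R := i%:R / n.+1%:R.

Definition sampled_wiener n : step_process R Omega :=
  StepProcess n.+1 (node n) (fun i => W (node n i)).

Let node_itv n i : (i <= n.+1)%N -> 0 <= node n i <= 1.
Proof. by move=> iN; rewrite divr_ge0//= ler_pdivrMr// mul1r ler_nat. Qed.

Let node_le n i j : (i <= j)%N -> node n i <= node n j.
Proof. by move=> ij; rewrite ler_wpM2r// ler_nat. Qed.

Lemma sampled_wiener_rv4 n : step_rv4 (sampled_wiener n).
Proof.
split => /=.
- by rewrite /node mul0r.
- by rewrite /node divff.
- by move=> i _; exact: node_le.
- move=> i ni; have i01 := node_itv (ltnW ni); split; last exact: wiener_rv4.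
  by apply: adapted_process; rewrite lexx andbT; case/andP: i01.
Qed.

Definition wiener_ito w := (W 1 w ^+ 2 - 1) / 2.

(** [x (y - x) = (y^2 - x^2) / 2 - (y - x)^2 / 2], and the first terms telescope. *)
Lemma sampled_integralE n w : W 0 w = 0 ->
  step_integral W (sampled_wiener n) w - wiener_ito w =
  - (\sum_(i < n.+1) ((W (node n i.+1) w - W (node n i) w) ^+ 2 - n.+1%:R^-1)) / 2.
Proof.
move=> W0w; rewrite sumrB sumr_const card_ord -[_ *+ n.+1]mulr_natl divff//.
rewrite /step_integral /= /wiener_ito.
have T : \sum_(i < n.+1) (W (node n i.+1) w ^+ 2 - W (node n i) w ^+ 2) = W 1 w ^+ 2.
  rewrite -(big_mkord xpredT (fun i => W (node n i.+1) w ^+ 2 - W (node n i) w ^+ 2)).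
  by rewrite telescope_sumr// /node divff// mul0r W0w expr0n subr0.
rewrite -T.
have -> : \sum_(i < n.+1) W (node n i) w * (W (node n i.+1) w - W (node n i) w) =
   \sum_(i < n.+1) ((W (node n i.+1) w ^+ 2 - W (node n i) w ^+ 2) / 2 -
     (W (node n i.+1) w - W (node n i) w) ^+ 2 / 2).
  by apply: eq_bigr => i _; field.
by rewrite sumrB -!mulr_suml; field.
Qed.

Let dev n i w := (W (node n i.+1) w - W (node n i) w) ^+ 2 - n.+1%:R^-1.

(** The deviations of the squared increments from [1/(n+1)] are centred and
    uncorrelated, so their variances add up. *)
Lemma sum_dev_variance n :
  P.-integrable setT (EFin \o (fun w => (\sum_(i < n.+1) dev n i w) ^+ 2)) /\
  \int[P]_w ((\sum_(i < n.+1) dev n i w) ^+ 2) <= 3 / n.+1%:R.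
Proof.
pose c : R := n.+1%:R^-1.
have nodeP i : (i < n.+1)%N -> [/\ 0 <= node n i, node n i <= node n i.+1 & node n i.+1 <= 1].
  move=> ni; have /andP[? _] := node_itv (ltnW ni); have /andP[_ ?] := node_itv ni.
  by split => //; exact: node_le.
have dn i : node n i.+1 - node n i = c.
  by rewrite /node -mulrBl -natrB// subSnn mul1r.
have mom i : (i < n.+1)%N -> [/\ rv4 P (fun w => W (node n i.+1) w - W (node n i) w),
    \int[P]_w ((W (node n i.+1) w - W (node n i) w) ^+ 2) = c &
    \int[P]_w ((W (node n i.+1) w - W (node n i) w) ^+ 4) <= 3 * c ^+ 2].
  move=> /nodeP[i0 ii i1]; have [h _ e2 e4] := wiener_increment W_wiener i0 ii i1.
  by split => //; [rewrite e2 dn|rewrite -(dn i)].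
have i22 i j : (i < n.+1)%N -> (j < n.+1)%N ->
    P.-integrable setT (EFin \o (fun w => dev n i w * dev n j w)).
  move=> /mom[ri _ _] /mom[rj _ _].
  have icc := finite_measure_integrable_cst P (c * c) measurableT.
  apply: eq_integrable (integrable_add (integrable_sub (integrable_sub
    (rv4_mul4 ri ri rj rj) (integrable_scale c (rv4_mul2 ri ri)))
    (integrable_scale c (rv4_mul2 rj rj))) icc) => //.
  by move=> w _ /=; rewrite /dev -/c; congr EFin; ring.
have idev i : (i < n.+1)%N -> P.-integrable setT (EFin \o dev n i).
  move=> /mom[ri _ _].
  apply: eq_integrable (integrable_sub (rv4_mul2 ri ri)
    (finite_measure_integrable_cst P c measurableT)) => //.
have dev0 i : (i < n.+1)%N -> \int[P]_w dev n i w = 0.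
  move=> ni; have [ri e2 _] := mom _ ni.
  rewrite /dev -/c RintegralB//; last 2 first.
  - exact: rv4_mul2.
  - exact: finite_measure_integrable_cst.
  by rewrite e2 Rintegral_prob_cst subrr.
have ltE i j : (i < j)%N -> (j < n.+1)%N -> \int[P]_w (dev n i w * dev n j w) = 0.
  move=> ij jn; have ni := ltn_trans ij jn.
  have [j0 jj j1] := nodeP _ jn.
  have ad : adapted W (node n j) (dev n i).
    apply: (adapted_comp (h := fun y => y ^+ 2 - c)
      (eta := fun w => W (node n i.+1) w - W (node n i) w)).
      by apply: measurable_funB => //; exact: measurable_funX.
    have [i0 _ _] := nodeP _ ni.
    apply: (adaptedD (e1 := W (node n i.+1)) (e2 := fun w => - W (node n i) w)).
      by apply: adapted_process; rewrite node_le// andbT (le_trans i0)// node_le.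
    apply: (adapted_comp (h := -%R)) => //; apply: adapted_process.
    by rewrite i0 node_le// ltnW.
  have mh : measurable_fun setT (fun y : R => y ^+ 2 - c).
    by apply: measurable_funB => //; exact: measurable_funX.
  have [_ e] := adapted_indep mW indW W0 j0 jj j1 ad mh (idev _ ni) (idev _ jn).
  by rewrite e [X in _ * X](dev0 _ jn) mulr0.
have E w : (\sum_(i < n.+1) dev n i w) ^+ 2 =
    \sum_(i < n.+1) \sum_(j < n.+1) dev n i w * dev n j w.
  by rewrite expr2 big_distrlr.
split.
  apply: (eq_integrable measurableT (EFin \o (fun w =>
    \sum_(i < n.+1) \sum_(j < n.+1) dev n i w * dev n j w))).
    by move=> w _ /=; rewrite E.
  by apply: integrable_bigsum => // i _; apply: integrable_bigsum => // j _; exact: i22.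
under eq_Rintegral do rewrite E.
rewrite Rintegral_bigsum//; last first.
  by move=> i _; apply: integrable_bigsum => // j _; exact: i22.
apply: (@le_trans _ _ (\sum_(i < n.+1) 3 * c ^+ 2)); last first.
  rewrite sumr_const card_ord -[leLHS]mulr_natl /c le_eqVlt; apply/orP; left; apply/eqP.
  have n0 : (n.+1%:R : R) != 0 by rewrite pnatr_eq0.
  by move: (n.+1%:R : R) n0 => N N0; field.
apply: ler_sum => i _; rewrite Rintegral_bigsum//; last by move=> j _; exact: i22.
rewrite (bigD1 i)//= big1 ?addr0.
  have [ri e2 e4] := mom i (ltn_ord i).
  have i4 := rv4_mul4 ri ri ri ri; have i2 := rv4_mul2 ri ri.
  rewrite (@eq_Rintegral _ _ _ P _ (fun w =>
    ((W (node n i.+1) w - W (node n i) w) ^+ 4 -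
     2 * c * (W (node n i.+1) w - W (node n i) w) ^+ 2) + c ^+ 2)); last first.
    by move=> w _; rewrite /dev -/c; ring.
  have [_ i4'] := ri.
  have i2' : P.-integrable setT (EFin \o (fun w => 2 * c * (W (node n i.+1) w - W (node n i) w) ^+ 2)).
    exact: integrable_scale i2.
  rewrite RintegralD//; last exact: finite_measure_integrable_cst.
    rewrite RintegralB// RintegralZl// e2 Rintegral_prob_cst.
    have := sqr_ge0 c; move: e4; move: (\int[P]_w _) => e4; nra.
  exact: integrable_sub.
move=> j ji; have [ij|ji'|/val_inj eij] := ltngtP i j.
- exact: ltE.
- by under eq_Rintegral do rewrite mulrC; exact: ltE.
- by rewrite eij eqxx in ji.
Qed.

Let err n : R := n.+1%:R^-1.

Let mstep h : step_rv4 h -> measurable_fun setT (step_integral W h).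
Proof.
move=> [h0 h1 hle hc]; apply: measurable_sum => i.
have [ti0 ti ti1] := step_times h0 h1 hle (ltn_ord i).
have [_ [mc _]] := hc i (ltn_ord i).
apply: measurable_funM => //; apply: measurable_funB; apply: mW.
  by rewrite (le_trans ti0 ti) ti1.
by rewrite ti0 (le_trans ti ti1).
Qed.

Let mI : measurable_fun setT wiener_ito.
Proof.
apply: measurable_funM => //; apply: measurable_funB => //; apply: measurable_funX.
by apply: mW; rewrite ler01 lexx.
Qed.

Let msq (f : Omega -> R) : measurable_fun setT f ->
  measurable_fun setT (fun w => (f w ^+ 2)%:E).
Proof. by move=> mf; apply/measurable_EFinP; exact: measurable_funX. Qed.

Lemma sampled_integral_L2 n :
  (\int[P]_w ((step_integral W (sampled_wiener n) w - wiener_ito w) ^+ 2)%:E <= (err n)%:E)%E.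
Proof.
have [i2 e2] := sum_dev_variance n.
have mG := mstep (sampled_wiener_rv4 n).
rewrite (ae_eq_integral (fun w => (4^-1 * (\sum_(i < n.+1) dev n i w) ^+ 2)%:E))//.
- have i2' := integrable_scale 4^-1 i2.
  rewrite -[leLHS]fineK; last exact: integrable_fin_num i2'.
  rewrite lee_fin -[leLHS]/(\int[P]_w _)%R RintegralZl//.
  by rewrite (le_trans (ler_wpM2l _ e2))// mulrA ler_piMl//; lra.
- by apply: msq; exact: measurable_funB.
- by have := measurable_int _ (integrable_scale 4^-1 i2).
- apply: filterS W0 => w W0w _; rewrite sampled_integralE// -/(dev n _ w).
  by congr EFin; rewrite /dev; field.
Qed.

Let sum_sq_integral (f g h : Omega -> R) (x y : \bar R) :
  measurable_fun setT f -> measurable_fun setT g -> measurable_fun setT h ->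
  (\int[P]_w ((f w - h w) ^+ 2)%:E <= x -> \int[P]_w ((g w - h w) ^+ 2)%:E <= y ->
  \int[P]_w ((f w - g w) ^+ 2)%:E <= 2%:E * x + 2%:E * y)%E.
Proof.
move=> mf mg mh fx gy.
have m1 := msq (measurable_funB mf mh); have m2 := msq (measurable_funB mg mh).
apply: (@le_trans _ _ (\int[P]_w (2%:E * ((f w - h w) ^+ 2)%:E + 2%:E * ((g w - h w) ^+ 2)%:E))%E).
  apply: ge0_le_integral => //.
  - by move=> w _; rewrite lee_fin sqr_ge0.
  - by apply: msq; exact: measurable_funB.
  - by apply: emeasurable_funD; exact: measurable_funeM.
  - move=> w _; rewrite -!EFinM -EFinD lee_fin.
    move: (f w) (g w) (h w) => a b c; have := sqr_ge0 (a - c + (b - c)); nra.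
rewrite ge0_integralD//; last 4 first.
- by move=> w _; rewrite mule_ge0// lee_fin sqr_ge0.
- exact: measurable_funeM.
- by move=> w _; rewrite mule_ge0// lee_fin sqr_ge0.
- exact: measurable_funeM.
rewrite !ge0_integralZl//; try by move=> w _; rewrite lee_fin sqr_ge0.
by rewrite leeD// lee_wpmul2l.
Qed.

Let sampled_pair_L2 n k :
  (\int[P]_w step_sqdist (sampled_wiener n) (sampled_wiener k) w <=
   (2 * err n + 2 * err k)%:E)%E.
Proof.
have [_ <-] := step_isometry (sampled_wiener_rv4 n) (sampled_wiener_rv4 k).
rewrite EFinD !EFinM; apply: (sum_sq_integral (h := wiener_ito)) => //.
- exact: mstep (sampled_wiener_rv4 n).
- exact: mstep (sampled_wiener_rv4 k).
- exact: sampled_integral_L2.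
- exact: sampled_integral_L2.
Qed.

Definition path_sqdist (h : step_process R Omega) (w : Omega) : \bar R :=
  (\int[mu]_(s in `]0%R, 1%R]) ((step_eval h s w - W s w) ^+ 2)%R%:E)%E.

Let measurable_step_eval (h : step_process R Omega) w : measurable_fun setT (fun s => step_eval h s w).
Proof.
by apply: measurable_sum => i; apply: measurable_funM.
Qed.

Lemma path_sqdist_cvg h w :
  step_sqdist h (sampled_wiener k) w @[k --> \oo] --> path_sqdist h w.
Proof.
have C s : `|step_eval h s w| <= \sum_(i < step_size h) `|step_coef h i w|.
  rewrite (le_trans (ler_norm_sum _ _ _))// ler_sum// => i _.
  by rewrite normrM ler_piMr// indicE; case: (_ \in _); rewrite ?normr1 ?normr0.
exact: (sampled_sqdist_cvg (@cW w) (measurable_step_eval h w) C).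
Qed.

Let step_sqdist_ge0 g h w : (0 <= step_sqdist g h w)%E.
Proof. by apply: integral_ge0 => s _; rewrite lee_fin sqr_ge0. Qed.

Let path_sqdist_ge0 h w : (0 <= path_sqdist h w)%E.
Proof. by apply: integral_ge0 => s _; rewrite lee_fin sqr_ge0. Qed.

Let measurable_path_sqdist h : step_rv4 h -> measurable_fun setT (path_sqdist h).
Proof.
move=> hh; apply: (emeasurable_fun_cvg (fun k => step_sqdist h (sampled_wiener k))).
  by move=> k; have [] := step_isometry hh (sampled_wiener_rv4 k).
by move=> w _; exact: path_sqdist_cvg.
Qed.

(** Fatou's lemma in the mesh of the finer discretisation. *)
Lemma sampled_path_L2 n :
  (\int[P]_w path_sqdist (sampled_wiener n) w <= (4 * err n)%:E)%E.
Proof.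
pose f k w := step_sqdist (sampled_wiener n) (sampled_wiener (k + n)) w.
rewrite (eq_integral (fun w => limn_einf (f ^~ w))); last first.
  move=> w _; have c : f k w @[k --> \oo] --> path_sqdist (sampled_wiener n) w.
    have := @path_sqdist_cvg (sampled_wiener n) w.
    by rewrite -(cvg_shiftn n).
  by rewrite is_cvg_limn_einfE; [exact/esym/cvg_lim|exact: cvgP c].
apply: le_trans (fatou _ _ _ _) _ => //.
- by move=> k; have [] := step_isometry (sampled_wiener_rv4 n) (sampled_wiener_rv4 (k + n)).
- by move=> k w _; exact: step_sqdist_ge0.
rewrite limn_einf_lim; apply: lime_le; first exact: is_cvg_einfs.
apply: nearW => k; apply: (@le_trans _ _ (\int[P]_w f k w)%E).
  by apply: ereal_inf_lbound; exists k => //=.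
rewrite (le_trans (sampled_pair_L2 _ _))// lee_fin.
have : err (k + n) <= err n by rewrite /err lef_pV2 ?posrE// ler_nat ltnS leq_addl.
move: (err _) (err n) => x y; lra.
Qed.

Let step_path_L2 h n : step_rv4 h ->
  (\int[P]_w step_sqdist h (sampled_wiener n) w <=
   2%:E * \int[P]_w path_sqdist h w + 2%:E * (4 * err n)%:E)%E.
Proof.
move=> hh; have mh := measurable_path_sqdist hh.
have mg := measurable_path_sqdist (sampled_wiener_rv4 n).
apply: (@le_trans _ _ (\int[P]_w (2%:E * path_sqdist h w +
    2%:E * path_sqdist (sampled_wiener n) w))%E); last first.
  rewrite ge0_integralD//; last 4 first.
  - by move=> w _; rewrite mule_ge0.
  - exact: measurable_funeM.
  - by move=> w _; rewrite mule_ge0.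
  - exact: measurable_funeM.
  rewrite !ge0_integralZl// leeD2l// lee_wpmul2l//.
  exact: sampled_path_L2.
apply: ge0_le_integral => //.
- by have [] := step_isometry hh (sampled_wiener_rv4 n).
- by apply: emeasurable_funD; exact: measurable_funeM.
move=> w _; rewrite /step_sqdist /path_sqdist.
have mx : measurable_fun ([set` `]0%R, 1%R]] : set R) (W ^~ w).
  apply: measurable_funS (measurable_path (@cW w)) => //.
  by apply: subset_itvr; rewrite bnd_simp.
have m1 g : measurable_fun ([set` `]0%R, 1%R]] : set R)
    (fun s => ((step_eval g s w - W s w) ^+ 2)%:E).
  apply/measurable_EFinP; apply: measurable_funX; apply: measurable_funB => //.
  by apply: measurable_funTS; exact: measurable_step_eval.
rewrite -!ge0_integralZl//; try exact: m1;
  try by move=> s _; rewrite lee_fin sqr_ge0.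
rewrite -ge0_integralD//; last 4 first.
- by move=> s _; rewrite mule_ge0// lee_fin sqr_ge0.
- by apply: measurable_funeM; exact: m1.
- by move=> s _; rewrite mule_ge0// lee_fin sqr_ge0.
- by apply: measurable_funeM; exact: m1.
apply: ge0_le_integral => //.
- by move=> s _; rewrite lee_fin sqr_ge0.
- apply/measurable_EFinP; apply: measurable_funX; apply: measurable_funB;
    by apply: measurable_funTS; exact: measurable_step_eval.
- by apply: emeasurable_funD; apply: measurable_funeM; exact: m1.
- move=> s _; rewrite -!EFinM -EFinD lee_fin.
  move: (step_eval (sampled_wiener n) s w) (step_eval h s w) (W s w) => b a c.
  have := sqr_ge0 (a - c + (b - c)); nra.
Qed.

Let path_sqdistE h w : path_sqdist h w =
  (\int[mu]_(s in `[0%R, 1%R]) ((step_eval h s w - W s w) ^+ 2)%R%:E)%E.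
Proof.
rewrite /path_sqdist integral_itv_obnd_cbnd//.
have mx : measurable_fun ([set` `]0%R, 1%R]] : set R) (W ^~ w).
  apply: measurable_funS (measurable_path (@cW w)) => //.
  by apply: subset_itvr; rewrite bnd_simp.
apply/measurable_EFinP; apply: measurable_funX; apply: measurable_funB => //.
by apply: measurable_funTS; exact: measurable_step_eval.
Qed.

(** Any sequence of step processes approaching [W] in mean square has integrals close, by
    isometry, to those of the discretisations of [W], which are explicit. *)
Lemma ito_wienerE (I : Omega -> R) : is_ito_integral P W W I ->
  {ae P, forall w, I w = (W 1 w ^+ 2 - 1) / 2}.
Proof.
move=> [mI' [h [hadm hW hI]]].
have hrv m := step_admissible_rv4 (hadm m).
have key m n (x y : R) :
  (\int[P]_w \int[mu]_(s in `[0%R, 1%R]) ((step_eval (h m) s w - W s w) ^+ 2)%R%:E <= x%:E ->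
   \int[P]_w ((step_integral W (h m) w - I w) ^+ 2)%R%:E <= y%:E ->
   \int[P]_w ((I w - wiener_ito w) ^+ 2)%:E <= (2 * y + 2 * (2 * (2 * x + 8 * err n) + 2 * err n))%:E)%E.
  move=> hx hy.
  have e1 : (\int[P]_w ((step_integral W (sampled_wiener n) w - step_integral W (h m) w) ^+ 2)%:E
      <= (2 * x + 8 * err n)%:E)%E.
    under eq_integral do rewrite -[X in X ^+ 2]opprB sqrrN.
    have [_ ->] := step_isometry (hrv m) (sampled_wiener_rv4 n).
    rewrite (le_trans (step_path_L2 n (hrv m)))// [leRHS]EFinD !EFinM.
    have -> : (2%:E * (4%:E * (err n)%:E) = 8%:E * (err n)%:E :> \bar R)%E.
      by rewrite -!EFinM mulrA -natrM.
    apply: leeD; last exact: lexx.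
    apply: lee_wpmul2l; first by rewrite lee_fin.
    by under eq_integral do rewrite path_sqdistE.
  have e2 := sampled_integral_L2 n.
  have ms := mstep (hrv m); have mg := mstep (sampled_wiener_rv4 n).
  have e3 : (\int[P]_w ((wiener_ito w - step_integral W (h m) w) ^+ 2)%:E <=
      2%:E * (err n)%:E + 2%:E * (2 * x + 8 * err n)%:E)%E.
    apply: (sum_sq_integral (h := step_integral W (sampled_wiener n))) => //.
      by under eq_integral do rewrite -[X in X ^+ 2]opprB sqrrN.
    by under eq_integral do rewrite -[X in X ^+ 2]opprB sqrrN.
  apply: (@le_trans _ _ (2%:E * y%:E + 2%:E * (2%:E * (err n)%:E + 2%:E * (2 * x + 8 * err n)%:E))%E).
    apply: (sum_sq_integral (h := step_integral W (h m))) => //.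
    by under eq_integral do rewrite -[X in X ^+ 2]opprB sqrrN.
  rewrite -[leLHS]/((2 * y + 2 * (2 * err n + 2 * (2 * x + 8 * err n)))%:E) lee_fin.
  by move: (err n) => z; lra.
have z : (\int[P]_w ((I w - wiener_ito w) ^+ 2)%:E = 0)%E.
  apply/eqP; rewrite eq_le; apply/andP; split; last first.
    by apply: integral_ge0 => w _; rewrite lee_fin sqr_ge0.
  apply/lee_addgt0Pr => e e0; rewrite add0e.
  have e40 : 0 < e / 50 by rewrite divr_gt0.
  have small (u : nat -> \bar R) : u m @[m --> \oo] --> 0%E ->
      \forall m \near \oo, (u m <= (e / 50)%:E)%E.
    move=> u0; have /u0 : nbhs 0%E [set y : \bar R | (y < (e / 50)%:E)%E].
      by apply: open_nbhs_nbhs; split; [exact: open_ereal_lt_ereal|rewrite /= lte_fin].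
    by rewrite nbhs_simpl /=; apply: filterS => m /= /ltW.
  have [m [hx hy]] : exists m,
     (\int[P]_w \int[mu]_(s in `[0%R, 1%R]) ((step_eval (h m) s w - W s w) ^+ 2)%R%:E <= (e / 50)%:E)%E /\
     (\int[P]_w ((step_integral W (h m) w - I w) ^+ 2)%R%:E <= (e / 50)%:E)%E.
    have := filterI (small _ hW) (small _ hI).
    by case=> m _ /(_ m (leqnn m)) [h1 h2]; exists m.
  have [n en] : exists n, err n <= e / 50.
    have := near_infty_natSinv_lt (PosNum e40).
    by case=> n _ /(_ n (leqnn n)) /ltW h1; exists n.
  apply: (le_trans (key m n _ _ hx hy)); rewrite lee_fin.
  move: en; move: (err n) => x en; lra.
have m2 := msq (measurable_funB mI' mI).
have : (\int[P]_w `|((I w - wiener_ito w) ^+ 2)%:E| = 0)%E.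
  by under eq_integral do rewrite gee0_abs ?lee_fin ?sqr_ge0//.
move/(ae_eq_integral_abs P measurableT m2).
apply: filterS => w /(_ Logic.I) [/eqP]; rewrite sqrf_eq0 subr_eq0 => /eqP ->.
by [].
Qed.

End ito_integral_of_wiener.

(** * Jump times of a counting path *)

Section counting_path.
Context (R : realType).
Variables (T : R) (x : R -> nat).
Hypotheses (T_gt0 : 0 < T) (cx : counting_path T x).

Let x0 : x 0 = 0%N. Proof. by case: cx. Qed.
Let xmono s t : 0 <= s -> s <= t -> t <= T -> (x s <= x t)%N.
Proof. by case: cx => _ h _ _; exact: h. Qed.

Lemma left_limit_cst (a t : R) (k : nat) : a < t ->
  (forall s, a < s < t -> x s = k) -> left_limit x t = k%:R.
Proof.
move=> at_ xk; rewrite /left_limit; apply/cvg_lim => //.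
apply: cvg_near_cst; near=> s.
by rewrite xk//; apply/andP; split; near: s; [exact: nbhs_left_gt|exact: nbhs_left_lt].
Unshelve. all: by end_near. Qed.

Lemma left_limitE (t : R) : 0 < t <= T ->
  exists s k, [/\ 0 <= s, s < t, (forall r, s <= r < t -> x r = k) &
    left_limit x t = k%:R].
Proof.
move=> /andP[t0 tT].
have ex : exists j, `[< exists s, [/\ 0 <= s, s < t & x s = j] >].
  by exists (x 0); apply/asboolP; exists 0.
have bd j : `[< exists s, [/\ 0 <= s, s < t & x s = j] >] -> (j <= x t)%N.
  by move=> /asboolP[s [s0 st <-]]; apply: xmono => //; exact: ltW.
case: (ex_maxnP ex bd) => k /asboolP[s [s0 st sk]] kmax.
have xk r : s <= r < t -> x r = k.
  move=> /andP[sr rt]; apply/eqP; rewrite eqn_leq; apply/andP; split.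
    by apply: kmax; apply/asboolP; exists r; rewrite (le_trans s0).
  by rewrite -sk; apply: xmono => //; rewrite (le_trans (ltW rt)).
exists s, k; split => //; apply: (left_limit_cst st) => r /andP[sr rt].
by apply: xk; rewrite (ltW sr).
Qed.

Let right_cst t : 0 <= t -> t < T -> exists2 e, 0 < e & forall s, t <= s < t + e -> x s = x t.
Proof.
move=> t0 tT; have : ((x s)%:R : R) @[s --> t^'+] --> ((x t)%:R : R).
  by case: cx => _ _ h _; apply: h; rewrite t0.
move=> /cvgrPdist_lt/(_ _ ltr01).
rewrite near_withinE => /nbhs_ballP[e /= e0 eP].
exists e => // s /andP[]; rewrite le_eqVlt => /predU1P[->//|ts st].
have := eP s; rewrite /ball/= ltr0_norm ?subr_lt0// opprB ltrBlDl => /(_ st ts).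
rewrite -[(x t)%:R]/((x t)%:Z%:~R) -[(x s)%:R]/((x s)%:Z%:~R) -intrB.
rewrite -intr_norm -[1]/(1%:~R) ltr_int; lia.
Qed.

Let A k : set R := [set t | 0 <= t <= T /\ (k <= x t)%N].

(** The first time at which the path reaches level [k], for a level below [x T]. *)
Let tau0 k := inf (A k).

Let tau0_lb k : has_lbound (A k). Proof. by exists 0 => t [/andP[]]. Qed.

Let tau0P k t : (k <= x T)%N -> 0 <= t <= T -> (k <= x t)%N = (tau0 k <= t).
Proof.
move=> kT tT; apply/idP/idP => [kt|].
  by apply: (ge_inf (tau0_lb k)).
have Ane : A k !=set0 by exists T; split => //; rewrite lexx ltW.
rewrite le_eqVlt => /predU1P[tE|ltt]; last first.
  have [s [/andP[s0 sT] ks] st] := inf_lt Ane ltt.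
  by apply: (leq_trans ks); apply: xmono => //; [exact: ltW|case/andP: tT].
have [t0 tT'] := andP tT.
move: tT'; rewrite le_eqVlt => /predU1P[->//|{}tT'].
have [e e0 ex] := right_cst t0 tT'.
have tte : inf (A k) < t + e by rewrite -/(tau0 k) tE ltrDl.
have [s [/andP[s0 sT] ks] st] := inf_lt Ane tte.
have ts : t <= s by rewrite -tE; apply: (ge_inf (tau0_lb k)); rewrite /A /= s0 sT.
by rewrite -(ex s)// ts.
Qed.

Let tau0_itv k : (k <= x T)%N -> 0 <= tau0 k <= T.
Proof.
move=> kT; have AkT : A k T by split => //; rewrite lexx ltW.
apply/andP; split; last by apply: (ge_inf (tau0_lb k)).
by apply: lb_le_inf; [exists T|move=> t [/andP[]]].
Qed.

Let tau0x k : (k <= x T)%N -> (k <= x (tau0 k))%N.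
Proof. by move=> kT; rewrite tau0P// tau0_itv. Qed.

(** The jumps have size at most one, so two levels are not reached at the same time. *)
Let tau0_lt k : (k.+1 <= x T)%N -> tau0 k < tau0 k.+1.
Proof.
move=> kT; have kT' := ltnW kT.
have /andP[a0 aT] := tau0_itv kT'; have /andP[b0 bT] := tau0_itv kT.
have le : tau0 k <= tau0 k.+1.
  by rewrite -tau0P ?b0//; exact: leq_trans (leqnSn k) (tau0x kT).
rewrite lt_neqAle le andbT; apply/eqP => E.
have t0 : 0 < tau0 k.+1.
  rewrite lt_neqAle b0 andbT; apply/eqP => z.
  by have := tau0x kT; rewrite -z x0.
have jump : (x (tau0 k.+1))%:R - left_limit x (tau0 k.+1) <= 1.
  by case: cx => _ _ _; apply; rewrite t0.
(* the path stays below k before tau0 k *)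
have below s : 0 <= s -> s < tau0 k.+1 -> (x s < k)%N.
  move=> s0 st; rewrite ltnNge; apply/negP => kx.
  have sT : 0 <= s <= T by rewrite s0 (le_trans (ltW st)).
  by move: kx; rewrite tau0P// E leNgt st.
have tT : 0 < tau0 k.+1 <= T by rewrite t0.
have [s [k' [s0 st xk' lE]]] := left_limitE tT.
have k'k : (k' < k)%N by rewrite -(xk' s) ?lexx ?st// below.
have := tau0x kT; move: jump; rewrite lE lerBlDr => jump kx.
have : ((x (tau0 k.+1))%:R : R) <= k'.+1%:R by rewrite -natr1 addrC.
rewrite ler_nat => h; have := leq_trans kx h; rewrite ltnS => h2.
by have := leq_ltn_trans h2 k'k; rewrite ltnn.
Qed.

(** With the conventions [0] below and [T] above, the path is constant between
    consecutive values. *)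
Definition jump_time (k : nat) : R :=
  if k == 0%N then 0 else if (k <= x T)%N then tau0 k else T.

Let n := x T.

Lemma jump_time0 : jump_time 0 = 0. Proof. by []. Qed.

Lemma jump_time_last : jump_time n.+1 = T.
Proof. by rewrite /jump_time /= ltnn. Qed.

Lemma jump_time_itv k : 0 <= jump_time k <= T.
Proof.
rewrite /jump_time; case: eqP => [_|_]; first by rewrite lexx ltW.
by case: ifPn => [/tau0_itv//|_]; rewrite lexx ltW.
Qed.

Lemma jump_timeP k t : (k <= n)%N -> 0 <= t <= T -> (k <= x t)%N = (jump_time k <= t).
Proof.
move=> kn tT; rewrite /jump_time kn; case: eqP => [->|_]; last exact: tau0P.
by case/andP: tT => ->.
Qed.

Lemma jump_time_gt0 k : (0 < k)%N -> 0 < jump_time k.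
Proof.
move=> k0; have /andP[t0 tT] := jump_time_itv k.
rewrite lt_neqAle t0 andbT; apply/eqP => z.
have [kn|nk] := leqP k n; last first.
  by move: z; rewrite /jump_time gtn_eqF// leqNgt nk/= => z; have := T_gt0; rewrite -z ltxx.
by have := jump_timeP kn (_ : 0 <= 0 <= T); rewrite -z lexx x0 leqNgt k0 ltW// => /(_ isT).
Qed.

Lemma jump_time_lt k : (k < n)%N -> jump_time k < jump_time k.+1.
Proof.
move=> kn; case: k kn => [|k] kn; first exact: jump_time_gt0.
by rewrite /jump_time /= kn (ltnW kn); exact: tau0_lt.
Qed.

Lemma jump_time_le k : (k <= n)%N -> jump_time k <= jump_time k.+1.
Proof.
rewrite leq_eqVlt => /predU1P[->|/jump_time_lt/ltW//].
by rewrite jump_time_last; case/andP: (jump_time_itv n).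
Qed.

Lemma path_between k t : (k <= n)%N -> jump_time k <= t < jump_time k.+1 -> x t = k.
Proof.
move=> kn /andP[kt tk].
have tT : 0 <= t <= T.
  have /andP[a _] := jump_time_itv k; have /andP[_ b] := jump_time_itv k.+1.
  by rewrite (le_trans a kt) (le_trans (ltW tk) b).
apply/eqP; rewrite eqn_leq jump_timeP// kt andbT.
move: kn; rewrite leq_eqVlt => /predU1P[->|kn]; first by apply: xmono; case/andP: tT.
by rewrite -ltnS ltnNge jump_timeP// -ltNge.
Qed.

Lemma path_jump k : (k <= n)%N -> x (jump_time k) = k.
Proof.
rewrite leq_eqVlt => /predU1P[->|kn].
  have h := jump_time_itv n; apply/eqP; rewrite eqn_leq jump_timeP// lexx andbT.
  by apply: xmono; case/andP: h.
by apply: path_between; [exact: ltnW|rewrite lexx jump_time_lt].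
Qed.

Lemma left_limit_between k t : (k <= n)%N -> jump_time k < t <= jump_time k.+1 ->
  left_limit x t = k%:R.
Proof.
move=> kn /andP[kt tk]; apply: (left_limit_cst kt) => s /andP[ks st].
by apply: path_between => //; rewrite (ltW ks) (lt_le_trans st).
Qed.

Lemma jump_time_cell t : 0 < t <= T ->
  exists2 k, (k <= n)%N & jump_time k < t <= jump_time k.+1.
Proof.
move=> /andP[t0 tT].
have ex : exists k, t <= jump_time k.+1 by exists n; rewrite jump_time_last.
case: (ex_minnP ex) => k tk kmin; have kn : (k <= n)%N.
  by apply: kmin; rewrite jump_time_last.
exists k => //; rewrite tk andbT; case: k tk kmin kn => [//|k] tk kmin kn.
by rewrite ltNge; apply/negP => /kmin; rewrite ltnn.
Qed.

(** Only the jump times contribute, each with a jump of size one. *)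
Lemma int_dXE h : int_dX T x h = \sum_(k < n) h (jump_time k.+1).
Proof.
have jinj : set_inj `I_n (fun k => jump_time k.+1).
  move=> i j; rewrite !inE /= => ni nj ij; apply: succn_inj.
  by rewrite -(path_jump ni) -(path_jump nj) ij.
rewrite (@fsbig_ord _ _ _ n (fun k => h (jump_time k.+1))).
rewrite (eq_fsbigr (fun k => h (jump_time k.+1) *
    ((x (jump_time k.+1))%:R - left_limit x (jump_time k.+1)))); last first.
  move=> k; rewrite inE /= => kn.
  rewrite path_jump// (@left_limit_between k) ?(ltnW kn) ?jump_time_lt ?lexx//.
  by rewrite -natr1 addrAC subrr add0r mulr1.
rewrite -(@fsbig_image _ _ _ _ _ `I_n (fun k => jump_time k.+1)
  (fun t => h t * ((x t)%:R - left_limit x t)) jinj).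
apply/esym/fsbig_widen.
  move=> _ [k /= kn <-]; rewrite in_itv/= jump_time_gt0//.
  by case/andP: (jump_time_itv k.+1).
move=> t [/=]; rewrite in_itv/= => /jump_time_cell [k kn kt] nimg.
rewrite (left_limit_between kn kt); case/andP: kt => kt.
rewrite le_eqVlt => /predU1P[tE|tk]; last first.
  by rewrite (path_between kn) ?subrr ?mulr0// (ltW kt).
move: kn; rewrite leq_eqVlt => /predU1P[kE|kn]; last by case: nimg; exists k.
by rewrite tE kE jump_time_last subrr mulr0.
Qed.

End counting_path.

(** * Integrals along a counting path *)

Section grid_cells.
Context (R : realType).
Notation mu := (@lebesgue_measure R).

Lemma Rintegral_cells (F : R -> R) (p : nat -> R) m :
  (forall i, (i < m)%N -> p i <= p i.+1) ->
  mu.-integrable [set` `]p 0, p m]%R] (EFin \o F) ->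
  \int[mu]_(t in `]p 0, p m]) F t = \sum_(k < m) \int[mu]_(t in `]p k, p k.+1]) F t.
Proof.
elim: m => [_ _|m IH pm iF]; first by rewrite big_ord0 set_itvoc0 Rintegral_set0.
have p0m j : (j <= m.+1)%N -> p 0 <= p j.
  by elim: j => [//|j IHj jm]; apply: le_trans (IHj (ltnW jm)) (pm _ _).
rewrite big_ord_recr/= -IH//; last first.
- by apply: integrableS iF => //; apply: subset_itvl; rewrite bnd_simp pm.
- by move=> i im; apply: pm; exact: leqW.
rewrite -(@Rintegral_itvB _ F (BRight (p 0)) (BRight (p m.+1)) (p m)).
- by rewrite addrC subrK.
- exact: iF.
- by rewrite bnd_simp p0m.
- by rewrite bnd_simp pm.
Qed.

End grid_cells.

Section path_integral.
Context (R : realType).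
Variables (T S : R) (x : R -> nat).
Hypotheses (T_gt0 : 0 < T) (S_gt0 : 0 < S) (cx : counting_path T x).
Notation mu := (@lebesgue_measure R).
Notation "'`]' a , b ']R'" := ([set` `]a, b]%R] : set R) (only parsing).
Let n := x T.
Let jt := jump_time T x.

Lemma jump_time_mono i j : (i <= j)%N -> (j <= n.+1)%N -> jt i <= jt j.
Proof.
elim: j => [|j IH]; first by rewrite leqn0 => /eqP->.
rewrite leq_eqVlt => /predU1P[->//|ij jn].
apply: le_trans (jump_time_le T_gt0 cx _); last by rewrite -ltnS.
by apply: IH => //; exact: ltnW.
Qed.

(** As a finite sum of indicators, the left limit is seen to be measurable. *)
Lemma left_limit_sum t : 0 < t <= T ->
  left_limit x t = \sum_(k < n) \1_([set s | jt k.+1 < s]) t.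
Proof.
move=> tT; have [k0 k0n /andP[kt tk]] := jump_time_cell x tT.
rewrite (left_limit_between T_gt0 cx k0n) ?kt//.
rewrite (eq_bigr (fun k : 'I_n => ((k < k0)%N)%:R)); last first.
  move=> k _; rewrite indicE; congr (nat_of_bool _)%:R.
  apply/idP/idP; rewrite inE/=.
    move=> jk; rewrite ltnNge; apply/negP => k0k.
    have := jump_time_mono (_ : (k0.+1 <= k.+1)%N) (_ : (k.+1 <= n.+1)%N).
    rewrite ltnS => /(_ k0k (ltnW (ltn_ord k))) h.
    by have := lt_le_trans jk (le_trans tk h); rewrite ltxx.
  by move=> kk0; apply: le_lt_trans kt; apply: jump_time_mono => //; exact: leqW.
rewrite -natr_sum -big_mkcond/= -(big_ord_widen n (fun=> 1%N))//.
by rewrite sum1_card card_ord.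
Qed.

Lemma path_sum t : 0 <= t <= T ->
  (x t)%:R = \sum_(k < n) \1_([set s | jt k.+1 <= s]) t :> R.
Proof.
move=> tT; have xtn : (x t <= n)%N.
  by case: cx => _ h _ _; apply: h; case/andP: tT.
rewrite (eq_bigr (fun k : 'I_n => ((k < x t)%N)%:R)); last first.
  move=> k _; rewrite indicE; congr (nat_of_bool _)%:R.
  by rewrite (jump_timeP T_gt0 cx)//; apply/idP/idP; rewrite inE.
rewrite -natr_sum -big_mkcond/= -(big_ord_widen n (fun=> 1%N))//.
by rewrite sum1_card card_ord.
Qed.

Lemma measurable_left_limit : measurable_fun `]0, T ]R (left_limit x).
Proof.
apply: (eq_measurable_fun (fun t : R => \sum_(k < n) \1_([set s | jt k.+1 < s]) t : R)).
  by move=> t; rewrite inE /= in_itv/= => tT; rewrite left_limit_sum.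
apply: measurable_funTS; apply: measurable_sum => k; apply: measurable_indic.
rewrite (_ : [set s | _] = [set` `]jt k.+1, +oo[%R]) //.
by apply/seteqP; split=> s /=; rewrite in_itv/= andbT.
Qed.

Lemma left_limit_bounds t : 0 < t <= T -> 0 <= left_limit x t <= n%:R.
Proof.
move=> tT; have [k kn kt] := jump_time_cell x tT.
by rewrite (left_limit_between T_gt0 cx kn kt) ler0n ler_nat.
Qed.

Lemma bounded_integrable_itv (F : R -> R) B : measurable_fun `]0, T ]R F ->
  (forall t, 0 < t <= T -> `|F t| <= B) ->
  mu.-integrable [set` `]0, T]%R] (EFin \o F).
Proof.
move=> mF FB; apply: measurable_bounded_integrable => //.
  rewrite -[X in (X < _)%E]/(@lebesgue_measure R [set` `]0, T]%R]).
  by rewrite lebesgue_measure_itv/= lte_fin T_gt0 -EFinB ltry.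
exists B; split; first exact: num_real.
move=> y By t /=; rewrite in_itv/= => tT; exact: le_trans (FB _ tT) (ltW By).
Qed.

Lemma integrable_along (y g : R -> R) : continuous g -> measurable_fun `]0, T ]R y ->
  (forall t, 0 < t <= T -> 0 <= y t <= n%:R) ->
  mu.-integrable [set` `]0, T]%R] (EFin \o (fun t => g (y t - S * t))).
Proof.
move=> cg my yb.
have [B gB] : exists B, forall z, - (S * T) <= z <= n%:R -> `|g z| <= B.
  have le : - (S * T) <= n%:R.
    by rewrite (@le_trans _ _ 0)// oppr_le0 mulr_ge0// ltW.
  have cg' : {within `[- (S * T), n%:R], continuous g} by exact: continuous_subspaceT.
  have [c _ cmax] := EVT_max le cg'; have [e _ emin] := EVT_min le cg'.
  exists (`|g c| + `|g e|) => z zb.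
  have := cmax z; have := emin z; rewrite in_itv/= => /(_ zb) h1 /(_ zb) h2.
  have := ler_norm (g c); have := ler_norm (- g e); rewrite normrN.
  have := normr_ge0 (g e); have := normr_ge0 (g c).
  by move=> *; rewrite ler_norml; apply/andP; split; lra.
apply: (@bounded_integrable_itv _ B).
  apply: (measurableT_comp (f := g)); first exact: continuous_measurable_fun.
  by apply: measurable_funB => //; exact: measurable_funM.
move=> t tT; rewrite gB//.
have /andP[l0 ln] := yb t tT; case/andP: tT => t0 tT.
have h1 : 0 <= S * t by rewrite mulr_ge0// ltW.
have h2 : S * t <= S * T by rewrite ler_pM2l.
by apply/andP; split; lra.
Qed.

Lemma measurable_counting : measurable_fun `]0, T ]R (fun t => (x t)%:R : R).
Proof.
apply: (eq_measurable_fun (fun t : R => \sum_(k < n) \1_([set s | jt k.+1 <= s]) t : R)).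
  by move=> t; rewrite inE /= in_itv/= => /andP[t0 tT]; rewrite path_sum// ltW.
apply: measurable_funTS; apply: measurable_sum => k; apply: measurable_indic.
rewrite (_ : [set s | _] = [set` `[jt k.+1, +oo[%R]) //.
by apply/seteqP; split=> s /=; rewrite in_itv/= andbT.
Qed.

Lemma counting_bounds t : 0 <= t <= T -> 0 <= ((x t)%:R : R) <= n%:R.
Proof.
by case/andP=> t0 tT; rewrite ler0n ler_nat; case: cx => _ h _ _; exact: h.
Qed.

Section primitive.
Variables g G : R -> R.
Hypotheses (cg : continuous g) (dG : forall y : R, is_derive y 1 G (g y)).

Let cell_integral k : (k <= n)%N ->
  \int[mu]_(t in `]jt k, jt k.+1]) (g (left_limit x t - S * t) * S) =
  G (k%:R - S * jt k) - G (k%:R - S * jt k.+1).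
Proof.
move=> kn; have jj : jt k <= jt k.+1 by apply: jump_time_mono.
pose f t := - G (k%:R - S * t).
have df (t : R) : is_derive t 1 f (g (k%:R - S * t) * S).
  apply: is_derive_eq (derN (der_comp (g := fun y => k%:R - S * y) (dG _)
    (derD (der_cst _ t) (derN (derZ S (der_id t)))))) _.
  by rewrite /=; ring.
have cf : continuous (fun t => g (k%:R - S * t) * S).
  move=> t; apply: cvgM; last exact: cvg_cst.
  apply: (@continuous_comp _ _ _ (fun t => k%:R - S * t) g); last exact: cg.
  by apply: cvgB; [exact: cvg_cst|apply: cvgM; [exact: cvg_cst|exact: cvg_id]].
have := der_FTC jj df cf; rewrite /f opprK addrC => <-.
rewrite -Rintegral_itv_obnd_cbnd.
  apply: eq_Rintegral => t; rewrite inE/= in_itv/= => tk.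
  by rewrite (left_limit_between T_gt0 cx kn tk).
apply: (@integrableS _ _ _ mu [set` `[jt k, jt k.+1]%R]) => //.
  by apply: subset_itvr; rewrite bnd_simp.
apply: continuous_compact_integrable; first exact: segment_compact.
exact: continuous_subspaceT.
Qed.

Let integrable_left :
  mu.-integrable [set` `]0, T]%R] (EFin \o (fun t => g (left_limit x t - S * t) * S)).
Proof.
apply: (@integrable_along _ (fun y => g y * S)).
- by move=> y; apply: cvgM; [exact: cg|exact: cvg_cst].
- exact: measurable_left_limit.
- exact: left_limit_bounds.
Qed.

(** Change of variables along the compensated path [M t = x t - S t]: between
    the jumps [M] decreases at speed [S], and each jump adds one.  The values of
    [h] outside of [(0, T]] do not matter. *)
Lemma int_dM_primitive (h : R -> R) :
  (forall t, 0 < t <= T -> h t = g (left_limit x t - S * t)) ->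
  int_dM S T x h = G (n%:R - S * T) - G 0 -
    \sum_(k < n) (G (k%:R - S * jt k.+1 + 1) - G (k%:R - S * jt k.+1)
                  - g (k%:R - S * jt k.+1)).
Proof.
move=> hE; rewrite /int_dM (int_dXE T_gt0 cx) -/n.
have ih : mu.-integrable [set` `]0, T]%R] (EFin \o (fun t => h t * S)).
  apply: eq_integrable integrable_left => // t; rewrite inE/= in_itv/= => tT.
  by rewrite hE.
rewrite -Rintegral_itv_obnd_cbnd//.
rewrite -{2}(jump_time_last T x) -/n -/jt -{1}(jump_time0 T x) -/jt Rintegral_cells; last first.
- by rewrite /jt jump_time_last.
- by move=> i ni; apply: jump_time_mono.
rewrite (eq_bigr (fun k : 'I_n.+1 =>
    G (k%:R - S * jt k) - G (k%:R - S * jt k.+1))); last first.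
  move=> k _; rewrite -cell_integral; last by rewrite -ltnS.
  apply: eq_Rintegral => t; rewrite inE/= in_itv/= => /andP[t1 t2]; rewrite hE//.
  have /andP[a _] := jump_time_itv x T_gt0 k.
  have /andP[_ b] := jump_time_itv x T_gt0 k.+1.
  by rewrite (le_lt_trans a t1) (le_trans t2 b).
rewrite (eq_bigr (fun k : 'I_n => g (k%:R - S * jt k.+1))); last first.
  move=> k _; rewrite hE.
    have kn := ltn_ord k; rewrite (left_limit_between T_gt0 cx (ltnW kn))// lexx andbT.
    exact: (jump_time_lt T_gt0 cx kn).
  rewrite (jump_time_gt0 T_gt0 cx)//=.
  by have /andP[_ b] := jump_time_itv x T_gt0 k.+1.
rewrite sumrB [X in _ - (X - _)]big_ord_recl [X in _ - (_ - X)]big_ord_recr/=.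
rewrite !sumrB /jt /n jump_time0 jump_time_last -/n !mulr0 subr0.
under [X in _ - (_ + X - _)]eq_bigr => i _ do rewrite /bump/= add1n -natr1 addrAC.
by rewrite -/n; ring.
Qed.

End primitive.

End path_integral.

(** * Primitives, and the regularity of the logarithm of psi *)

Section modulus.
Context (R : realType).

(** Integrating the difference with the constant value taken below [a] gives a
    primitive on the whole line, including at [a]. *)
Lemma continuous_primitive (g : R -> R) (a : R) : continuous g ->
  (forall y, y <= a -> g y = g a) ->
  exists G : R -> R, forall y : R, is_derive y 1 G (g y).
Proof.
move=> cg ga; pose f y := g y - g a.
have cf : continuous f by move=> y; apply: cvgB; [exact: cg|exact: cvg_cst].
pose F y := \int[lebesgue_measure]_(t in [set` Interval -oo%O (BRight y)]) f t.
exists (fun y => F y + g a * y) => y.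
have iF : lebesgue_measure.-integrable [set` Interval -oo%O (BRight (y + 1))] (EFin \o f).
  have i1 : lebesgue_measure.-integrable `[a, y + 1] (EFin \o f).
    apply: continuous_compact_integrable; first exact: segment_compact.
    exact: continuous_subspaceT.
  have mI : measurable ([set` `[a, y + 1]%R] : set R) by [].
  have mJ : measurable ([set` Interval -oo%O (BRight (y + 1))] : set R) by [].
  have -> : EFin \o f = (EFin \o f) \_ [set` `[a, y + 1]%R] \+
     (EFin \o f) \_ [set` `]y + 1, +oo[%R].
    apply/funext => t; rewrite /= /patch; case: ifPn; case: ifPn.
    - by rewrite !inE/= !in_itv/= andbT => h1 /andP[_ h2]; move: (lt_le_trans h1 h2); rewrite ltxx.
    - by rewrite adde0.
    - by rewrite add0e.
    - rewrite adde0 !notin_setE/= !in_itv/= andbT => /negP; rewrite -leNgt => h1 /negP.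
      by rewrite h1 andbT -ltNge => /ltW h2; rewrite /f ga// subrr.
  apply: integrableD => //.
    apply/integrable_restrict => //; apply: integrableS i1 => //; first exact: measurableI.
  apply/integrable_restrict => //; rewrite (_ : _ `&` _ = set0); first exact: integrable_set0.
  by apply/seteqP; split => t //= []; rewrite !in_itv/= andbT => h1 h2; move: (le_lt_trans h1 h2); rewrite ltxx.
have yy : y < y + 1 by rewrite ltrDl.
have [dF F'] := @continuous_FTC1 _ f -oo%O y (y + 1) yy iF (ltNyr _ : (-oo%O < BRight y)%E) (cf y).
have FD : is_derive y 1 F (f y) by split => //; rewrite -F' derive1E.
apply: is_derive_eq (derD FD (derZ (g a) (der_id y))) _.
by rewrite /f mulr1 subrK.
Qed.

Lemma expR_rem3 (y : R) : `|expR y - 1 - y - y ^+ 2 / 2| <= `|y| ^+ 3 * expR `|y|.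
Proof.
pose f z : R := expR z - 1 - z - z ^+ 2 / 2.
have df (z : R) : is_derive z 1 f (expR z - 1 - z).
  apply: is_derive_eq (derD (derD (derD (is_derive_expR z) (derN (der_cst 1 z)))
    (derN (der_id z))) (derN (derM (derM (der_id z) (der_id z)) (der_cst 2^-1 z)))) _.
  by rewrite /=; field.
have := @der_mvt _ f _ 0 y (y ^+ 2 * expR `|y|) df.
rewrite /f expR0 subrr subr0 expr0n/= mul0r !subr0 => h.
have -> : `|y| ^+ 3 = y ^+ 2 * `|y| by rewrite exprSr real_normK ?num_real.
rewrite [leRHS]mulrAC; apply: h => z zb.
have zy : `|z| <= `|y|.
  exact: between0_normr.
apply: (le_trans (expR_rem2 z)); apply: ler_pM => //; rewrite ?sqr_ge0 ?expR_ge0 ?ler_expR//.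
by rewrite -real_normK ?num_real// -[leRHS]real_normK ?num_real// lerXn2r ?nnegrE.
Qed.

Section psi.
Variable psi : R -> R.
Hypotheses (psi_gt0 : forall y, 0 < psi y) (psi_C1 : continuously_differentiable_at psi 0)
  (psi0 : psi 0 = 1) (dpsi0 : 0 < (psi^`())%classic 0).
Let c := (psi^`())%classic 0.

Let log_derivative (e : R) : 0 < e -> exists2 dl : R, 0 < dl &
  forall y : R, `|y| <= dl -> is_derive y 1 psi ((psi^`())%classic y) /\
    `|(psi^`())%classic y / psi y - c| <= e.
Proof.
move=> e0; have [der cd] := psi_C1.
have der0 : derivable psi 0 1 := nbhs_singleton der.
have cpsi : {for 0, continuous psi}.
  by apply/differentiable_continuous/derivable1_diffP.
have cq : (psi^`())%classic y / psi y @[y --> (0 : R)] --> c.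
  rewrite -[c]divr1 -psi0; apply: cvgM => //.
  by apply: cvgV => //; rewrite psi0 oner_neq0.
have : \forall y \near (0 : R), derivable psi y 1 /\ `|(psi^`())%classic y / psi y - c| <= e.
  apply: filterI => //; move/cvgrPdist_le : cq => /(_ _ e0); apply: filterS => y.
  by rewrite distrC.
move=> /nbhs_ballP[dl /= dl0 h]; exists (dl / 2); first by rewrite divr_gt0.
move=> y ydl; have [|d1 d2] := h y; last first.
  by split => //; rewrite derive1E; exact: derivableP.
by rewrite /ball/= sub0r normrN (le_lt_trans ydl)// ltr_pdivrMr// ltr_pMr// ltr1n.
Qed.

(** The derivative of [ln psi(y) - c y] is continuous at [0], where it vanishes. *)
Lemma ln_psi_modulus (e : R) : 0 < e -> exists2 dl : R, 0 < dl &
  forall y z, `|y| <= dl -> `|z| <= dl ->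
    `|(ln (psi y) - c * y) - (ln (psi z) - c * z)| <= e * `|y - z|.
Proof.
move=> e0; have [dl dl0 h] := log_derivative e0; exists dl => //.
pose f y := ln (psi y) - c * y.
have df (y : R) : `|y| <= dl -> is_derive y 1 f ((psi^`())%classic y / psi y - c).
  move=> ydl; have [d1 _] := h _ ydl.
  apply: is_derive_eq (derD (der_comp (is_derive1_ln (psi_gt0 y)) d1)
    (derN (derZ c (der_id y)))) _.
  by rewrite mulr1 mulrC.
move=> y z; wlog zy : y z / z <= y.
  move=> wl ydl zdl; have [/wl|/ltW/wl] := leP z y; first exact.
  by rewrite distrC [`|y - z|]distrC; apply.
move=> ydl zdl.
have itv t : z <= t <= y -> `|t| <= dl.
  by move: ydl zdl; rewrite !ler_norml => /andP[_ h1] /andP[h2 _] /andP[h3 h4]; apply/andP; split; lra.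
have dt (t : R) : t \in `]z, y[ -> is_derive t 1 f ((psi^`())%classic t / psi t - c).
  by rewrite in_itv/= => /andP[h1 h2]; apply/df/itv; rewrite !ltW.
have ct : {within `[z, y], continuous f}.
  apply: derivable_within_continuous => t; rewrite in_itv/= => /itv/df h1.
  exact: ex_derive.
have [t tzy E] := MVT_segment zy dt ct.
rewrite -/(f y) -/(f z) E normrM ler_wpM2r//.
by move: tzy; rewrite in_itv/= => /itv/h[].
Qed.

(** With [l = ln (psi y)], the remainder is [exp l - 1 - l] minus half the square of
    [c y]: expand the exponential to second order, and use that [l - c y] is small
    compared with [y]. *)
Lemma psi_modulus (e : R) : 0 < e -> exists dl : R, [/\ 0 < dl,
  (forall y z, `|y| <= dl -> `|z| <= dl ->
    `|(ln (psi y) - c * y) - (ln (psi z) - c * z)| <= e * `|y - z|) &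
  (forall y, `|y| <= dl ->
    `|psi y - 1 - ln (psi y) - (c * y) ^+ 2 / 2| <= e * y ^+ 2)].
Proof.
move=> e0; pose A := c + 1; have A0 : 0 < A by rewrite addr_gt0.
pose e1 := Num.min 1 (e / (2 * A)).
have e10 : 0 < e1 by rewrite lt_min ltr01 divr_gt0// mulr_gt0.
have e11 : e1 <= 1 by rewrite ge_min lexx.
have e1e : e1 * (2 * A) <= e by rewrite -ler_pdivlMr ?mulr_gt0// ge_min lexx orbT.
have [d1 d10 h1] := ln_psi_modulus e10.
pose M := A ^+ 3 * expR A; have M0 : 0 < M by rewrite mulr_gt0 ?exprn_gt0 ?expR_gt0.
pose dl := Num.min d1 (Num.min 1 (e / (2 * M))).
have dl1 : dl <= 1 by rewrite !ge_min lexx orbT.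
have dld : dl <= d1 by rewrite ge_min lexx.
have M20 : 0 < 2 * M by rewrite mulr_gt0.
have dle : dl * (2 * M) <= e by rewrite -ler_pdivlMr// /dl !ge_min lexx !orbT.
have e1le : e1 <= e.
  have A1 : 1 <= 2 * A by rewrite /A; have := dpsi0; rewrite -/c => *; lra.
  by apply: le_trans e1e; rewrite ler_peMr// ltW.
exists dl; split.
- by rewrite !lt_min d10 ltr01/= divr_gt0// mulr_gt0.
- move=> y z yd zd; apply: (le_trans (h1 _ _ (le_trans yd dld) (le_trans zd dld))).
  by rewrite ler_wpM2r.
- move=> y yd; have := h1 y 0 (le_trans yd dld).
  rewrite normr0 psi0 ln1 mulr0 !subr0 => /(_ (ltW d10)) h2.
  have E : psi y = expR (ln (psi y)) by rewrite lnK// posrE.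
  rewrite {1}E; move: (ln (psi y)) h2 => l h2.
  have lA : `|l| <= A * `|y|.
    have -> : l = (l - c * y) + c * y by rewrite subrK.
    rewrite (le_trans (ler_normD _ _))// normrM (gtr0_norm dpsi0) mulrDl mul1r addrC lerD2l.
    by apply: (le_trans h2); rewrite ler_piMl.
  have h3 : `|expR l - 1 - l - l ^+ 2 / 2| <= (e / 2) * y ^+ 2.
    apply: (le_trans (expR_rem3 l)).
    have y1 := le_trans yd dl1.
    apply: (@le_trans _ _ ((A * `|y|) ^+ 3 * expR A)).
      apply: ler_pM; rewrite ?exprn_ge0 ?expR_ge0//.
        by rewrite lerXn2r ?nnegrE// mulr_ge0// ltW.
      by rewrite ler_expR (le_trans lA)// ler_piMr// ltW.
    rewrite -[y ^+ 2]real_normK ?num_real//.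
    have -> : (A * `|y|) ^+ 3 * expR A = `|y| * M * `|y| ^+ 2 by rewrite /M; ring.
    rewrite ler_wpM2r// ler_pdivlMr// -mulrA [M * 2]mulrC.
    by apply: le_trans dle; rewrite ler_wpM2r// mulr_ge0// ltW.
  have h4 : `|l ^+ 2 / 2 - (c * y) ^+ 2 / 2| <= (e / 2) * y ^+ 2.
    have -> : l ^+ 2 / 2 - (c * y) ^+ 2 / 2 = (l - c * y) * (l + c * y) / 2 by field.
    rewrite !normrM [`|2^-1|]gtr0_norm// -[y ^+ 2]real_normK ?num_real//.
    have h5 : `|l + c * y| <= 2 * A * `|y|.
      apply: (le_trans (ler_normD _ _)); rewrite normrM (gtr0_norm dpsi0) -/c.
      apply: (@le_trans _ _ (A * `|y| + A * `|y|)); last by rewrite -mulrDl; lra.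
      by rewrite lerD// ler_wpM2r// lerDl.
    rewrite ler_pdivrMr// (_ : e / 2 * `|y| ^+ 2 * 2 = e * `|y| ^+ 2); last by field.
    apply: (@le_trans _ _ ((e1 * `|y|) * (2 * A * `|y|))); first exact: ler_pM.
    rewrite (_ : _ * _ = e1 * (2 * A) * `|y| ^+ 2); last by ring.
    by rewrite ler_wpM2r.
  rewrite (_ : _ - _ = (expR l - 1 - l - l ^+ 2 / 2) + (l ^+ 2 / 2 - (c * y) ^+ 2 / 2)); last by ring.
  rewrite (le_trans (ler_normD _ _))// (_ : e * y ^+ 2 = e / 2 * y ^+ 2 + e / 2 * y ^+ 2).
    exact: lerD.
  by field.
Qed.

End psi.

End modulus.

(** * Pathwise expansion of the likelihood ratio *)

Section pathwise.
Context (R : realType).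
Variables (T S : R) (x : R -> nat).
Hypotheses (T_gt0 : 0 < T) (S_gt0 : 0 < S) (cx : counting_path T x).
Notation mu := (@lebesgue_measure R).
Let n := x T.
Let mT := n%:R - S * T.

Let pair_integrable (g1 g2 : R -> R) : continuous g1 -> continuous g2 ->
  continuous (fun y => g1 y - g2 y).
Proof. by move=> c1 c2 y; apply: cvgB; [exact: c1|exact: c2]. Qed.

Let integrable_left (g h : R -> R) : continuous g ->
  (forall t, 0 < t <= T -> h t = g (left_limit x t - S * t)) ->
  mu.-integrable [set` `]0, T]%R] (EFin \o (fun t => h t * S)).
Proof.
move=> cg hE.
have : mu.-integrable [set` `]0, T]%R] (EFin \o (fun t => g (left_limit x t - S * t) * S)).
  apply: (@integrable_along _ T S x T_gt0 S_gt0 (left_limit x) (fun y => g y * S)).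
  - by move=> y; apply: cvgM; [exact: cg|exact: cvg_cst].
  - exact: measurable_left_limit.
  - exact: left_limit_bounds.
by apply: eq_integrable => // t; rewrite inE/= in_itv/= => tT; rewrite hE.
Qed.

Lemma int_dMB (g1 g2 h1 h2 : R -> R) : continuous g1 -> continuous g2 ->
  (forall t, 0 < t <= T -> h1 t = g1 (left_limit x t - S * t)) ->
  (forall t, 0 < t <= T -> h2 t = g2 (left_limit x t - S * t)) ->
  int_dM S T x h1 - int_dM S T x h2 = int_dM S T x (fun t => h1 t - h2 t).
Proof.
move=> c1 c2 E1 E2.
have i1 := integrable_left c1 E1; have i2 := integrable_left c2 E2.
have i3 : mu.-integrable [set` `]0, T]%R] (EFin \o (fun t => (h1 t - h2 t) * S)).
  apply: (integrable_left (pair_integrable c1 c2)) => t tT.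
  by rewrite E1// E2.
rewrite /int_dM -!Rintegral_itv_obnd_cbnd// !(int_dXE T_gt0 cx) sumrB.
have -> : \int[mu]_(t in `]0, T]) ((h1 t - h2 t) * S) =
   \int[mu]_(t in `]0, T]) (h1 t * S) - \int[mu]_(t in `]0, T]) (h2 t * S).
  by rewrite -RintegralB//; apply: eq_Rintegral => t _; rewrite mulrBl.
by ring.
Qed.

(** A jump of size one costs at most the Lipschitz constant, and the primitive of
    a Lipschitz function vanishing at zero is quadratic: no cancellation between
    the jumps and the compensator has to be exploited. *)
Lemma int_dM_lipschitz (r h : R -> R) (L a : R) : 0 <= L -> r 0 = 0 ->
  (forall y z, `|r y - r z| <= L * `|y - z|) -> (forall y, y <= a -> r y = r a) ->
  (forall t, 0 < t <= T -> h t = r (left_limit x t - S * t)) ->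
  `|int_dM S T x h| <= L * (mT ^+ 2 + n%:R).
Proof.
move=> L0 r0 rL ra hE.
have cr : continuous r.
  move=> y; apply/cvgrPdist_le => e e0; near=> z.
  apply: (le_trans (rL _ _)); apply: (@le_trans _ _ ((L + 1) * `|y - z|)).
    by rewrite ler_wpM2r// lerDl.
  rewrite mulrC -ler_pdivlMr ?ltr_wpDl//.
  near: z; apply: cvgr_dist_le; first exact: cvg_id.
  by rewrite divr_gt0// ltr_wpDl.
have [G dG] := continuous_primitive cr ra.
rewrite (int_dM_primitive T_gt0 S_gt0 cx cr dG hE) -/n -/mT.
rewrite (le_trans (ler_normB _ _))// mulrDr; apply: lerD.
  rewrite expr2 mulrA; have := @der_mvt _ G r 0 mT (L * `|mT|) dG.
  rewrite subr0 -mulrA -expr2 real_normK ?num_real// expr2 mulrA; apply => z /between0_normr zm.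
  by have := rL z 0; rewrite r0 !subr0 => /le_trans; apply; rewrite ler_wpM2l.
rewrite (le_trans (ler_norm_sum _ _ _))//.
have -> : L * n%:R = \sum_(k < n) L by rewrite sumr_const card_ord mulr_natr.
apply: ler_sum => k _; move: (k%:R - S * _) => m.
pose F y := G y + (- r m) * y.
have dF (y : R) : is_derive y 1 F (r y - r m).
  by apply: is_derive_eq (derD (dG y) (derZ (- r m) (der_id y))) _; rewrite mulr1.
have := @der_mvt _ F _ m (m + 1) L dF.
rewrite (_ : m + 1 - m = 1); last by ring.
rewrite normr1 mulr1 /F.
have -> : G (m + 1) + - r m * (m + 1) - (G m + - r m * m) = G (m + 1) - G m - r m by ring.
apply => z; rewrite min_l ?max_r ?lerDl// => /andP[z1 z2].
apply: (le_trans (rL _ _)); rewrite ler_piMr// ger0_norm ?subr_ge0//.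
by rewrite lerBlDl.
Unshelve. all: by end_near. Qed.

Lemma int_dM_linear (k : R) :
  int_dM S T x (fun t => k * (S * t - left_limit x t)) = k * ((n%:R - mT ^+ 2) / 2).
Proof.
pose G y : R := - k * (y * y * 2^-1).
have cg : continuous (fun y : R => - k * y).
  by move=> y; apply: cvgM; [exact: cvg_cst|exact: cvg_id].
have dG (y : R) : is_derive y 1 G (- k * y).
  apply: is_derive_eq (derZ (- k) (derM (derM (der_id y) (der_id y)) (der_cst 2^-1 y))) _.
  by rewrite /=; field.
rewrite (int_dM_primitive T_gt0 S_gt0 cx cg dG); last by move=> t _; rewrite -mulrNN opprB.
rewrite -/n -/mT (eq_bigr (fun=> - (k / 2))); last by move=> i _; rewrite /G; field.
by rewrite sumr_const card_ord -mulr_natl /G; field.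
Qed.

Lemma score_statE : score_stat S T x = (S * T)^-1 * ((n%:R - mT ^+ 2) / 2).
Proof.
rewrite /score_stat -[in RHS](mul1r (_ / 2)) -int_dM_linear; congr (_ * int_dM S T x _).
by apply/funext => t; rewrite mul1r.
Qed.

Lemma integrable_counting (g : R -> R) : continuous g ->
  mu.-integrable [set` `]0, T]%R] (EFin \o (fun t => g ((x t)%:R - S * t))).
Proof.
move=> cg; apply: (@integrable_along _ T S x T_gt0 S_gt0 (fun t => (x t)%:R) g cg).
- exact: measurable_counting.
- by move=> t /andP[t0 tT]; apply: (counting_bounds cx); rewrite (ltW t0).
Qed.

Let I := \int[mu]_(t in `]0, T]) (S * t - (x t)%:R) ^+ 2.

Let integrable_sq k :
  mu.-integrable [set` `]0, T]%R] (EFin \o (fun t => k * (S * t - (x t)%:R) ^+ 2)).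
Proof.
have cg : continuous (fun y : R => k * y ^+ 2).
  move=> y; apply: cvgM; first exact: cvg_cst.
  exact: exprn_continuous.
apply: eq_integrable (integrable_counting cg) => // t _ /=.
by rewrite -opprB sqrrN.
Qed.

Lemma info_statE : info_stat S T x = (S * T ^+ 2)^-1 * I.
Proof.
rewrite /info_stat /I Rintegral_itv_obnd_cbnd//.
by have := integrable_sq 1; apply: eq_integrable => // t _ /=; rewrite mul1r.
Qed.

Section expansion.
Variables (psi : R -> R) (e dl u : R).
Let c := (psi^`())%classic 0.
Let theta := u / (S * c * T).
Hypotheses (psi_gt0 : forall y, 0 < psi y) (psi0 : psi 0 = 1) (c_gt0 : 0 < c)
  (e_ge0 : 0 <= e) (dl_gt0 : 0 < dl) (u_ge0 : 0 <= u).
Hypothesis ln_lip : forall y z, `|y| <= dl -> `|z| <= dl ->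
  `|(ln (psi y) - c * y) - (ln (psi z) - c * z)| <= e * `|y - z|.
Hypothesis ln_rem : forall y, `|y| <= dl ->
  `|psi y - 1 - ln (psi y) - (c * y) ^+ 2 / 2| <= e * y ^+ 2.
Hypothesis left_small : forall t, 0 < t <= T -> `|theta * (S * t - left_limit x t)| <= dl.
Hypothesis x_small : forall t, 0 < t <= T -> `|theta * (S * t - (x t)%:R)| <= dl.

Let theta_ge0 : 0 <= theta.
Proof. by rewrite divr_ge0// !mulr_ge0// ltW. Qed.

(** Clamping makes the integrand globally Lipschitz and constant far away, without
    changing its values along the path. *)
Let cl (z : R) : R := Num.max (- dl) (Num.min dl z).

Let cl_le z : `|cl z| <= dl.
Proof.
by rewrite ler_norml /cl le_max lexx/= ge_max ge_min lexx/= andbT; have := dl_gt0; lra.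
Qed.

Let cl_id z : `|z| <= dl -> cl z = z.
Proof. by rewrite ler_norml => /andP[h1 h2]; rewrite /cl (min_idPr h2) (max_idPr h1). Qed.

Let cl_lip y z : `|cl y - cl z| <= `|y - z|.
Proof.
rewrite /cl; have d0 := dl_gt0.
have [h1 h2] := conj (ler_norm (y - z)) (ler_norm (z - y)).
rewrite distrC in h2; rewrite ler_norml; move: (`|y - z|) h1 h2 => w h1 h2.
case: (leP dl y) => h3; case: (leP dl z) => h4; case: (leP (- dl) dl) => h5;
  case: (leP (- dl) y) => h6; case: (leP (- dl) z) => h7; apply/andP; split; lra.
Qed.

Let rho z := ln (psi (cl z)) - c * cl z.

Let rho_lip y z : `|rho y - rho z| <= e * `|y - z|.
Proof.
apply: (le_trans (ln_lip (cl_le y) (cl_le z))).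
by rewrite ler_wpM2l.
Qed.

Let lipschitz_continuous (f : R -> R) L : 0 <= L ->
  (forall y z, `|f y - f z| <= L * `|y - z|) -> continuous f.
Proof.
move=> L0 fL y; apply/cvgrPdist_le => a a0; near=> z.
apply: (le_trans (fL _ _)); apply: (@le_trans _ _ ((L + 1) * `|y - z|)).
  by rewrite ler_wpM2r// lerDl.
rewrite mulrC -ler_pdivlMr ?ltr_wpDl//.
near: z; apply: cvgr_dist_le; first exact: cvg_id.
by rewrite divr_gt0// ltr_wpDl.
Unshelve. all: by end_near. Qed.

Let cont_lnpsi : continuous (fun z => ln (psi (cl z))).
Proof.
have -> : (fun z => ln (psi (cl z))) = fun z => rho z + c * cl z.
  by apply/funext => z; rewrite /rho subrK.
move=> z; apply: cvgD; first exact: lipschitz_continuous rho_lip z.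
apply: cvgM; first exact: cvg_cst.
by apply: (@lipschitz_continuous cl 1) => // y t; rewrite mul1r.
Qed.

Let linear_continuous (k : R) : continuous (fun m : R => k * m).
Proof. by move=> y; apply: cvgM; [exact: cvg_cst|exact: cvg_id]. Qed.

Let comp_linear (f : R -> R) (k : R) : continuous f -> continuous (fun m => f (k * m)).
Proof. by move=> cf y; apply: (@continuous_comp _ _ _ (fun m => k * m) f); [exact: linear_continuous|exact: cf]. Qed.

Let expand_dM :
  `|int_dM S T x (fun t => ln (psi (theta * (S * t - left_limit x t))))
    - u * score_stat S T x| <= e * theta * (mT ^+ 2 + n%:R).
Proof.
have -> : u * score_stat S T x = int_dM S T x (fun t => (c * theta) * (S * t - left_limit x t)).
  rewrite int_dM_linear score_statE mulrA; congr (_ * _); rewrite /theta.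
  by field; rewrite !gt_eqF.
rewrite (@int_dMB (fun m => ln (psi (cl (- theta * m)))) (fun m => (- (c * theta)) * m)).
- apply: (@int_dM_lipschitz (fun m => rho (- theta * m)) _ _ (- (dl / theta))).
  + by rewrite mulr_ge0.
  + by rewrite mulr0 /rho cl_id ?normr0 ?ltW// psi0 ln1 mulr0 subrr.
  + move=> y z; apply: (le_trans (rho_lip _ _)).
    by rewrite -mulrBr normrM normrN (ger0_norm theta_ge0) mulrA.
  + move=> y ya; move: theta_ge0; rewrite le_eqVlt => /predU1P[<-|th0]; first by rewrite oppr0 !mul0r.
    rewrite !mulNr mulrN opprK [theta * (dl / _)]mulrC divfK ?gt_eqF//.
    have h : dl <= - (theta * y) by rewrite -mulrN mulrC -ler_pdivrMr// lerNr.
    by rewrite /rho /cl (min_idPl h) minxx.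
  + move=> t tT; rewrite /rho mulNr -mulrN opprB cl_id ?left_small//.
    by rewrite -(mulrA c theta).
- exact: (@comp_linear _ (- theta) cont_lnpsi).
- exact: linear_continuous.
- by move=> t tT; rewrite mulNr -mulrN opprB cl_id ?left_small.
- by move=> t tT; rewrite mulNr -mulrN opprB.
Qed.

Let expand_dt :
  `|\int[mu]_(t in `[0, T])
        ((psi (theta * (S * t - (x t)%:R)) - 1
          - ln (psi (theta * (S * t - (x t)%:R)))) * S)
    - u ^+ 2 / 2 * info_stat S T x| <= e * (theta ^+ 2 * S * I).
Proof.
pose kap z := psi (cl z) - 1 - ln (psi (cl z)).
have ckap : continuous kap.
  have -> : kap = fun z => expR (ln (psi (cl z))) - 1 - ln (psi (cl z)).
    by apply/funext => z; rewrite lnK// posrE.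
  move=> z; apply: cvgB; last exact: cont_lnpsi.
  apply: cvgB; last exact: cvg_cst.
  by apply: (@continuous_comp _ _ _ (fun z => ln (psi (cl z))) expR); [exact: cont_lnpsi|exact: continuous_expR].
pose A t := (psi (theta * (S * t - (x t)%:R)) - 1
          - ln (psi (theta * (S * t - (x t)%:R)))) * S.
have iA : mu.-integrable [set` `]0, T]%R] (EFin \o A).
  have cg : continuous (fun m => kap (- theta * m) * S).
    by move=> y; apply: cvgM; [exact: (@comp_linear _ (- theta) ckap)|exact: cvg_cst].
  apply: eq_integrable (integrable_counting cg) => // t; rewrite inE/= in_itv/= => tT.
  by rewrite /A mulNr -mulrN opprB /kap cl_id// x_small.
rewrite -[X in `|X - _|]/(\int[mu]_(t in `[0, T]) A t) -Rintegral_itv_obnd_cbnd//.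
have -> : u ^+ 2 / 2 * info_stat S T x =
    \int[mu]_(t in `]0, T]) (((c * theta) ^+ 2 / 2 * S) * (S * t - (x t)%:R) ^+ 2).
  rewrite RintegralZl//; last first.
    by have := integrable_sq 1; apply: eq_integrable => // t _ /=; rewrite mul1r.
  rewrite info_statE mulrA; congr (_ * _); rewrite /theta.
  by field; rewrite !gt_eqF.
have iB := integrable_sq ((c * theta) ^+ 2 / 2 * S).
rewrite -RintegralB//.
have iD : mu.-integrable [set` `]0, T]%R] (EFin \o (fun t =>
    A t - (c * theta) ^+ 2 / 2 * S * (S * t - (x t)%:R) ^+ 2)) by have := integrableB _ iA iB; exact.
apply: (le_trans (le_normr_Rintegral _ iD)) => //.
rewrite mulrA -RintegralZl//; last first.
  by have := integrable_sq 1; apply: eq_integrable => // t _ /=; rewrite mul1r.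
apply: le_Rintegral => //.
  by have := integrable_norm iD; apply.

move=> t /=; rewrite in_itv/= => tT.
have := ln_rem (x_small tT); rewrite /A; move: (S * t - _) => m h.
have -> : (psi (theta * m) - 1 - ln (psi (theta * m))) * S - (c * theta) ^+ 2 / 2 * S * m ^+ 2 =
  (psi (theta * m) - 1 - ln (psi (theta * m)) - (c * (theta * m)) ^+ 2 / 2) * S by field.
rewrite normrM (gtr0_norm S_gt0).
apply: (@le_trans _ _ (e * (theta * m) ^+ 2 * S)); first by rewrite ler_pM2r.
by rewrite le_eqVlt; apply/orP; left; apply/eqP; ring.
Qed.

(** Only the derivative of [psi] at [0] survives in the limit, because [e] can be taken
    arbitrarily small when [dl] is small. *)
Lemma logLR_expansion :
  `|quadratic_logLR S T u x - local_logLR S psi T u x| <=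
  e * (theta * (mT ^+ 2 + n%:R) + theta ^+ 2 * S * I).
Proof.
rewrite /quadratic_logLR /local_logLR /local_LR /likelihood_ratio expRK -/c -/theta.
move: expand_dM expand_dt.
set a := int_dM _ _ _ _; set b := \int[mu]_(t in _) _.
move: (u * _) (u ^+ 2 / 2 * _) => p q h1 h2.
rewrite (_ : p - q - (a - b) = - (a - p) + (b - q)); last by ring.
rewrite (le_trans (ler_normD _ _))// normrN mulrDr mulrA; exact: lerD.
Qed.

End expansion.

End pathwise.

(** * Discretisation of a counting path *)

Section grid_path.
Context (R : realType).
Variables (T S : R) (x : R -> nat) (N : nat).
Hypotheses (T_gt0 : 0 < T) (S_gt0 : 0 < S) (cx : counting_path T x) (N_gt0 : (0 < N)%N).
Notation mu := (@lebesgue_measure R).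
Let del := T / N%:R.
Let gr i : R := grid T N i.
Let m i := (x (gr i))%:R - S * gr i.
Let D i := (x (gr i.+1))%:R - (x (gr i))%:R + S * del.

Let NR : 0 < N%:R :> R. Proof. by rewrite ltr0n. Qed.
Let del_gt0 : 0 < del. Proof. by rewrite divr_gt0. Qed.

Let grS i : gr i.+1 = gr i + del.
Proof. by rewrite /gr /grid -natr1 mulrDl mul1r. Qed.

Let gr0 : gr 0 = 0. Proof. by rewrite /gr /grid mul0r. Qed.
Let grN : gr N = T.
Proof. by rewrite /gr /grid mulrC divfK// gt_eqF. Qed.

Let gr_itv i : (i <= N)%N -> 0 <= gr i <= T.
Proof. by move=> iN; apply: grid_bounds => //; exact: ltW. Qed.

Let xmono s t : 0 <= s -> s <= t -> t <= T -> ((x s)%:R : R) <= (x t)%:R.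
Proof. by case: cx => _ h _ _ s0 st tT; rewrite ler_nat h. Qed.

Let in_cell i t : (i < N)%N -> gr i <= t <= gr i.+1 ->
  m i - S * del <= (x t)%:R - S * t <= m i.+1 + S * del.
Proof.
move=> iN /andP[t1 t2]; have /andP[g0 _] := gr_itv (ltnW iN); have /andP[_ g1] := gr_itv iN.
have h1 := xmono g0 t1 (le_trans t2 g1).
have h2 := xmono (le_trans g0 t1) t2 g1.
rewrite /m grS; rewrite grS in t2 h2 *.
have := S_gt0; move: h1 h2; move: (_%:R) (_%:R) (_%:R) => a b e h1 h2 S0.
have h3 : S * (t - gr i) <= S * del by rewrite ler_pM2l// lerBlDl.
have h4 : 0 <= S * (t - gr i) by rewrite mulr_ge0 ?subr_ge0// ltW.
rewrite mulrBr in h3 h4; rewrite mulrDr; apply/andP; split; lra.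
Qed.

(** [x] is nondecreasing, so inside a cell the compensated path leaves the range of its
    values at the two ends by at most [S T / N]. *)
Lemma path_grid_sup (a : R) : (forall i, (i <= N)%N -> `|m i| <= a) ->
  forall t, 0 <= t <= T -> `|S * t - (x t)%:R| <= a + S * del.
Proof.
move=> ma t /andP[t0 tT].
have [i iN it] : exists2 i, (i < N)%N & gr i <= t <= gr i.+1.
  have ex : exists i, t <= gr i.+1 by exists N.-1; rewrite prednK// grN.
  have iN : (ex_minn ex < N)%N.
    case: ex_minnP => i _ /(_ N.-1); rewrite prednK// grN => /(_ tT) iN.
    by rewrite (leq_ltn_trans iN)// ltn_predL.
  exists (ex_minn ex) => //; case: ex_minnP {iN} => -[|i] ti imin.
    by rewrite gr0 t0.
  rewrite ti andbT leNgt; apply/negP => /ltW /imin; by rewrite ltnn.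
have := in_cell iN it; have := ma _ (ltnW iN); have := ma _ iN.
rewrite !ler_norml; move: (m i) (m i.+1) (S * del) (S * t) => m1 m2 Sd St.
by move=> /andP[? ?] /andP[? ?] /andP[? ?]; apply/andP; split; lra.
Qed.

(** The bound passes to the limit: the path is constant just before [t]. *)
Lemma left_limit_sup (b : R) : (forall t, 0 <= t <= T -> `|S * t - (x t)%:R| <= b) ->
  forall t, 0 < t <= T -> `|S * t - left_limit x t| <= b.
Proof.
move=> xb t tT; have [s [k [s0 st xk ->]]] := left_limitE cx tT.
apply/ler_addgt0Pr => e e0; pose r := Num.max s (t - e / S).
have eS : 0 < e / S by rewrite divr_gt0.
have rt : s <= r < t by rewrite /r le_max lexx/= gt_max st/= ltrBlDr ltrDl.
have /andP[sr rlt] := rt; have /andP[t0 tT'] := tT.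
have := xb r; rewrite xk// (le_trans s0 sr) (le_trans (ltW rlt) tT') => /(_ isT) h.
have -> : S * t - k%:R = (S * r - k%:R) + S * (t - r) by ring.
have h2 : 0 <= S * (t - r) by apply: mulr_ge0; [exact: ltW|rewrite subr_ge0 ltW].
rewrite (le_trans (ler_normD _ _))// lerD// (ger0_norm h2).
by rewrite mulrC -ler_pdivlMr// lerBlDr addrC -lerBlDr /r le_max lexx orbT.
Qed.

Let cx_sq : continuous (fun y : R => y ^+ 2).
Proof. exact: exprn_continuous. Qed.

(** On a cell the compensated path differs from its value [m i] at the left end by at most
    [D i], and [2 |m| D] is at most [lam m^2 + D^2 / lam]. *)
Lemma info_riemann (lam : R) : 0 < lam ->
  `|info_stat S T x - (S * T * N%:R)^-1 * \sum_(i < N) m i ^+ 2| <=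
  lam * ((S * T * N%:R)^-1 * \sum_(i < N) m i ^+ 2) +
  (1 + lam^-1) * ((S * T * N%:R)^-1 * \sum_(i < N) D i ^+ 2).
Proof.
move=> lam0; pose F t := ((x t)%:R - S * t) ^+ 2.
have iF : mu.-integrable [set` `]0, T]%R] (EFin \o F).
  exact: (@integrable_counting _ T S x T_gt0 S_gt0 cx _ cx_sq).
have -> : info_stat S T x = (S * T * N%:R)^-1 * (del^-1 * \sum_(i < N) \int[mu]_(t in `]gr i, gr i.+1]) F t).
  rewrite info_statE// mulrA; congr (_ * _).
    by rewrite /del; field; rewrite !gt_eqF.
  rewrite -Rintegral_cells ?gr0 ?grN//; last by move=> i _; rewrite grS lerDl ltW.
  by apply: eq_Rintegral => t _; rewrite /F -opprB sqrrN.
rewrite [lam * (_ * _)]mulrCA [(1 + _) * (_ * _)]mulrCA -mulrBr -mulrDr normrM.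
have STN : 0 < (S * T * N%:R)^-1 by rewrite invr_gt0 !mulr_gt0.
rewrite (gtr0_norm STN) ler_pM2l// mulr_sumr -sumrB.
rewrite !mulr_sumr -big_split/=.
rewrite (le_trans (ler_norm_sum _ _ _))// ler_sum// => i _.
have iN := ltn_ord i.
have /andP[g0 _] := gr_itv (ltnW iN); have /andP[_ g1] := gr_itv iN.
have iFi : mu.-integrable [set` `]gr i, gr i.+1]%R] (EFin \o F).
  by apply: integrableS iF => //; apply: subset_itv; rewrite bnd_simp.
have mui : fine (mu [set` `]gr i, gr i.+1]%R]) = del.
  rewrite -[mu _]/(@lebesgue_measure R [set` `]gr i, gr i.+1]%R]) lebesgue_measure_itv/=.
  by rewrite lte_fin grS ltrDl del_gt0/= addrAC subrr add0r.
have ic (k : R) : mu.-integrable [set` `]gr i, gr i.+1]%R] (EFin \o cst k).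
  apply: (integrableS _ _ _ (_ : mu.-integrable [set` `[gr i, gr i.+1]%R] _)) => //.
    by apply: subset_itvr; rewrite bnd_simp.
  apply: continuous_compact_integrable; first exact: segment_compact.
  by apply: continuous_subspaceT => y; exact: cvg_cst.
pose B := (2 * `|m i| + D i) * D i.
have grle : gr i <= gr i.+1 by rewrite grS lerDl ltW.
have Sd0 : 0 <= S * del by rewrite mulr_ge0// ltW.
have SdD : S * del <= D i by rewrite lerDr subr_ge0 xmono.
have D0 : 0 <= D i := le_trans Sd0 SdD.
have FB t : gr i < t <= gr i.+1 -> `|F t - m i ^+ 2| <= B.
  move=> /andP[t1 t2]; rewrite /F subr_sqr normrM mulrC.
  have h : `|(x t)%:R - S * t - m i| <= D i.
    have := in_cell iN (_ : gr i <= t <= gr i.+1); rewrite (ltW t1) t2 => /(_ isT).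
    have -> : m i.+1 = m i + D i - 2 * (S * del) by rewrite /m /D grS; ring.
    move: (_%:R - _) Sd0 SdD => y; move: (m i) (D i) (S * del) => a b e h1 h2 /andP[h3 h4].
    by rewrite ler_norml; apply/andP; split; lra.
  apply: ler_pM => //.
  have -> : (x t)%:R - S * t + m i = ((x t)%:R - S * t - m i) + 2 * m i by ring.
  by rewrite (le_trans (ler_normD _ _))// addrC lerD// normrM ger0_norm.
have -> : del^-1 * \int[mu]_(t in `]gr i, gr i.+1]) F t - m i ^+ 2 =
    del^-1 * \int[mu]_(t in `]gr i, gr i.+1]) (F t - m i ^+ 2).
  have -> : \int[mu]_(t in `]gr i, gr i.+1]) (F t - m i ^+ 2) =
      \int[mu]_(t in `]gr i, gr i.+1]) F t - m i ^+ 2 * del.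
    rewrite -mui -(@Rintegral_cst _ _ _ mu _ _ (m i ^+ 2))//.
    by apply: (RintegralB _ iFi (ic (m i ^+ 2))).
  by rewrite mulrBr [_ * (_ * del)]mulrCA mulVf ?gt_eqF// mulr1.
rewrite normrM gtr0_norm ?invr_gt0// ler_pdivrMl//.
have iFm : mu.-integrable [set` `]gr i, gr i.+1]%R] (EFin \o (fun t => F t - m i ^+ 2)).
  by have := integrableB _ iFi (ic (m i ^+ 2)); exact.
apply: (le_trans (le_normr_Rintegral _ iFm)) => //.
apply: (@le_trans _ _ (\int[mu]_(t in `]gr i, gr i.+1]) B)).
  apply: le_Rintegral => //.
    by have := integrable_norm iFm; apply.
  exact: (ic B).
rewrite Rintegral_cst// mui mulrC ler_pM2l// /B.
have -> : m i ^+ 2 = `|m i| ^+ 2 by rewrite real_normK ?num_real.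
move: (`|m i|) (D i) => a b.
have h := sqr_ge0 (lam * a - b).
have -> : lam * a ^+ 2 + (1 + lam^-1) * b ^+ 2 = (2 * a + b) * b + lam^-1 * (lam * a - b) ^+ 2.
  by field; rewrite gt_eqF.
by rewrite lerDl mulr_ge0// invr_ge0 ltW.
Qed.

End grid_path.

(** * The Poisson process on a grid *)

Section markov_event.
Context (R : realType) d (Omega : measurableType d) (P : probability Omega R).

(** Markov's inequality, as the existence of an exceptional event. *)
Lemma markov_event (Y : Omega -> R) (B eta : R) :
  P.-integrable setT (EFin \o Y) -> (forall w, 0 <= Y w) -> \int[P]_w Y w <= B ->
  0 < B -> 0 < eta ->
  exists E, [/\ measurable E, (P E <= eta%:E)%E & forall w, ~ E w -> Y w <= B / eta].
Proof.
move=> iY Y0 YB B0 eta0; pose a := B / eta; have a0 : 0 < a by rewrite divr_gt0.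
have -> : eta = B / a by rewrite /a invf_div mulrC divfK// gt_eqF.
have mY := measurable_integrable iY.
have mlt : measurable [set w | a < Y w].
  rewrite (_ : mkset _ = setT `&` Y @^-1` [set` `]a, +oo[%R]); first exact: mY.
  by rewrite setTI; apply/seteqP; split => w /=; rewrite in_itv/= andbT.
have mle : measurable [set w | (a%:E <= `|(Y w)%:E|)%E].
  rewrite (_ : mkset _ = setT `&` Y @^-1` [set` `[a, +oo[%R]); first exact: mY.
  by rewrite setTI; apply/seteqP; split => w /=; rewrite in_itv/= andbT lee_fin ger0_norm.
exists [set w | a < Y w]; split => //.
- pose Y' : {RV P >-> R} := HB.pack Y (isMeasurableFun.Build _ _ _ _ Y mY).
  have := @markov _ _ _ P Y' (fun x => x) a a0 (@measurable_id _ _ _) (fun r h => h)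
    (fun x y _ _ h => h).
  have -> : ('E_P[((fun x => x) \o Num.norm) \o Y'] = (\int[P]_w Y w)%R%:E)%E.
    rewrite unlock /Rintegral fineK; last exact: integrable_fin_num.
    by apply: eq_integral => w _ /=; rewrite ger0_norm.
  move=> h; rewrite EFinM lee_pdivlMr// muleC.
  apply: (@le_trans _ _ (\int[P]_w Y w)%:E); last by rewrite lee_fin.
  apply: le_trans h; rewrite lee_pmul2l//; apply: le_measure; rewrite ?inE//.
  by move=> w /= /ltW aw; rewrite lee_fin ger0_norm.
- have -> : B / (B / a) = a by rewrite invf_div mulrC divfK// gt_eqF.
  by move=> w /negP; rewrite -leNgt.
Qed.

End markov_event.

Section poisson_process.
Context (R : realType) d (Omega : measurableType d) (P : probability Omega R).
Variables (S T : R) (X : R -> Omega -> nat).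
Hypotheses (S_gt0 : 0 < S) (T_gt0 : 0 < T) (X_poisson : poisson_process P S T X).

Let mX t : 0 <= t <= T -> measurable_fun setT (X t).
Proof. by case: X_poisson => h _ _ _; exact: h. Qed.

Let cX w : counting_path T (X ^~ w).
Proof. by case: X_poisson. Qed.

Definition counting t w : R := (X t w)%:R.

Lemma counting0 w : counting 0 w = 0.
Proof. by rewrite /counting; case: (cX w) => ->. Qed.

Lemma measurable_counting_at t : 0 <= t <= T -> measurable_fun setT (counting t).
Proof.
move=> tT; apply: (measurableT_comp (f := fun k : nat => k%:R : R)); last exact: mX.
by move=> _ A _.
Qed.

Lemma counting_independent : independent_increments P T counting.
Proof. by case: X_poisson. Qed.

Definition compensated t w : R := counting t w - S * t.

(** By monotonicity the increment is a natural number, with Poisson law. *)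
Lemma compensated_increment s t : 0 <= s -> s <= t -> t <= T ->
  [/\ rv4 P (fun w => compensated t w - compensated s w),
  \int[P]_w (compensated t w - compensated s w) = 0,
  \int[P]_w ((compensated t w - compensated s w) ^+ 2) = S * (t - s) &
  \int[P]_w ((compensated t w - compensated s w) ^+ 4) =
    S * (t - s) + 3 * (S * (t - s)) ^+ 2].
Proof.
move=> s0; rewrite le_eqVlt => /predU1P[<- _|st tT].
  rewrite (_ : (fun w => compensated s w - compensated s w) = fun=> 0); last first.
    by apply/funext => w; rewrite subrr.
  split; first exact: rv4_cst.
  - by rewrite (@eq_Rintegral _ _ _ P _ (fun=> 0)) ?Rintegral_prob_cst// => w _; rewrite subrr.
  - rewrite (@eq_Rintegral _ _ _ P _ (fun=> 0)) ?Rintegral_prob_cst ?subrr ?mulr0// => w _.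
    by rewrite subrr expr0n.
  - rewrite (@eq_Rintegral _ _ _ P _ (fun=> 0)) ?Rintegral_prob_cst ?subrr.
      by rewrite mulr0 expr0n/= mulr0 addr0.
    by move=> w _; rewrite subrr expr0n.
pose N w := (X t w - X s w)%N.
have xle w : (X s w <= X t w)%N.
  by case: (cX w) => _ h _ _; apply: h => //; exact: ltW.
have sT : 0 <= s <= T by rewrite s0 (le_trans (ltW st)).
have tT' : 0 <= t <= T by rewrite (le_trans s0 (ltW st)).
have NE w : (N w)%:R - S * (t - s) = compensated t w - compensated s w.
  by rewrite natrB// /compensated /counting; ring.
have mN : measurable_fun setT N.
  move=> _ A _; rewrite setTI.
  rewrite (_ : N @^-1` A = \bigcup_j \bigcup_(k in [set k | A (j - k)%N])
     ([set w | X t w = j] `&` [set w | X s w = k])); last first.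
    apply/seteqP; split => [w Aw|w [j _ [k /= Ajk [jE kE]]]]; last by rewrite /N jE kE.
    by exists (X t w) => //; exists (X s w).
  apply: bigcup_measurable => j _; apply: bigcup_measurable => k _.
  apply: measurableI; rewrite -[X in measurable X]setTI.
    exact: (mX tT' measurableT (Y := [set j])).
  exact: (mX sT measurableT (Y := [set k])).
have law k : P (N @^-1` [set k]) = (poisson_pmf (S * (t - s)) k)%:E.
  case: X_poisson => _ _ _ <- //; congr (P _); apply/seteqP; split => w /=.
    by move=> <-; rewrite /N subnKC.
  by rewrite /N => ->; rewrite addKn.
have l0 : 0 < S * (t - s) by rewrite mulr_gt0// subr_gt0.
have [h1 h2 h3 h4] := poisson_centered_moments l0 mN law.
split.
- split; last by move: h1; apply: eq_integrable => // w _ /=; rewrite NE.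
  apply: measurable_funB; apply: measurable_funB => //; exact: measurable_counting_at.
- by rewrite -h2; apply: eq_Rintegral => w _; rewrite NE.
- by rewrite -h3; apply: eq_Rintegral => w _; rewrite NE.
- by rewrite -h4; apply: eq_Rintegral => w _; rewrite NE.
Qed.

Let comp0 w : compensated 0 w = 0.
Proof. by rewrite /compensated counting0 mulr0 subrr. Qed.

Lemma compensated_moments t : 0 <= t <= T ->
  [/\ rv4 P (compensated t), \int[P]_w compensated t w = 0 &
  \int[P]_w (compensated t w ^+ 2) = S * t].
Proof.
move=> /andP[t0 tT]; have [h1 h2 h3 _] := compensated_increment (lexx 0) t0 tT.
split.
- by move: h1; congr (rv4 P _); apply/funext => w; rewrite comp0 subr0.
- by rewrite -h2; apply: eq_Rintegral => w _; rewrite comp0 subr0.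
- rewrite subr0 in h3; rewrite -h3; apply: eq_Rintegral => w _.
  by rewrite comp0 subr0.
Qed.

Let sq_integrable Y : rv4 P Y -> P.-integrable setT (EFin \o (fun w => Y w ^+ 2)).
Proof.
by move=> rY; exact: (rv4_mul2 rY rY).
Qed.

Lemma endpoint_mean :
  P.-integrable setT (EFin \o (fun w => compensated T w ^+ 2 + counting T w)) /\
  \int[P]_w (compensated T w ^+ 2 + counting T w) = 2 * (S * T).
Proof.
have [r e1 e2] : [/\ rv4 P (compensated T), \int[P]_w compensated T w = 0 &
  \int[P]_w (compensated T w ^+ 2) = S * T].
  by apply: compensated_moments; rewrite lexx ltW.
have E w : counting T w = compensated T w + S * T by rewrite /compensated subrK.
have i1 := rv4_integrable r; have i2 := sq_integrable r.
have i3 : P.-integrable setT (EFin \o counting T).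
  have := integrable_add i1 (@integrable_bounded _ _ _ P (fun=> S * T) `|S * T| _ _).
  move=> /(_ _ (fun=> lexx _)); rewrite (_ : (fun w => _ + _) = counting T); first exact.
  by apply/funext => w; rewrite E.
split; first exact: integrable_add.
rewrite RintegralD// e2 (@eq_Rintegral _ _ _ P _ (fun w => compensated T w + S * T)); last by move=> w _; rewrite E.
rewrite RintegralD//; first by rewrite e1 Rintegral_prob_cst; ring.
exact: finite_measure_integrable_cst.
Qed.

Section grid_moments.
Variable N : nat.
Hypothesis N_gt0 : (0 < N)%N.
Let gr i : R := grid T N i.
Let NR : 0 < N%:R :> R. Proof. by rewrite ltr0n. Qed.

Let gr_itv i : (i <= N)%N -> 0 <= gr i <= T.
Proof. by move=> iN; apply: grid_bounds => //; exact: ltW. Qed.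

Lemma grid_square_mean (M : nat) : (M <= N.+1)%N ->
  P.-integrable setT (EFin \o (fun w => \sum_(i < M) compensated (gr i) w ^+ 2)) /\
  \int[P]_w (\sum_(i < M) compensated (gr i) w ^+ 2) <= M%:R * (S * T).
Proof.
move=> MN.
have h (i : 'I_M) : [/\ rv4 P (compensated (gr i)), \int[P]_w compensated (gr i) w = 0 &
    \int[P]_w (compensated (gr i) w ^+ 2) = S * gr i].
  by apply/compensated_moments/gr_itv; rewrite -ltnS (leq_trans (ltn_ord i)).
have i2 (i : 'I_M) : P.-integrable setT (EFin \o (fun w => compensated (gr i) w ^+ 2)).
  by apply: sq_integrable; case: (h i).
split; first exact: integrable_bigsum.
rewrite Rintegral_bigsum//.
have -> : M%:R * (S * T) = \sum_(i < M) (S * T) by rewrite sumr_const card_ord mulr_natl.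
apply: ler_sum => i _; case: (h i) => _ _ ->; rewrite ler_pM2l//.
have iN : (i <= N)%N by rewrite -ltnS (leq_trans (ltn_ord i)).
by case/andP: (gr_itv iN).
Qed.

Let D i w := counting (gr i.+1) w - counting (gr i) w + S * (T / N%:R).

Lemma oscillation_mean :
  P.-integrable setT (EFin \o (fun w => \sum_(i < N) D i w ^+ 2)) /\
  \int[P]_w (\sum_(i < N) D i w ^+ 2) =
    N%:R * (S * (T / N%:R) + 4 * (S * (T / N%:R)) ^+ 2).
Proof.
pose l := S * (T / N%:R).
pose xi i w := compensated (gr i.+1) w - compensated (gr i) w.
have grS i : gr i.+1 - gr i = T / N%:R by rewrite /gr /grid -natr1; ring.
have DE i w : D i w ^+ 2 = xi i w ^+ 2 + (4 * l) * xi i w + (4 * l ^+ 2).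
  have -> : D i w = xi i w + 2 * l.
    by rewrite /D /xi /compensated -/l /l -(grS i); ring.
  by ring.
have h (i : 'I_N) : [/\ rv4 P (xi i), \int[P]_w xi i w = 0 & \int[P]_w (xi i w ^+ 2) = l].
  have /andP[a b] := gr_itv (ltnW (ltn_ord i)); have /andP[a' b'] := gr_itv (ltn_ord i).
  have gg : gr i <= gr i.+1 by rewrite -subr_ge0 grS divr_ge0// ltW.
  by have [h1 h2 h3 _] := compensated_increment a gg b'; rewrite /l -(grS i).
have i1 (i : 'I_N) : P.-integrable setT (EFin \o (fun w => xi i w ^+ 2)).
  by apply: sq_integrable; case: (h i).
have i2 (i : 'I_N) : P.-integrable setT (EFin \o (fun w => 4 * l * xi i w)).
  by apply/integrable_scale/rv4_integrable; case: (h i).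
have i3 : P.-integrable setT (EFin \o (fun w => 4 * l ^+ 2)).
  exact: finite_measure_integrable_cst.
have iD (i : 'I_N) : P.-integrable setT (EFin \o (fun w => D i w ^+ 2)).
  have := integrable_add (integrable_add (i1 i) (i2 i)) i3.
  by congr (P.-integrable setT (EFin \o _)); apply/funext => w; rewrite DE.
split; first exact: integrable_bigsum.
rewrite Rintegral_bigsum//.
rewrite (eq_bigr (fun=> l + 4 * l ^+ 2)); first by rewrite sumr_const card_ord [RHS]mulr_natl.
move=> i _; case: (h i) => r e1 e2.
rewrite (@eq_Rintegral _ _ _ P _ (fun w => xi i w ^+ 2 + (4 * l) * xi i w + (4 * l ^+ 2))); last first.
  by move=> w _; rewrite DE.
rewrite RintegralD//; last exact: integrable_add.
rewrite RintegralD// e2 RintegralZl ?e1//; last exact: rv4_integrable.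
by rewrite Rintegral_prob_cst mulr0 addr0.
Qed.

(** The normalised increments have fourth moments [(1/(S T)) / N + 3 / N^2], which is at
    most [(3 + 2/S) / N^2] when [N <= 2 T]. *)
Lemma poisson_lindeberg (a b : R) : 0 <= a -> 0 <= b -> 4 * (a + b) + 1 <= N%:R ->
  1 <= T -> N%:R <= 2 * T ->
  `|\int[P]_w expR (- a * scaled T counting (Num.sqrt (S * T))^-1 S N N w ^+ 2
      - b / N%:R * (\sum_(i < N) scaled T counting (Num.sqrt (S * T))^-1 S N i w ^+ 2))
    - expR (- riccati_sum a b N%:R N)|
  <= lindeberg_const (3 + 2 / S) a b / Num.sqrt N%:R.
Proof.
move=> a0 b0 Nab T1 NT; set c := (Num.sqrt (S * T))^-1.
have ST0 : 0 < S * T by rewrite mulr_gt0.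
have cc : c ^+ 2 = (S * T)^-1 by rewrite exprVn sqr_sqrtr// ltW.
pose xi i w := compensated (gr i.+1) w - compensated (gr i) w.
have xiE i w : scaled T counting c S N i.+1 w - scaled T counting c S N i w = c * xi i w.
  by rewrite /scaled -mulrBr.
have grS i : gr i.+1 - gr i = T / N%:R by rewrite /gr /grid -natr1; ring.
pose l := S * (T / N%:R).
have h i : (i < N)%N -> [/\ rv4 P (xi i), \int[P]_w xi i w = 0,
    \int[P]_w (xi i w ^+ 2) = l & \int[P]_w (xi i w ^+ 4) = l + 3 * l ^+ 2].
  move=> iN; have /andP[p q] := gr_itv (ltnW iN); have /andP[p' q'] := gr_itv iN.
  have gg : gr i <= gr i.+1 by rewrite -subr_ge0 grS divr_ge0// ltW.
  by have := compensated_increment p gg q'; rewrite grS.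
have pow j i w : (scaled T counting c S N i.+1 w - scaled T counting c S N i w) ^+ j
     = c ^+ j * xi i w ^+ j by rewrite xiE exprMn.
apply: lindeberg_riccati => //.
- exact: ltW.
- exact: measurable_counting_at.
- exact: counting_independent.
- by apply: aeW => w; exact: counting0.
- move=> i iN; have [[_ h1] _ _ _] := h i iN.
  have := integrable_scale (c ^+ 4) h1.
  by congr (P.-integrable setT (EFin \o _)); apply/funext => w; rewrite pow.
- move=> i iN; have [r h1 _ _] := h i iN.
  rewrite (@eq_Rintegral _ _ _ P _ (fun w => c * xi i w)); last by move=> w _; rewrite xiE.
  by rewrite RintegralZl ?h1 ?mulr0//; exact: rv4_integrable.
- move=> i iN; have [r _ h1 _] := h i iN.
  rewrite (@eq_Rintegral _ _ _ P _ (fun w => c ^+ 2 * xi i w ^+ 2)); last by move=> w _; rewrite pow.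
  rewrite RintegralZl//; last exact: sq_integrable.
  by rewrite h1 cc /l; field; rewrite !gt_eqF.
- move=> i iN; have [[_ r] _ _ h1] := h i iN.
  rewrite (@eq_Rintegral _ _ _ P _ (fun w => c ^+ 4 * xi i w ^+ 4)); last by move=> w _; rewrite pow.
  rewrite RintegralZl// h1 (exprM c 2 2) cc.
  have -> : (S * T)^-1 ^+ 2 * (l + 3 * l ^+ 2) = (3 + N%:R / (S * T)) / N%:R ^+ 2.
    by rewrite /l; field; rewrite !gt_eqF.
  rewrite ler_pM2r ?invr_gt0 ?exprn_gt0// lerD2l ler_pdivrMr//.
  by have -> : 2 / S * (S * T) = 2 * T by field; rewrite gt_eqF.
Qed.

End grid_moments.

End poisson_process.

(** * The expansion at a given horizon *)

(** The mesh [T / steps T] of the grid stays bounded as [T] grows, while the number of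
    steps goes to infinity. *)
Definition steps (R : realType) (T : R) : nat := (Num.truncn T).+1.

Lemma steps_bounds (R : realType) (T : R) : 1 <= T -> T <= (steps T)%:R <= 2 * T.
Proof.
move=> T1; have T0 : 0 <= T by rewrite (le_trans ler01).
have /andP[h1 h2] := Num.Theory.truncn_itv T0.
by rewrite /steps (ltW h2)/= -natr1; lra.
Qed.

Section one_horizon.
Context (R : realType) d (Omega : measurableType d) (P : probability Omega R).
Variables (S T : R) (X : R -> Omega -> nat).
Hypotheses (S_gt0 : 0 < S) (T_ge1 : 1 <= T) (X_poisson : poisson_process P S T X).
Let N := steps T.
Let T_gt0 : 0 < T. Proof. exact: lt_le_trans T_ge1. Qed.
Let NR : 0 < N%:R :> R. Proof. by rewrite ltr0n. Qed.
Let ST_gt0 : 0 < S * T. Proof. exact: mulr_gt0. Qed.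

Notation M t w := (compensated S X t w).

Definition info_grid w : R :=
  (S * T * N%:R)^-1 * \sum_(i < N) M (grid T N i) w ^+ 2.

Definition oscillation w : R :=
  (S * T * N%:R)^-1 * \sum_(i < N)
    (counting X (grid T N i.+1) w - counting X (grid T N i) w + S * (T / N%:R)) ^+ 2.

(** Outside an event of small probability all the random quantities that enter
    the expansion are under control at once. *)
Lemma good_event (eta : R) (K : nat) : 0 < eta -> (0 < K)%N ->
  exists E, [/\ measurable E, (P E <= (4 * eta)%:E)%E & forall w, ~ E w ->
  [/\ M T w ^+ 2 + counting X T w <= 2 * (S * T) / eta,
      info_grid w <= 1 / eta,
      oscillation w <= (1 + 4 * S) / T / eta &
      forall i, (i <= K)%N -> M (grid T K i) w ^+ 2 <= K.+1%:R * (S * T) / eta]].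
Proof.
move=> eta0 K0.
have [i1 e1] := endpoint_mean S_gt0 T_gt0 X_poisson.
have [E1 [mE1 pE1 hE1]] : exists E, [/\ measurable E, (P E <= eta%:E)%E &
   forall w, ~ E w -> M T w ^+ 2 + counting X T w <= 2 * (S * T) / eta].
  apply: (markov_event i1) => //; [|by rewrite e1|by rewrite mulr_gt0].
  by move=> w; rewrite addr_ge0 ?sqr_ge0// ler0n.
have N0 : (0 < N)%N by [].
have STN : 0 < S * T * N%:R by rewrite mulr_gt0.
have [i2 e2] := grid_square_mean S_gt0 T_gt0 X_poisson N0 (leqnSn N).
have [E2 [mE2 pE2 hE2]] : exists E, [/\ measurable E, (P E <= eta%:E)%E &
   forall w, ~ E w -> info_grid w <= 1 / eta].
  apply: (markov_event (integrable_scale (S * T * N%:R)^-1 i2)) => //.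
    by move=> w; rewrite mulr_ge0 ?invr_ge0 ?(ltW STN)// sumr_ge0// => i _; exact: sqr_ge0.
  by rewrite RintegralZl// ler_pdivrMl// mulr1 (le_trans e2)// mulrC.
have [i3 e3] := oscillation_mean S_gt0 T_gt0 X_poisson N0.
have [E3 [mE3 pE3 hE3]] : exists E, [/\ measurable E, (P E <= eta%:E)%E &
   forall w, ~ E w -> oscillation w <= (1 + 4 * S) / T / eta].
  have S4 : 0 < 1 + 4 * S by have := S_gt0; lra.
  apply: (markov_event (integrable_scale (S * T * N%:R)^-1 i3)) => //.
  - by move=> w; rewrite mulr_ge0 ?invr_ge0 ?(ltW STN)// sumr_ge0// => i _; exact: sqr_ge0.
  - rewrite RintegralZl// e3.
    have -> : (S * T * N%:R)^-1 * (N%:R * (S * (T / N%:R) + 4 * (S * (T / N%:R)) ^+ 2)) =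
       (T / N%:R + 4 * S * (T / N%:R) ^+ 2) / T by field; rewrite !gt_eqF.
    have TN1 : T / N%:R <= 1 by rewrite ler_pdivrMr// mul1r; case/andP: (steps_bounds T_ge1).
    rewrite ler_pM2r ?invr_gt0// lerD//.
    by rewrite ler_piMr ?mulr_ge0 ?(ltW S_gt0)// exprn_ile1// divr_ge0// ltW.
  - by rewrite divr_gt0.
have [i4 e4] := grid_square_mean S_gt0 T_gt0 X_poisson K0 (leqnn K.+1).
have [E4 [mE4 pE4 hE4]] : exists E, [/\ measurable E, (P E <= eta%:E)%E &
   forall w, ~ E w -> forall i, (i <= K)%N -> M (grid T K i) w ^+ 2 <= K.+1%:R * (S * T) / eta].
  have [||E [mE pE hE]] := markov_event i4 _ e4 _ eta0.
  - by move=> w; rewrite sumr_ge0// => i _; exact: sqr_ge0.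
  - by rewrite mulr_gt0.
  - exists E; split => // w /hE h i iK; apply: le_trans h.
    by rewrite (bigD1 (Ordinal (iK : (i < K.+1)%N)))//= lerDl sumr_ge0// => j _; exact: sqr_ge0.
exists (E1 `|` E2 `|` (E3 `|` E4)); split.
- by apply: measurableU; apply: measurableU.
- have -> : (4 * eta)%:E = (eta%:E + eta%:E + (eta%:E + eta%:E))%E.
    by rewrite -!EFinD; congr (_%:E); ring.
  apply: (le_trans (measureU2 _ _ _)); try exact: measurableU.
  by apply: leeD; apply: (le_trans (measureU2 _ _ _)) => //; apply: leeD.
- move=> w Ew; split.
  + by apply: hE1 => h; apply: Ew; left; left.
  + by apply: hE2 => h; apply: Ew; left; right.
  + by apply: hE3 => h; apply: Ew; right; left.
  + by apply: hE4 => h; apply: Ew; right; right.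
Qed.

Let cX w : counting_path T (X ^~ w).
Proof. by case: X_poisson. Qed.

Definition normalized i w : R := scaled T (counting X) (Num.sqrt (S * T))^-1 S N i w.

Let normalized_sq i w : normalized i w ^+ 2 = M (grid T N i) w ^+ 2 / (S * T).
Proof.
by rewrite /normalized /scaled exprMn exprVn sqr_sqrtr ?(ltW ST_gt0)// mulrC.
Qed.

(** The likelihood is compared with a functional of the grid values alone, to which the
    Lindeberg estimate applies. *)
Definition expansion (u : R) w : R :=
  u / 2 - u / 2 * normalized N w ^+ 2
    - u ^+ 2 / 2 * (N%:R^-1 * \sum_(i < N) normalized i w ^+ 2).

Section deterministic.
Variables (psi : R -> R) (eps dl eta kap lam C u : R) (K : nat) (w : Omega).
Let c := (psi^`())%classic 0.
Hypotheses (psi_gt0 : forall y, 0 < psi y) (psi0 : psi 0 = 1) (c_gt0 : 0 < c)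
  (eps_gt0 : 0 < eps) (dl_gt0 : 0 < dl) (eta_gt0 : 0 < eta) (kap_gt0 : 0 < kap)
  (lam_gt0 : 0 < lam) (u_ge0 : 0 <= u) (uC : u <= C) (K_gt0 : (0 < K)%N).
Hypothesis ln_lip : forall y z, `|y| <= dl -> `|z| <= dl ->
  `|(ln (psi y) - c * y) - (ln (psi z) - c * z)| <= eps * `|y - z|.
Hypothesis ln_rem : forall y, `|y| <= dl ->
  `|psi y - 1 - ln (psi y) - (c * y) ^+ 2 / 2| <= eps * y ^+ 2.
Hypotheses (end_le : M T w ^+ 2 + counting X T w <= 2 * (S * T) / eta)
  (info_le : info_grid w <= 1 / eta)
  (osc_le : oscillation w <= (1 + 4 * S) / T / eta)
  (grid_le : forall i, (i <= K)%N -> M (grid T K i) w ^+ 2 <= K.+1%:R * (S * T) / eta).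
Hypothesis range_le :
  C / (S * c) * (kap + K.+1%:R * S / (eta * kap) / T + S / K%:R) <= dl.

Let theta := u / (S * c * T).

Let C_ge0 : 0 <= C := le_trans u_ge0 uC.
Let KR : 0 < K%:R :> R. Proof. by rewrite ltr0n. Qed.

(** It gives linear bounds from the control of squares, with a free parameter [b]. *)
Let small_of_sq (a b : R) : 0 < b -> `|a| <= b + a ^+ 2 / b.
Proof.
move=> b0; rewrite -[a ^+ 2]real_normK ?num_real//.
have [|h] := leP `|a| b; first by move=> h; rewrite (le_trans h)// lerDl divr_ge0 ?sqr_ge0// ltW.
apply: (@le_trans _ _ (`|a| ^+ 2 / b)); last by rewrite lerDr ltW.
by rewrite ler_pdivlMr// expr2 ler_pM2l ?ltW// (lt_trans b0).
Qed.

Let x_sup t : 0 <= t <= T ->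
  `|S * t - (X t w)%:R| <= T * (kap + K.+1%:R * S / (eta * kap) / T + S / K%:R).
Proof.
pose a := kap * T + K.+1%:R * S / (eta * kap).
have -> : T * (kap + K.+1%:R * S / (eta * kap) / T + S / K%:R) = a + S * (T / K%:R).
  by rewrite /a; field; rewrite !gt_eqF.
apply: (path_grid_sup T_gt0 S_gt0 (cX w) K_gt0) => i iK.
have kT : 0 < kap * T by rewrite mulr_gt0.
apply: (le_trans (small_of_sq _ kT)); rewrite /a lerD2l ler_pdivrMr//.
apply: (le_trans (grid_le iK)).
by rewrite le_eqVlt; apply/orP; left; apply/eqP; field; rewrite !gt_eqF.
Qed.

Let theta_ge0 : 0 <= theta.
Proof. by rewrite divr_ge0// !mulr_ge0// ltW. Qed.

Let theta_small y : `|y| <= T * (kap + K.+1%:R * S / (eta * kap) / T + S / K%:R) ->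
  `|theta * y| <= dl.
Proof.
move=> h; rewrite normrM (ger0_norm theta_ge0).
apply: (le_trans _ range_le).
apply: (@le_trans _ _ (C / (S * c * T) * (T * (kap + K.+1%:R * S / (eta * kap) / T + S / K%:R)))).
  apply: ler_pM => //; rewrite /theta ler_wpM2r// invr_ge0 !mulr_ge0// ltW//.
by rewrite le_eqVlt; apply/orP; left; apply/eqP; field; rewrite !gt_eqF.
Qed.

Let J := info_stat S T (X ^~ w).

Let J_le : J <= (4 + 8 * S) / eta.
Proof.
have := @info_riemann _ T S (X ^~ w) N T_gt0 S_gt0 (cX w) isT 1 ltr01.
rewrite invr1 mul1r -/J => h.
have h1 := le_trans (ler_norm _) h.
have oE : (S * T * N%:R)^-1 * \sum_(i < N)
   ((X (grid T N i.+1) w)%:R - (X (grid T N i) w)%:R + S * (T / N%:R)) ^+ 2 = oscillation w by [].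
have iE : (S * T * N%:R)^-1 * \sum_(i < N) ((X (grid T N i) w)%:R - S * grid T N i) ^+ 2 = info_grid w by [].
rewrite oE iE in h1.
have h2 : oscillation w <= (1 + 4 * S) / eta.
  apply: (le_trans osc_le); rewrite ler_pM2r ?invr_gt0//.
  by rewrite ler_pdivrMr// ler_peMr// addr_ge0// mulr_ge0// ltW.
have -> : (4 + 8 * S) / eta = 2 * (1 / eta) + 2 * ((1 + 4 * S) / eta) by field; rewrite gt_eqF.
by move: h1 h2 info_le; lra.
Qed.

Lemma quadratic_close :
  `|quadratic_logLR S T u (X ^~ w) - local_logLR S psi T u (X ^~ w)| <=
  eps * (2 * C / (c * eta) + C ^+ 2 / c ^+ 2 * ((4 + 8 * S) / eta)).
Proof.
apply: (le_trans (@logLR_expansion _ T S (X ^~ w) T_gt0 S_gt0 (cX w) psi eps dl u psi_gt0 psi0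
  c_gt0 (ltW eps_gt0) dl_gt0 u_ge0 ln_lip ln_rem _ _)).
- by move=> t tT; apply/theta_small/(left_limit_sup S_gt0 (cX w) x_sup tT).
- by move=> t /andP[t0 tT]; apply/theta_small/x_sup; rewrite (ltW t0).
rewrite ler_pM2l// -/c -/theta; apply: lerD.
  apply: (@le_trans _ _ (theta * (2 * (S * T) / eta))); first by rewrite ler_wpM2l.
  have -> : theta * (2 * (S * T) / eta) = 2 * u / (c * eta).
    by rewrite /theta; field; rewrite !gt_eqF.
  by rewrite ler_pM2r ?invr_gt0 ?mulr_gt0// ler_pM2l.
have -> : theta ^+ 2 * S * \int[lebesgue_measure]_(t in `]0, T]) (S * t - (X t w)%:R) ^+ 2 =
   u ^+ 2 / c ^+ 2 * J.
  rewrite /J info_statE// /theta; move: (\int[_]_(_ in _) _) => I.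
  by field; rewrite !gt_eqF.
have u2 : u ^+ 2 <= C ^+ 2 by rewrite lerXn2r ?nnegrE.
apply: (@le_trans _ _ (u ^+ 2 / c ^+ 2 * ((4 + 8 * S) / eta))).
  by rewrite ler_wpM2l// divr_ge0// sqr_ge0.
rewrite ler_wpM2r//; last by rewrite ler_pM2r// invr_gt0 exprn_gt0.
by rewrite divr_ge0 ?addr_ge0 ?mulr_ge0// ltW.
Qed.

(** The score contributes [M T / (S T)], which is negligible, and the information is
    replaced by its Riemann sum. *)
Lemma expansion_close :
  `|quadratic_logLR S T u (X ^~ w) - expansion u w| <=
  C / 2 * (lam + 2 / (lam * eta * S) / T) +
  C ^+ 2 / 2 * (lam / eta + (1 + lam^-1) * ((1 + 4 * S) / eta) / T).
Proof.
have nE : N%:R^-1 * (\sum_(i < N) normalized i w ^+ 2) = info_grid w.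
  rewrite (eq_bigr (fun i : 'I_N => (S * T)^-1 * M (grid T N i) w ^+ 2)); last first.
    by move=> i _; rewrite normalized_sq mulrC.
  by rewrite -mulr_sumr /info_grid [(S * T * _)^-1]invfM mulrA [N%:R^-1 * _]mulrC.
have gN : grid T N N = T by rewrite /grid mulrC divfK// gt_eqF.
have -> : quadratic_logLR S T u (X ^~ w) - expansion u w =
   u / 2 * (M T w / (S * T)) - u ^+ 2 / 2 * (J - info_grid w).
  rewrite /quadratic_logLR /expansion nE normalized_sq gN score_statE// -/J.
  have -> : (X T w)%:R = M T w + S * T by rewrite /compensated /counting subrK.
  by rewrite addrK; field; rewrite !gt_eqF.
rewrite (le_trans (ler_normB _ _))// lerD//.
  rewrite normrM ger0_norm ?divr_ge0//; apply: ler_pM => //; first by rewrite divr_ge0.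
    by rewrite ler_pM2r.
  apply: (le_trans (small_of_sq _ lam_gt0)); rewrite lerD2l.
  have h : M T w ^+ 2 <= 2 * (S * T) / eta by rewrite (le_trans _ end_le)// lerDl ler0n.
  have -> : (M T w / (S * T)) ^+ 2 / lam = M T w ^+ 2 * ((S * T) ^+ 2 * lam)^-1.
    by field; rewrite !gt_eqF.
  have -> : 2 / (lam * eta * S) / T = 2 * (S * T) / eta * ((S * T) ^+ 2 * lam)^-1.
    by field; rewrite !gt_eqF.
  by rewrite ler_pM2r// invr_gt0 mulr_gt0// exprn_gt0.
rewrite normrM ger0_norm ?divr_ge0 ?sqr_ge0//; apply: ler_pM => //; first by rewrite divr_ge0 ?sqr_ge0.
  by rewrite ler_pM2r// lerXn2r ?nnegrE.
apply: (le_trans (@info_riemann _ T S (X ^~ w) N T_gt0 S_gt0 (cX w) isT lam lam_gt0)).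
apply: lerD; first by rewrite ler_pM2l//; move: info_le; rewrite div1r.
rewrite -[leRHS]mulrA ler_wpM2l ?addr_ge0 ?invr_ge0 ?(ltW lam_gt0)//.
by apply: (le_trans osc_le); rewrite mulrAC.
Qed.

End deterministic.

End one_horizon.

(** * The quadratic approximation in probability *)

Lemma near_div_le (R : realType) (b e : R) : 0 < e -> \forall T \near +oo, b / T <= e.
Proof.
move=> e0; near=> T.
have T0 : 0 < T by near: T; exact: nbhs_pinfty_gt.
rewrite ler_pdivrMr// mulrC -ler_pdivrMr//; near: T; exact: nbhs_pinfty_ge.
Unshelve. all: by end_near. Qed.

Lemma small_multiple (R : realType) (A e : R) : 0 <= A -> 0 < e ->
  exists2 r : R, 0 < r & A * r <= e.
Proof.
move=> A0 e0; have A1 : 0 < A + 1 by rewrite ltr_wpDl.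
exists (e / (A + 1)); first by rewrite divr_gt0.
by rewrite mulrA ler_pdivrMr// mulrC ler_wpM2l ?lerDl// ltW.
Qed.

Lemma cvge0_le (R : realType) (T : Type) (F : set_system T) (FF : Filter F)
    (f : T -> \bar R) :
  (forall x, (0 <= f x)%E) ->
  (forall e : R, 0 < e -> \forall x \near F, (f x <= e%:E)%E) -> f @ F --> 0%E.
Proof.
move=> f0 fe; apply: cvg_EFin.
  apply: filterS (fe _ ltr01) => x fx; rewrite ge0_fin_numE//.
  exact: le_lt_trans fx (ltry _).
apply/cvgrPdist_le => e e0; apply: filterS (fe _ e0) => x fx.
have fin : f x \is a fin_num by rewrite ge0_fin_numE//; exact: le_lt_trans fx (ltry _).
by rewrite /= sub0r normrN ger0_norm ?fine_ge0// -lee_fin fineK.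
Qed.

Section family.
Context (R : realType) (S : R) (psi : R -> R).
Hypotheses (S_gt0 : 0 < S) (psi_gt0 : forall x, 0 < psi x)
  (psi_C1 : continuously_differentiable_at psi 0) (psi0 : psi 0 = 1)
  (dpsi0 : 0 < (psi^`())%classic 0).
Unset Implicit Arguments.
Context (d : measure_display) (Omega : R -> measurableType d)
  (P : forall T : R, probability (Omega T) R) (X : forall T : R, R -> Omega T -> nat).
Hypothesis X_poisson : forall T : R, 0 < T -> poisson_process (P T) S T (X T).

Set Implicit Arguments.

(** The constants are chosen in the order: probability of the exceptional event, Lipschitz
    constant [eps], radius [dl], number [K] of cells of the coarse grid, then [T]. *)
Lemma logLR_event (u : R -> R) (C : R) (e : R) : 0 < e ->
  (\forall T \near +oo, 0 <= u T <= C) ->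
  \forall T \near +oo, exists E, [/\ measurable E, (P T E <= e%:E)%E & forall w, ~ E w ->
    `|quadratic_logLR S T (u T) (X T ^~ w) - local_logLR S psi T (u T) (X T ^~ w)| <= e /\
    `|local_logLR S psi T (u T) (X T ^~ w) - expansion S T (X T) (u T) w| <= e].
Proof.
move=> e0 uC; have C0 : 0 <= C.
  near (pinfty_nbhs R) => T.
  have /andP[uT0 uTC] : 0 <= u T <= C by near: T.
  exact: le_trans uTC.
pose c := (psi^`())%classic 0; have c0 : 0 < c by [].
pose eta := e / 4; have eta0 : 0 < eta by rewrite divr_gt0.
have e2 : 0 < e / 2 by rewrite divr_gt0.
have e8 : 0 < e / 8 by rewrite divr_gt0.
have SC0 : 0 <= C / (S * c) by rewrite divr_ge0// mulr_ge0// ltW.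
have [|eps eps0 epsA] := @small_multiple _
  (2 * C / (c * eta) + C ^+ 2 / c ^+ 2 * ((4 + 8 * S) / eta)) (e / 2) _ e2.
  by rewrite addr_ge0 ?mulr_ge0 ?invr_ge0 ?addr_ge0 ?mulr_ge0 ?sqr_ge0// ltW.
have [dl [dl0 mod1 mod2]] := psi_modulus psi_gt0 psi_C1 psi0 dpsi0 eps0.
have dl4 : 0 < dl / 4 by rewrite divr_gt0.
have dl2 : 0 < dl / 2 by rewrite divr_gt0.
have [kap kap0 kapA] := small_multiple SC0 dl4.
pose K := (Num.truncn (C / (S * c) * S / (dl / 4))).+1.
have KA : C / (S * c) * S / K%:R <= dl / 4.
  rewrite ler_pdivrMr// [leRHS]mulrC -ler_pdivrMr// ltW//.
  have h : 0 <= C / (S * c) * S / (dl / 4).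
    by apply: divr_ge0; [apply: mulr_ge0 => //; exact: ltW|exact: ltW].
  by case/andP: (Num.Theory.truncn_itv h).
have [|lam lam0 lamA] := @small_multiple _ (C / 2 + C ^+ 2 / 2 / eta) (e / 4) _ eta0.
  by rewrite addr_ge0 ?divr_ge0 ?sqr_ge0// ltW.
near=> T.
have T1 : 1 <= T by near: T; exact: nbhs_pinfty_ge.
have T0 : 0 < T by exact: lt_le_trans T1.
have /andP[u0 uTC] : 0 <= u T <= C by near: T.
have [E [mE pE hE]] := good_event S_gt0 T1 (X_poisson T T0) eta0 (isT : (0 < K)%N).
exists E; split => //; first by rewrite (le_trans pE)// lee_fin /eta mulrC divfK.
move=> w /hE[h1 h2 h3 h4].
have range : C / (S * c) * (kap + K.+1%:R * S / (eta * kap) / T + S / K%:R) <= dl.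
  have : C / (S * c) * (K.+1%:R * S / (eta * kap)) / T <= dl / 2 by near: T; exact: near_div_le.
  have -> : C / (S * c) * (kap + K.+1%:R * S / (eta * kap) / T + S / K%:R) =
    C / (S * c) * kap + C / (S * c) * (K.+1%:R * S / (eta * kap)) / T + C / (S * c) * S / K%:R by ring.
  by move: kapA KA; lra.
have q1 := quadratic_close S_gt0 T1 (X_poisson T T0) psi_gt0 psi0 dpsi0 eps0 dl0 eta0 kap0 u0 uTC
  (isT : (0 < K)%N) mod1 mod2 h1 h2 h3 h4 range.
have q2 := expansion_close S_gt0 T1 (X_poisson T T0) eta0 lam0 u0 uTC h1 h2 h3.
have q1' : `|quadratic_logLR S T (u T) (X T ^~ w) - local_logLR S psi T (u T) (X T ^~ w)| <= e / 2.
  by apply: (le_trans q1); rewrite mulrC.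
have q2' : `|quadratic_logLR S T (u T) (X T ^~ w) - expansion S T (X T) (u T) w| <= e / 2.
  apply: (le_trans q2).
  have : (C / 2 * (2 / (lam * eta * S)) + C ^+ 2 / 2 * ((1 + lam^-1) * ((1 + 4 * S) / eta))) / T <= e / 4.
    by near: T; apply: near_div_le; rewrite divr_gt0.
  have -> : C / 2 * (lam + 2 / (lam * eta * S) / T) +
     C ^+ 2 / 2 * (lam / eta + (1 + lam^-1) * ((1 + 4 * S) / eta) / T) =
     (C / 2 + C ^+ 2 / 2 / eta) * lam +
     (C / 2 * (2 / (lam * eta * S)) + C ^+ 2 / 2 * ((1 + lam^-1) * ((1 + 4 * S) / eta))) / T by ring.
  by move: lamA; lra.
split; first by rewrite (le_trans q1')// ler_pdivrMr// ler_peMr ?ler1n// ltW.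
move: q1' q2'; move: (quadratic_logLR _ _ _ _) (local_logLR _ _ _ _ _) (expansion _ _ _ _ _) => a b f.
by rewrite !ler_norml => /andP[? ?] /andP[? ?]; apply/andP; split; lra.
Unshelve. all: by end_near. Qed.

(** The outer measure is monotone, and the deviation set is contained in the measurable
    exceptional event. *)
Lemma quadratic_approximation (u : R -> R) :
  (\forall T \near +oo, local_param_set S T (u T)) ->
  (exists C : R, \forall T \near +oo, `|u T| <= C) ->
  cvg0_in_probability P
    (fun T w => quadratic_logLR S T (u T) (X T ^~ w) - local_logLR S psi T (u T) (X T ^~ w)).
Proof.
move=> uU [C uC] e e0.
have uC' : \forall T \near +oo, 0 <= u T <= C.
  near=> T; have /andP[u0 _] : local_param_set S T (u T) by near: T.
  by rewrite u0 (le_trans (ler_norm _))//; near: T.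
apply: cvge0_le => [T|a a0]; first exact: mu_ext_ge0.
have m0 : 0 < Num.min e a by rewrite lt_min e0.
have := logLR_event m0 uC'; apply: filterS => T [E [mE pE hE]].
apply: (@le_trans _ _ (((P T) ^*)%mu E)).
  apply: le_mu_ext => w /= ew; apply: contrapT => /hE[h _].
  by move: ew; rewrite ltNge; rewrite (le_trans h)// ge_min lexx.
rewrite measurable_mu_extE// (le_trans pE)// lee_fin ge_min lexx orbT//.
Unshelve. all: by end_near. Qed.

End family.

(** * Polynomial approximation on the unit interval *)

Section bernstein.
Context (R : realType).

(** The expectation of [h] under the binomial law with [n] trials, as a polynomial
    in the success probability; conditioning on the first trial gives the
    recursion and spares the binomial coefficients. *)
Fixpoint bernstein (n : nat) (h : nat -> R) : {poly R} :=
  if n is m.+1 then (1 - 'X) * bernstein m h + 'X * bernstein m (fun k => h k.+1)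
  else (h 0%N)%:P.

Lemma bernsteinE n h v : (bernstein n.+1 h).[v] =
  (1 - v) * (bernstein n h).[v] + v * (bernstein n (fun k => h k.+1)).[v].
Proof. by rewrite /= hornerD !hornerM !hornerE. Qed.

Lemma bernstein_le n h1 h2 v : 0 <= v <= 1 ->
  (forall k, h1 k <= h2 k) -> (bernstein n h1).[v] <= (bernstein n h2).[v].
Proof.
move=> /andP[v0 v1]; elim: n h1 h2 => [|n IH] h1 h2 h; first by rewrite /= !hornerC.
by rewrite !bernsteinE lerD// ler_wpM2l ?subr_ge0 ?IH// => k; exact: h.
Qed.

Lemma bernstein_affine n a b h v :
  (bernstein n (fun k => a + b * h k)).[v] = a + b * (bernstein n h).[v].
Proof.
elim: n h => [|n IH] h; first by rewrite /= !hornerC.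
by rewrite !bernsteinE IH (IH (fun k => h k.+1)); ring.
Qed.

(** The second moment about [c] of a binomial variable, by induction on the number of
    trials for all [c] at once. *)
Lemma bernstein_var n c v :
  (bernstein n (fun k => (k%:R - c) ^+ 2)).[v] = n%:R * v * (1 - v) + (n%:R * v - c) ^+ 2.
Proof.
elim: n c => [|n IH] c; first by rewrite /= hornerC; ring.
rewrite bernsteinE IH.
have -> : (fun k => (k.+1%:R - c) ^+ 2) = (fun k => (k%:R - (c - 1)) ^+ 2).
  by apply/funext => k; rewrite -natr1; congr (_ ^+ 2); ring.
by rewrite IH -natr1; ring.
Qed.

(** Compactness of the unit interval. *)
Lemma uniform_modulus (g : R -> R) (e : R) : continuous g -> 0 < e ->
  exists2 dl : R, 0 < dl & forall v y, 0 <= v <= 1 -> `|v - y| < dl -> `|g v - g y| <= e.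
Proof.
move=> cg e0.
have : \forall dl \near (0 : R)^'+, `[0, 1] `<=` (fun v => forall y, `|v - y| < dl -> `|g v - g y| <= e).
  apply: (compact_near_coveringP _).1; first exact: segment_compact.
  move=> v _.
  have e2 : 0 < e / 2 by rewrite divr_gt0.
  have : \forall y \near v, `|g v - g y| <= e / 2 by move: (cg v) => /cvgrPdist_le /(_ _ e2).
  move=> /nbhs_ballP[r /= r0 h].
  have r2 : 0 < r / 2 by rewrite divr_gt0.
  exists (ball v (r / 2), [set dl | dl < r / 2]).
    by split; [exact: nbhsx_ballx|exact: nbhs_right_lt].
  move=> [w dl] [/= vw dr] y wy.
  have h1 := h w (_ : `|v - w| < r); have h2 := h y (_ : `|v - y| < r).
  have -> : g w - g y = (g v - g y) - (g v - g w) by ring.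
  rewrite (le_trans (ler_normB _ _))// (_ : e = e / 2 + e / 2); last by field.
  apply: lerD.
    apply: h2; rewrite (_ : v - y = (v - w) + (w - y)); last by ring.
    rewrite (le_lt_trans (ler_normD _ _))// (_ : r = r / 2 + r / 2); last by field.
    by rewrite ltrD// (lt_trans wy).
  by apply: h1; apply: lt_trans vw _; rewrite ltr_pdivrMr// ltr_pMr// ltr1n.
move=> near0; near (0 : R)^'+ => dl; exists dl; first by near: dl; exact: nbhs_right_gt.
have sub : `[0, 1] `<=` (fun v => forall y, `|v - y| < dl -> `|g v - g y| <= e) by near: dl.
by move=> v y v01; apply: sub; rewrite /= in_itv.
Unshelve. all: by end_near. Qed.

(** Chebyshev's argument: where [k / n] is within [dl] of [v] the oscillation of [g] is
    small, elsewhere it is at most [2 B (k / n - v)^2 / dl^2]. *)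
Lemma bernstein_approx (g : R -> R) (B e : R) : continuous g -> (forall x, `|g x| <= B) -> 0 < e ->
  exists p : {poly R}, forall v, 0 <= v <= 1 -> `|g v - p.[v]| <= e.
Proof.
move=> cg gB e0; have e2 : 0 < e / 2 by rewrite divr_gt0.
have B0 : 0 <= B by exact: le_trans (gB 0).
have [dl dl0 dlP] := uniform_modulus cg e2.
pose c := 2 * B / dl ^+ 2; have c0 : 0 <= c by apply: divr_ge0; [exact: mulr_ge0|exact: sqr_ge0].
pose n := (Num.truncn (c / (e / 2))).+1.
have n0 : 0 < n%:R :> R by rewrite ltr0n.
have cn : c / n%:R <= e / 2.
  rewrite ler_pdivrMr// [leRHS]mulrC -ler_pdivrMr// ltW//.
  have h : 0 <= c / (e / 2) by apply: divr_ge0 => //; exact: ltW.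
  by case/andP: (Num.Theory.truncn_itv h).
pose h k := g (k%:R / n%:R).
exists (bernstein n h) => v v01.
have pt k : `|h k - g v| <= e / 2 + c / n%:R ^+ 2 * (k%:R - n%:R * v) ^+ 2.
  have q0 : 0 <= c / n%:R ^+ 2 * (k%:R - n%:R * v) ^+ 2.
    by rewrite mulr_ge0 ?sqr_ge0// divr_ge0// sqr_ge0.
  have [far|near] := leP dl `|v - k%:R / n%:R|; last first.
    by rewrite distrC; apply: (le_trans (dlP _ _ v01 near)); rewrite lerDl.
  apply: (@le_trans _ _ (2 * B)).
    apply: (le_trans (ler_normB _ _)); have := gB v; have := gB (k%:R / n%:R).
    by rewrite /h; lra.
  apply: (@le_trans _ _ (c / n%:R ^+ 2 * (k%:R - n%:R * v) ^+ 2)); last by rewrite lerDr ltW.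
  have -> : c / n%:R ^+ 2 * (k%:R - n%:R * v) ^+ 2 = c * `|v - k%:R / n%:R| ^+ 2.
    by rewrite real_normK ?num_real//; field; rewrite gt_eqF.
  rewrite /c -mulrA ler_peMr ?mulr_ge0// mulrC ler_pdivlMr ?exprn_gt0// mul1r.
  by rewrite lerXn2r ?nnegrE// ltW.
have vv : v * (1 - v) <= 1 by case/andP: v01 => ? ?; nra.
have U : (bernstein n (fun k => e / 2 + c / n%:R ^+ 2 * (k%:R - n%:R * v) ^+ 2)).[v] <= e.
  rewrite bernstein_affine bernstein_var subrr expr0n addr0.
  have -> : c / n%:R ^+ 2 * (n%:R * v * (1 - v)) = c / n%:R * (v * (1 - v)) by field; rewrite gt_eqF.
  have : c / n%:R * (v * (1 - v)) <= c / n%:R by rewrite ler_piMr// divr_ge0// ltW.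
  by move: cn; lra.
have up : g v - (bernstein n h).[v] <= e.
  rewrite -mulN1r -bernstein_affine; apply: le_trans U; apply: bernstein_le => // k.
  by rewrite mulN1r (le_trans _ (pt k))// distrC ler_norm.
have lo : (bernstein n h).[v] - g v <= e.
  rewrite addrC -[X in _ + X]mul1r -bernstein_affine.
  apply: le_trans U; apply: bernstein_le => // k.
  by rewrite mul1r addrC (le_trans _ (pt k))// ler_norm.
by rewrite ler_norml lerNl opprB lo up.
Qed.

End bernstein.

(** * Convergence of expectations *)

(** The integral of a nonnegative function is a supremum over the simple functions
    below it, so it is monotone whether or not the functions are measurable. *)
Lemma le_integral_pointwise (R : realType) d (T : measurableType d)
    (mu : {measure set T -> \bar R}) (f g : T -> \bar R) :
  (forall x, (f x <= g x)%E) -> (\int[mu]_x f x <= \int[mu]_x g x)%E.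
Proof.
move=> fg; rewrite /integral !patch_setT; apply: leeB; apply: ereal_sup_le => _ [h /= hle <-];
  exists h => //= x; apply: (le_trans (hle x)).
- by apply: (@funepos_le _ _ setT) => [y _|]; [exact: fg|rewrite inE].
- by apply: (@funeneg_le _ _ setT) => [y _|]; [exact: fg|rewrite inE].
Qed.

Section sandwich.
Context (R : realType) d (Omega : measurableType d) (P : probability Omega R).

(** [phi] lies between [h - s] and [h + s], with [s] equal to [e] up to [2 B] on the
    exceptional event. *)
Lemma expectation_close (phi h : Omega -> R) (B e : R) (E : set Omega) :
  0 <= B -> 0 <= e -> measurable_fun setT h -> (forall w, `|phi w| <= B) -> (forall w, `|h w| <= B) ->
  measurable E -> (P E <= e%:E)%E -> (forall w, ~ E w -> `|phi w - h w| <= e) ->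
  ((\int[P]_w h w - (e + 2 * B * e))%R%:E <= \int[P]_w (phi w)%:E <=
   (\int[P]_w h w + (e + 2 * B * e))%R%:E)%E.
Proof.
move=> B0 e0 mh phiB hB mE PE close.
pose s w : R := e + 2 * B * \1_E w.
have ih := integrable_bounded P mh hB.
have i1 : P.-integrable setT (EFin \o (\1_E : Omega -> R)).
  apply: (@integrable_bounded _ _ _ P _ 1) => // w.
  by rewrite indicE; case: (_ \in _); rewrite ?normr1 ?normr0.
have is_ : P.-integrable setT (EFin \o s).
  apply: integrable_add; first exact: finite_measure_integrable_cst.
  exact: integrable_scale.
have Es : \int[P]_w s w <= e + 2 * B * e.
  rewrite RintegralD//; [|exact: finite_measure_integrable_cst|exact: integrable_scale].
  rewrite Rintegral_prob_cst RintegralZl// lerD2l ler_wpM2l ?mulr_ge0//.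
  rewrite /Rintegral integral_indic// setIT -lee_fin fineK//.
  exact: fin_num_measure.
have bnd w : h w - s w <= phi w <= h w + s w.
  suff : `|phi w - h w| <= s w by rewrite ler_norml => /andP[? ?]; apply/andP; split; lra.
  rewrite /s indicE; have [wE|wE] := boolP (w \in E).
    rewrite mulr1; apply: (le_trans (ler_normB _ _)).
    by have := phiB w; have := hB w; lra.
  by rewrite mulr0 addr0 close// -notin_setE.
have I (k : Omega -> R) : P.-integrable setT (EFin \o k) ->
   (\int[P]_w (k w)%:E = (\int[P]_w k w)%R%:E)%E.
  by move=> ik; rewrite /Rintegral fineK//; exact: integrable_fin_num.
apply/andP; split.
  apply: (@le_trans _ _ (\int[P]_w (h w - s w)%R%:E)%E).
    rewrite I; last exact: integrable_sub.
    by rewrite lee_fin RintegralB// lerD2l lerN2.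
  by apply: le_integral_pointwise => w; rewrite lee_fin; case/andP: (bnd w).
apply: (@le_trans _ _ (\int[P]_w (h w + s w)%R%:E)%E).
  by apply: le_integral_pointwise => w; rewrite lee_fin; case/andP: (bnd w).
rewrite I; last exact: integrable_add.
by rewrite lee_fin RintegralD// lerD2l.
Qed.

End sandwich.

Section families.
Unset Implicit Arguments.
Context (R : realType) (d : measure_display) (Omega : R -> measurableType d)
  (P : forall T : R, probability (Omega T) R).
Set Implicit Arguments.

Lemma expectation_cvg (phi h : forall T, Omega T -> R) (B l : R) :
  0 <= B -> (forall T w, `|phi T w| <= B) ->
  (\forall T \near +oo, measurable_fun setT (h T) /\ forall w, `|h T w| <= B) ->
  (forall e : R, 0 < e -> \forall T \near +oo, exists E,
    [/\ measurable E, (P T E <= e%:E)%E & forall w, ~ E w -> `|phi T w - h T w| <= e]) ->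
  \int[P T]_w h T w @[T --> +oo] --> l ->
  ('E_(P T)[phi T])%E @[T --> +oo] --> l%:E.
Proof.
move=> B0 phiB hB close lim.
have key (e : R) : 0 < e -> \forall T \near +oo,
    ((l - e)%:E <= 'E_(P T)[phi T] <= (l + e)%:E)%E.
  move=> e0; have D : 0 < 2 + 2 * B by lra.
  pose a := e / (2 + 2 * B); have a0 : 0 < a by rewrite divr_gt0.
  have aE : a + 2 * B * a + a = e by rewrite /a; field; rewrite gt_eqF.
  near=> T.
  have [mh hT] : measurable_fun setT (h T) /\ forall w, `|h T w| <= B by near: T.
  have [E [mE PE cl]] : exists E,
    [/\ measurable E, (P T E <= a%:E)%E & forall w, ~ E w -> `|phi T w - h T w| <= a].
    by near: T; exact: close.
  have /andP[h1 h2] := expectation_close B0 (ltW a0) mh (phiB T) hT mE PE cl.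
  have : `|l - \int[P T]_w h T w| <= a by near: T; move/cvgrPdist_le : lim => /(_ _ a0).
  rewrite ler_norml unlock => /andP[h3 h4].
  apply/andP; split; [apply: le_trans h1|apply: (le_trans h2)]; rewrite lee_fin; lra.
apply: cvg_EFin.
  apply: filterS (key _ ltr01) => T /andP[h1 h2].
  by rewrite fin_numElt (lt_le_trans _ h1) ?ltNyr// (le_lt_trans h2) ?ltry.
apply/cvgrPdist_le => e e0; apply: filterS (key _ e0) => T /andP[h1 h2].
have fin : 'E_(P T)[phi T]%E \is a fin_num.
  by rewrite fin_numElt (lt_le_trans _ h1) ?ltNyr// (le_lt_trans h2) ?ltry.
move: h1 h2; rewrite -(fineK fin) !lee_fin /= => h1 h2.
by rewrite ler_norml; apply/andP; split; lra.
Unshelve. all: by end_near. Qed.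

Context (d' : measure_display) (Omega' : measurableType d') (P' : probability Omega' R).

(** On the unit interval the moments determine the law, by density of the
    polynomials. *)
Lemma moments_cvg (V : forall T, Omega T -> R) (V' : Omega' -> R) (g : R -> R) (B : R) :
  (\forall T \near +oo, measurable_fun setT (V T) /\ forall w, 0 <= V T w <= 1) ->
  measurable_fun setT V' -> (forall w, 0 <= V' w <= 1) ->
  (forall k, \int[P T]_w (V T w ^+ k) @[T --> +oo] --> \int[P']_w (V' w ^+ k)) ->
  continuous g -> (forall x, `|g x| <= B) ->
  \int[P T]_w g (V T w) @[T --> +oo] --> \int[P']_w g (V' w).
Proof.
move=> hV mV' V'01 mom cg gB.
have pow d1 (O : measurableType d1) (Q : probability O R) (U : O -> R) :
    measurable_fun setT U -> (forall w, 0 <= U w <= 1) -> forall p : {poly R},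
    Q.-integrable setT (EFin \o (fun w => p.[U w])) /\
    \int[Q]_w p.[U w] = \sum_(i < size p) p`_i * \int[Q]_w (U w ^+ i).
  move=> mU U01 p.
  have iU i : Q.-integrable setT (EFin \o (fun w => U w ^+ i)).
    apply: (@integrable_bounded _ _ _ Q _ 1); first exact: measurable_funX.
    by move=> w; have /andP[u0 u1] := U01 w; rewrite ger0_norm ?exprn_ge0// exprn_ile1.
  have E : (fun w => p.[U w]) = fun w => \sum_(i < size p) p`_i * U w ^+ i.
    by apply/funext => w; rewrite horner_coef.
  rewrite E; split; first by apply: integrable_bigsum => // i _; exact: integrable_scale.
  rewrite Rintegral_bigsum//; last by move=> i _; exact: integrable_scale.
  by apply: eq_bigr => i _; rewrite RintegralZl.
have app d1 (O : measurableType d1) (Q : probability O R) (U : O -> R) (p : {poly R}) (a : R) :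
    measurable_fun setT U -> (forall w, 0 <= U w <= 1) ->
    (forall v, 0 <= v <= 1 -> `|g v - p.[v]| <= a) ->
    `|\int[Q]_w g (U w) - \int[Q]_w p.[U w]| <= a.
  move=> mU U01 pa; have [ip _] := pow _ _ Q U mU U01 p.
  have mg : measurable_fun setT (fun w => g (U w)).
    by apply: (measurableT_comp (f := g)) => //; exact: continuous_measurable_fun.
  have ig := integrable_bounded Q mg (fun w => gB (U w)).
  rewrite -RintegralB//.
  apply: Rintegral_bounded; last by move=> w; exact: pa.
  by apply: measurable_funB => //; exact: measurable_integrable ip.
apply/cvgrPdist_le => e e0; have e3 : 0 < e / 3 by rewrite divr_gt0.
have [p pe] := bernstein_approx cg gB e3.
have lim : \sum_(i < size p) p`_i * \int[P T]_w (V T w ^+ i) @[T --> +oo] -->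
   \sum_(i < size p) p`_i * \int[P']_w (V' w ^+ i).
  elim: (index_enum _) => [|i r IH].
    by under eq_cvg do rewrite big_nil; rewrite big_nil; exact: cvg_cst.
  under eq_cvg do rewrite big_cons; rewrite big_cons; apply: cvgD => //.
  by apply: cvgM; [exact: cvg_cst|exact: mom].
near=> T.
have [mV V01] : measurable_fun setT (V T) /\ forall w, 0 <= V T w <= 1 by near: T.
have h1 := app _ _ (P T) _ _ _ mV V01 pe.
have h2 := app _ _ P' _ _ _ mV' V'01 pe.
have h3 : `|\sum_(i < size p) p`_i * \int[P']_w (V' w ^+ i) -
   \sum_(i < size p) p`_i * \int[P T]_w (V T w ^+ i)| <= e / 3.
  by near: T; move/cvgrPdist_le : lim => /(_ _ e3).
have [_ E1] := pow _ _ (P T) _ mV V01 p; have [_ E2] := pow _ _ P' _ mV' V'01 p.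
rewrite -E1 -E2 in h3; move: h1 h2 h3.
set A := \int[P']_w g _; set A' := \int[P']_w p.[_].
set D := \int[P T]_w g _; set D' := \int[P T]_w p.[_].
move: A A' D D' => A A' D D'; rewrite !ler_norml => /andP[? ?] /andP[? ?] /andP[? ?].
by apply/andP; split; lra.
Unshelve. all: by end_near. Qed.

End families.

(** * Riemann sums of the squared Wiener process *)

Lemma bounded_convergence (R : realType) d (Omega : measurableType d) (P : probability Omega R)
    (h : nat -> Omega -> R) (l : Omega -> R) (B : R) :
  (forall n, measurable_fun setT (h n)) -> (forall n w, `|h n w| <= B) ->
  (forall w, h n w @[n --> \oo] --> l w) ->
  \int[P]_w h n w @[n --> \oo] --> \int[P]_w l w.
Proof.
move=> mh hB hl.
have ml : measurable_fun setT l by apply: (measurable_fun_cvg mh) => w _; exact: hl.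
have lB w : `|l w| <= B.
  have cl : `|h n w| @[n --> \oo] --> `|l w| by apply: cvg_norm; exact: hl.
  rewrite -(cvg_lim _ cl)//; apply: limr_le; first by apply/cvg_ex; exists `|l w|.
  by apply: nearW => n; exact: hB.
have il := integrable_bounded P ml lB.
have iB : P.-integrable setT (EFin \o (fun=> B)) by exact: finite_measure_integrable_cst.
rewrite /Rintegral; apply: fine_cvg; rewrite fineK; last exact: integrable_fin_num.
apply: (@dominated_cvg _ _ _ P setT measurableT (fun n => EFin \o h n) (EFin \o l) (EFin \o (fun=> B))) => //.
- by move=> n; exact/measurable_EFinP.
- by move=> w _; apply: cvg_EFin; [exact: nearW|exact: hl].
- by move=> n w _; rewrite lee_fin.
Qed.

Section riemann_sums.
Context (R : realType).
Notation mu := (@lebesgue_measure R).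
Variable x : R -> R.
Hypothesis cx : {within `[0, 1], continuous x}.

(** The [0 -] matches the form in which the convergence of sampled paths is stated. *)
Lemma sampled_square_integral n :
  (\int[mu]_(s in `]0%R, 1%R]) ((0 - sampled x n.+1 s) ^+ 2)%:E =
   (n.+1%:R^-1 * \sum_(i < n.+1) x (i%:R / n.+1%:R) ^+ 2)%R%:E)%E.
Proof.
have nR : 0 < n.+1%:R :> R by [].
have [B B0 xB] := path_bounded cx.
pose F s := (0 - sampled x n.+1 s) ^+ 2.
have iF : mu.-integrable [set` `]0%R, 1%R]] (EFin \o F).
  apply: (@bounded_integrable_itv _ 1 ltr01 F (B ^+ 2)).
    by apply: measurable_funX; apply: measurable_funB => //; exact: measurable_sampled.
  move=> s s01; rewrite /F normrX sub0r normrN.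
  by apply: lerXn2r; rewrite ?nnegrE//; exact: (@sampled_bound _ x B n s B0 xB s01).
rewrite -[LHS]fineK; last by apply: integrable_fin_num.
congr (_%:E); rewrite -[LHS]/(\int[mu]_(s in `]0, 1]) F s).
pose p (i : nat) : R := i%:R / n.+1%:R.
have pS i : p i.+1 - p i = n.+1%:R^-1 by rewrite /p -[i.+1%:R]natr1; ring.
have ple i : p i <= p i.+1 by rewrite -subr_ge0 pS invr_ge0.
have p0 : p 0%N = 0 by rewrite /p mul0r.
have p1 : p n.+1 = 1 by rewrite /p divff// gt_eqF.
have := @Rintegral_cells _ F p n.+1 (fun i _ => ple i); rewrite p0 p1 => ->//.
rewrite mulr_sumr; apply: eq_bigr => i _.
rewrite (@eq_Rintegral _ _ _ mu _ (fun=> x (p i) ^+ 2)); last first.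
  move=> s; rewrite inE/= in_itv/= => si.
  by rewrite /F (sampledE x si) sub0r sqrrN.
have mui : fine (mu [set` `]p i, p i.+1]%R]) = n.+1%:R^-1.
  rewrite -[mu _]/(@lebesgue_measure R [set` `]p i, p i.+1]%R]) lebesgue_measure_itv/=.
  by rewrite lte_fin -subr_gt0 pS invr_gt0 nR -EFinB pS.
by rewrite Rintegral_cst// mui mulrC.
Qed.

Lemma square_riemann_cvg :
  n.+1%:R^-1 * (\sum_(i < n.+1) x (i%:R / n.+1%:R) ^+ 2) @[n --> \oo] -->
  \int[mu]_(s in `[0, 1]) x s ^+ 2.
Proof.
have h := @sampled_sqdist_cvg _ x cx (fun=> 0) 0 (measurable_cst _)
  (fun=> eq_ind_r (fun y => y <= 0) (lexx _) (normr0 _)).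
have [B B0 xB] := path_bounded cx.
have ix : mu.-integrable [set` `]0%R, 1%R]] (EFin \o (fun s => x s ^+ 2)).
  apply: (@bounded_integrable_itv _ 1 ltr01 _ (B ^+ 2)).
    apply: measurable_funX; apply: measurable_funS (measurable_path cx) => //.
    by apply: subset_itvr; rewrite bnd_simp.
  move=> s /andP[s0 s1]; rewrite normrX; apply: lerXn2r; rewrite ?nnegrE//.
  by apply: xB; rewrite (ltW s0).
have E : (\int[mu]_(s in `]0%R, 1%R]) ((0 - x s) ^+ 2)%:E =
    (\int[mu]_(s in `[0%R, 1%R]) x s ^+ 2)%R%:E)%E.
  rewrite -Rintegral_itv_obnd_cbnd// /Rintegral fineK; last by apply: integrable_fin_num.
  by apply: eq_integral => s _; rewrite sub0r sqrrN.
rewrite E in h; move: h; under eq_fun do rewrite sampled_square_integral.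
by move=> /fine_cvgP[].
Qed.

End riemann_sums.

Lemma div_sqrt_le (R : realType) (C e x : R) : 0 < e -> (`|C| / e) ^+ 2 < x ->
  C / Num.sqrt x <= e.
Proof.
move=> e0 h; have x0 : 0 < x by exact: le_lt_trans (sqr_ge0 _) h.
rewrite ler_pdivrMr ?sqrtr_gt0// mulrC -ler_pdivrMr//.
apply: (@le_trans _ _ (`|C| / e)); first by rewrite ler_pM2r ?invr_gt0// ler_norm.
have q0 : 0 <= `|C| / e by rewrite divr_ge0// ltW.
by rewrite -[leLHS](ger0_norm q0) -sqrtr_sqr ler_wsqrtr// ltW.
Qed.

Section wiener.
Context (R : realType) d (Omega : measurableType d) (P : probability Omega R).
Variable W : R -> Omega -> R.
Hypothesis W_wiener : wiener_process P W.

Let mW t : 0 <= t <= 1 -> measurable_fun setT (W t).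
Proof. by case: W_wiener => -[h _] _ _ _; exact: h. Qed.
Let cW w : {within `[0, 1], continuous (W ^~ w)}.
Proof. by case: W_wiener => -[_ h] _ _ _; exact: h. Qed.

Definition energy w : R := \int[lebesgue_measure]_(s in `[0, 1]) W s w ^+ 2.

Let riemann n w : R := n.+1%:R^-1 * (\sum_(i < n.+1) W (i%:R / n.+1%:R) w ^+ 2).

Let riemann_cvg w : riemann n w @[n --> \oo] --> energy w.
Proof. exact: (square_riemann_cvg (@cW w)). Qed.

Let measurable_riemann n : measurable_fun setT (riemann n).
Proof.
apply: measurable_funM => //; apply: measurable_sum => i; apply: measurable_funX.
by apply: mW; have := cell_node_itv R i; rewrite in_itv.
Qed.

Lemma measurable_energy : measurable_fun setT energy.
Proof. by apply: (measurable_fun_cvg measurable_riemann) => w _; exact: riemann_cvg. Qed.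

Lemma energy_ge0 w : 0 <= energy w.
Proof. by apply: Rintegral_ge0 => s _; exact: sqr_ge0. Qed.

(** The Riemann sums of the squared path converge to its energy, and their Laplace
    transforms are close to the Riccati values. *)
Lemma wiener_riccati (a b : R) : 0 <= a -> 0 <= b ->
  expR (- riccati_sum a b n.+1%:R n.+1) @[n --> \oo] -->
  \int[P]_w expR (- a * W 1 w ^+ 2 - b * energy w).
Proof.
move=> a0 b0.
pose h n w := expR (- a * W 1 w ^+ 2 - b * riemann n w).
have lim : \int[P]_w h n w @[n --> \oo] --> \int[P]_w expR (- a * W 1 w ^+ 2 - b * energy w).
  apply: (@bounded_convergence _ _ _ P h _ 1).
  - move=> n; apply: (measurableT_comp (f := expR)); first exact: measurable_expR.
    apply: measurable_funB; apply: measurable_funM => //.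
    by apply/measurable_funX/mW; rewrite ler01 lexx.
  - move=> n w; rewrite ger0_norm ?expR_ge0// -expR0 ler_expR /h.
    have h1 : 0 <= a * W 1 w ^+ 2 by rewrite mulr_ge0// sqr_ge0.
    have h2 : 0 <= b * riemann n w.
      by rewrite !mulr_ge0// ?invr_ge0// sumr_ge0// => i _; exact: sqr_ge0.
    by rewrite mulNr; lra.
  - move=> w; apply: (@cvg_comp _ _ _ _ expR); last exact: continuous_expR.
    apply: cvgB; first exact: cvg_cst.
    by apply: cvgM; [exact: cvg_cst|exact: riemann_cvg].
have close : \forall n \near \oo, `|\int[P]_w h n w - expR (- riccati_sum a b n.+1%:R n.+1)| <=
    lindeberg_const 3 a b / Num.sqrt n.+1%:R.
  near=> n.
  have nab : 4 * (a + b) + 1 <= n.+1%:R.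
    rewrite -[n.+1%:R]natr1 lerD2r; near: n; exact: nbhs_infty_ger.
  have grE i : grid 1 n.+1 i = i%:R / n.+1%:R :> R by rewrite /grid div1r.
  have scE i w : scaled 1 W 1 0 n.+1 i w = W (i%:R / n.+1%:R) w.
    by rewrite /scaled grE mul1r mul0r subr0.
  have inc i : (i < n.+1)%N -> [/\ rv4 P (fun w => W (i.+1%:R / n.+1%:R) w - W (i%:R / n.+1%:R) w),
      \int[P]_w (W (i.+1%:R / n.+1%:R) w - W (i%:R / n.+1%:R) w) = 0,
      \int[P]_w ((W (i.+1%:R / n.+1%:R) w - W (i%:R / n.+1%:R) w) ^+ 2) = n.+1%:R^-1 &
      \int[P]_w ((W (i.+1%:R / n.+1%:R) w - W (i%:R / n.+1%:R) w) ^+ 4) <= 3 / n.+1%:R ^+ 2].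
    move=> iN.
    have dE : i.+1%:R / n.+1%:R - i%:R / n.+1%:R = n.+1%:R^-1 :> R.
      by rewrite -[i.+1%:R]natr1; ring.
    have p0 : 0 <= i%:R / n.+1%:R :> R by rewrite divr_ge0.
    have p1 : i%:R / n.+1%:R <= i.+1%:R / n.+1%:R :> R by rewrite ler_wpM2r// ler_nat.
    have p2 : i.+1%:R / n.+1%:R <= 1 :> R by rewrite ler_pdivrMr// mul1r ler_nat.
    by have := wiener_increment W_wiener p0 p1 p2; rewrite dE exprVn.
  have := @lindeberg_riccati _ _ _ P 1 W 1 0 n.+1 3 ler01 mW _ _ isT _ _ _ _ a b a0 b0 nab.
  have -> : \int[P]_w h n w = \int[P]_w expR (- a * scaled 1 W 1 0 n.+1 n.+1 w ^+ 2 -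
      b / n.+1%:R * (\sum_(i < n.+1) scaled 1 W 1 0 n.+1 i w ^+ 2)).
    apply: eq_Rintegral => w _; rewrite /h /riemann scE divff// [b * (_ * _)]mulrA.
    by under [in RHS]eq_bigr do rewrite scE.
  apply.
  - by case: W_wiener.
  - by case: W_wiener.
  - move=> i iN; have [[_ h4] _ _ _] := inc i iN.
    by move: h4; apply: eq_integrable => // w _ /=; rewrite !scE.
  - move=> i iN; have [_ h1 _ _] := inc i iN.
    by rewrite -[RHS]h1; apply: eq_Rintegral => w _; rewrite !scE.
  - move=> i iN; have [_ _ h1 _] := inc i iN.
    by rewrite -[RHS]h1; apply: eq_Rintegral => w _; rewrite !scE.
  - move=> i iN; have [_ _ _ h1] := inc i iN.
    by apply: le_trans h1; rewrite le_eqVlt; apply/orP; left; apply/eqP; apply: eq_Rintegral => w _; rewrite !scE.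
apply/cvgrPdist_le => e e0; have e2 : 0 < e / 2 by rewrite divr_gt0.
near=> n.
have h1 : `|\int[P]_w expR (- a * W 1 w ^+ 2 - b * energy w) - \int[P]_w h n w| <= e / 2.
  by near: n; move/cvgrPdist_le : lim => /(_ _ e2).
have h2 : `|\int[P]_w h n w - expR (- riccati_sum a b n.+1%:R n.+1)| <= e / 2.
  have : `|\int[P]_w h n w - expR (- riccati_sum a b n.+1%:R n.+1)| <=
    lindeberg_const 3 a b / Num.sqrt n.+1%:R by near: n.
  move=> /le_trans; apply; apply: div_sqrt_le => //; rewrite -[n.+1%:R]natr1.
  rewrite (@le_lt_trans _ _ n%:R) ?ltrDl//; near: n; exact: nbhs_infty_ger.
move: h1 h2; move: (\int[P]_w _) (\int[P]_w _) (expR _) => p q r.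
by rewrite !ler_norml => /andP[? ?] /andP[? ?]; apply/andP; split; lra.
Unshelve. all: by end_near. Qed.

End wiener.

(** * The limit law *)

Lemma expR_near1 (R : realType) (e : R) : 0 < e -> exists2 r : R, 0 < r &
  forall y, `|y| <= r -> `|1 - expR y| < e.
Proof.
move=> e0.
have : \forall y \near (0 : R), `|expR 0 - expR y| < e.
  by move: (@continuous_expR R 0) => /cvgrPdist_lt /(_ _ e0).
move=> /nbhs_ballP[r /= r0 h]; exists (r / 2); first by rewrite divr_gt0.
move=> y yr; have := h y; rewrite /ball/= sub0r normrN expR0; apply.
by rewrite (le_lt_trans yr)// ltr_pdivrMr// ltr_pMr// ltr1n.
Qed.

Section limit_law.
Context (R : realType) (S : R) (psi : R -> R).
Hypotheses (S_gt0 : 0 < S) (psi_gt0 : forall x, 0 < psi x)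
  (psi_C1 : continuously_differentiable_at psi 0) (psi0 : psi 0 = 1)
  (dpsi0 : 0 < (psi^`())%classic 0).
Unset Implicit Arguments.
Context (d : measure_display) (Omega : R -> measurableType d)
  (P : forall T : R, probability (Omega T) R) (X : forall T : R, R -> Omega T -> nat).
Hypothesis X_poisson : forall T : R, 0 < T -> poisson_process (P T) S T (X T).
Set Implicit Arguments.
Context (d' : measure_display) (Omega' : measurableType d') (P' : probability Omega' R)
  (W : R -> Omega' -> R).
Hypothesis W_wiener : wiener_process P' W.

Section fixed_u.
Variables (u : R) (u_ge0 : 0 <= u).

(** The random factor of the expansion: it takes its values in the unit interval,
    since the linear term of the likelihood is, up to a constant, the opposite of
    a square. *)
Definition poisson_factor (T : R) (w : Omega T) : R :=
  expR (- (u / 2) * normalized S T (X T) (steps T) w ^+ 2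
    - u ^+ 2 / 2 / (steps T)%:R * \sum_(i < steps T) normalized S T (X T) i w ^+ 2).

Arguments poisson_factor T w : clear implicits.

Definition wiener_factor (w : Omega') : R :=
  expR (- (u / 2) * W 1 w ^+ 2 - u ^+ 2 / 2 * energy W w).

Lemma expansionE (T : R) (w : Omega T) :
  expR (expansion S T (X T) u w) = expR (u / 2) * poisson_factor T w.
Proof. by rewrite -expRD /expansion; congr expR; ring. Qed.

Let u2 : 0 <= u / 2. Proof. by rewrite divr_ge0. Qed.
Let uu : 0 <= u ^+ 2 / 2. Proof. by rewrite divr_ge0// sqr_ge0. Qed.

Lemma poisson_factor_itv (T : R) (w : Omega T) : 0 <= poisson_factor T w <= 1.
Proof.
rewrite expR_ge0/= -expR0 ler_expR.
set N := steps T.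
have h1 : 0 <= u / 2 * normalized S T (X T) N w ^+ 2 by rewrite mulr_ge0// sqr_ge0.
have h2 : 0 <= u ^+ 2 / 2 / N%:R * \sum_(i < N) normalized S T (X T) i w ^+ 2.
  by rewrite mulr_ge0 ?divr_ge0 ?sqr_ge0// sumr_ge0// => i _; exact: sqr_ge0.
by rewrite mulNr; lra.
Qed.

Lemma wiener_factor_itv (w : Omega') : 0 <= wiener_factor w <= 1.
Proof.
rewrite expR_ge0/= -expR0 ler_expR.
have h1 : 0 <= u / 2 * W 1 w ^+ 2 by rewrite mulr_ge0// sqr_ge0.
have h2 : 0 <= u ^+ 2 / 2 * energy W w by rewrite mulr_ge0// energy_ge0.
by rewrite mulNr; lra.
Qed.

Lemma measurable_wiener_factor : measurable_fun setT wiener_factor.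
Proof.
apply: (measurableT_comp (f := expR)); first exact: measurable_expR.
apply: measurable_funB; apply: measurable_funM => //; last exact: measurable_energy W_wiener.
by apply: measurable_funX; case: W_wiener => -[h _] _ _ _; apply: h; rewrite ler01 lexx.
Qed.

Lemma measurable_poisson_factor (T : R) : 0 < T -> measurable_fun setT (poisson_factor T).
Proof.
move=> T0.
have mn i : (i <= steps T)%N -> measurable_fun setT (normalized S T (X T) i).
  move=> iN; apply: (@measurable_scaled _ _ _ (P T)) => //.
  - exact: ltW.
  - by move=> t tT; exact: (measurable_counting_at (X_poisson T T0)).
  - exact: (counting_independent (X_poisson T T0)).
  - by apply: aeW => w; exact: (counting0 (X_poisson T T0)).
apply: (measurableT_comp (f := expR)); first exact: measurable_expR.
apply: measurable_funB; apply: measurable_funM => //.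
  by apply: measurable_funX; exact: mn.
by apply: measurable_sum => i; apply: measurable_funX; apply: mn; exact: ltnW.
Qed.

(** Both sides are close to the same deterministic Riccati recursion. *)
Lemma factor_moments (k : nat) :
  \int[P T]_w (poisson_factor T w ^+ k) @[T --> +oo] --> \int[P']_w (wiener_factor w ^+ k).
Proof.
pose a := k%:R * (u / 2); pose b := k%:R * (u ^+ 2 / 2).
have a0 : 0 <= a by rewrite mulr_ge0.
have b0 : 0 <= b by rewrite mulr_ge0.
have -> : \int[P']_w (wiener_factor w ^+ k) =
    \int[P']_w expR (- a * W 1 w ^+ 2 - b * energy W w).
  apply: eq_Rintegral => w _; rewrite /wiener_factor -expRM_natl; congr expR.
  by rewrite /a /b -mulr_natl; ring.
have lim := wiener_riccati W_wiener a0 b0.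
apply/cvgrPdist_le => e e0; have e2 : 0 < e / 2 by rewrite divr_gt0.
have [n0 _ hn0] : \forall n \near \oo,
    `|\int[P']_w expR (- a * W 1 w ^+ 2 - b * energy W w) - expR (- riccati_sum a b n.+1%:R n.+1)| <= e / 2.
  by move/cvgrPdist_le : lim => /(_ _ e2).
near=> T.
have T1 : 1 <= T by near: T; exact: nbhs_pinfty_ge.
have T0 : 0 < T by exact: lt_le_trans T1.
have /andP[TN N2T] := steps_bounds T1.
have n0T : (n0 <= Num.truncn T)%N.
  have Tn0 : n0%:R < T by near: T; exact: nbhs_pinfty_gt.
  by rewrite -ltnS -(ltr_nat R); exact: lt_le_trans TN.
have h1 : `|\int[P']_w expR (- a * W 1 w ^+ 2 - b * energy W w) -
    expR (- riccati_sum a b (steps T)%:R (steps T))| <= e / 2.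
  exact: (hn0 (Num.truncn T) n0T).
have Nab : 4 * (a + b) + 1 <= (steps T)%:R.
  by apply: le_trans TN; near: T; apply: nbhs_pinfty_ge; exact: num_real.
have := poisson_lindeberg S_gt0 T0 (X_poisson T T0) (isT : (0 < steps T)%N) a0 b0 Nab T1 N2T.
have -> : \int[P T]_w expR (- a * scaled T (counting (X T)) (Num.sqrt (S * T))^-1 S (steps T) (steps T) w ^+ 2 -
     b / (steps T)%:R * \sum_(i < steps T) scaled T (counting (X T)) (Num.sqrt (S * T))^-1 S (steps T) i w ^+ 2)
   = \int[P T]_w (poisson_factor T w ^+ k).
  apply: eq_Rintegral => w _; rewrite /poisson_factor -expRM_natl; congr expR.
  by rewrite /a /b -mulr_natl /normalized; ring.
have eN : lindeberg_const (3 + 2 / S) a b / Num.sqrt (steps T)%:R <= e / 2.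
  apply: div_sqrt_le => //; apply: (lt_le_trans _ TN).
  by near: T; apply: nbhs_pinfty_gt; exact: num_real.
move=> /le_trans /(_ eN) h2; move: h1 h2.
move: (\int[P']_w _) (expR _) (\int[P T]_w _) => p q r.
by rewrite !ler_norml => /andP[? ?] /andP[? ?]; apply/andP; split; lra.
Unshelve. all: by end_near. Qed.

(** Multiplicative errors close to [1] are harmless for a continuous function, uniformly
    over the values of the factor in the unit interval. *)
Lemma local_LR_near (g : R -> R) (e : R) : continuous g -> 0 < e ->
  \forall T \near +oo, exists E, [/\ measurable E, (P T E <= e%:E)%E &
    forall w, ~ E w -> `|g (local_LR S psi T u (X T ^~ w)) - g (expR (u / 2) * poisson_factor T w)| <= e].
Proof.
move=> cg e0; pose g' v := g (expR (u / 2) * v).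
have cg' : continuous g'.
  move=> v; apply: (@continuous_comp _ _ _ (fun v => expR (u / 2) * v) g); last exact: cg.
  by apply: cvgM; [exact: cvg_cst|exact: cvg_id].
have [dl dl0 mod] := uniform_modulus cg' e0.
have [r r0 hr] := expR_near1 dl0.
have m0 : 0 < Num.min e r by rewrite lt_min e0.
have uC : \forall T \near +oo, 0 <= (fun=> u) (T : R) <= u by near=> T; rewrite u_ge0 lexx.
have := logLR_event S_gt0 psi_gt0 psi_C1 psi0 dpsi0 X_poisson m0 uC.
apply: filterS => T [E [mE PE hE]]; exists E; split => //.
  by rewrite (le_trans PE)// lee_fin ge_min lexx.
move=> w /hE[_ cl].
set l := local_logLR _ _ _ _ _ in cl; set x := expansion _ _ _ _ _ in cl.
have -> : local_LR S psi T u (X T ^~ w) = expR l by rewrite /l /local_logLR lnK// posrE expR_gt0.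
have -> : expR l = expR (u / 2) * (poisson_factor T w * expR (l - x)).
  by rewrite mulrA -expansionE -expRD addrC subrK.
rewrite -/(g' _) -/(g' _) distrC; apply: mod; first exact: poisson_factor_itv.
have /andP[v0 v1] := poisson_factor_itv w.
rewrite -{1}[poisson_factor T w]mulr1 -mulrBr normrM ger0_norm//.
apply: le_lt_trans (hr (l - x) _); last by rewrite (le_trans cl)// ge_min lexx orbT.
by rewrite ler_piMl.
Unshelve. all: by end_near. Qed.

Variable WdW : Omega' -> R.
Hypothesis WdW_ito : is_ito_integral P' W W WdW.

(** With the Ito integral equal to [(W_1^2 - 1) / 2], the limit is [exp(u/2)] times the
    Wiener factor. *)
Lemma local_LR_cvg : cvg_in_distribution P
  (fun T w => local_LR S psi T u (X T ^~ w)) P'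
  (fun w => expR (- u * WdW w
     - u ^+ 2 / 2 * \int[lebesgue_measure]_(s in `[0, 1]) W s w ^+ 2)).
Proof.
move=> f cf [B fB]; have B0 : 0 <= B by exact: le_trans (fB 0).
pose g v := f (expR (u / 2) * v).
have cg : continuous g.
  move=> v; apply: (@continuous_comp _ _ _ (fun v => expR (u / 2) * v) f); last exact: cf.
  by apply: cvgM; [exact: cvg_cst|exact: cvg_id].
have mf : measurable_fun setT f by exact: continuous_measurable_fun.
have mg : measurable_fun setT g by exact: continuous_measurable_fun.
have mV T : 0 < T -> measurable_fun setT (fun w => g (poisson_factor T w)).
  by move=> T0; apply: (measurableT_comp mg); exact: measurable_poisson_factor.
pose Z w := expR (- u * WdW w - u ^+ 2 / 2 * energy W w).
have -> : ('E_P'[f \o Z] =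
     (\int[P']_w g (wiener_factor w))%R%:E)%E.
  have iW : P'.-integrable setT (EFin \o (fun w => g (wiener_factor w))).
    apply: (@integrable_bounded _ _ _ P' _ B) => [|w]; last exact: fB.
    by apply: (measurableT_comp mg); exact: measurable_wiener_factor.
  rewrite unlock /Rintegral fineK; last exact: integrable_fin_num.
  apply: ae_eq_integral => //.
  - apply/measurable_EFinP; apply: (measurableT_comp mf).
    apply: (measurableT_comp (f := expR)); first exact: measurable_expR.
    apply: measurable_funB; apply: measurable_funM => //.
      by case: WdW_ito.
    exact: measurable_energy W_wiener.
  - by apply: measurable_int iW.
  - apply: filterS (ito_wienerE W_wiener WdW_ito) => w WE _; congr (_%:E).
    rewrite /= /Z /g /wiener_factor -expRD WE; congr (f (expR _)).
    by move: (energy W w) => I; field.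
apply: (@expectation_cvg _ _ _ P _ (fun T w => g (poisson_factor T w)) B) => //.
- by move=> T w; exact: fB.
- near=> T; split => [|w]; last exact: fB.
  by apply: mV; near: T; exact: nbhs_pinfty_gt.
- by move=> e e0; have := local_LR_near cf e0.
- apply: (moments_cvg (B := B)) => //.
  + near=> T; split => [|w]; last exact: poisson_factor_itv.
    by apply: measurable_poisson_factor; near: T; exact: nbhs_pinfty_gt.
  + exact: measurable_wiener_factor.
  + exact: wiener_factor_itv.
  + exact: factor_moments.
  + by move=> x; exact: fB.
Unshelve. all: by end_near. Qed.

End fixed_u.

End limit_law.

Theorem mainTheorem4 (R : realType) (S : R) (psi : R -> R)
  (S_gt0 : 0 < S)
  (psi_gt0 : forall x, 0 < psi x)
  (psi_C1 : continuously_differentiable_at psi 0)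
  (psi0 : psi 0 = 1)
  (dpsi0 : 0 < (psi^`())%classic 0)
  (d : measure_display) (Omega : R -> measurableType d)
  (P0 : forall T : R, probability (Omega T) R)
  (X : forall T : R, R -> Omega T -> nat)
  (X_poisson : forall T : R, 0 < T -> poisson_process (P0 T) S T (X T))
  (d' : measure_display) (Omega' : measurableType d')
  (P' : probability Omega' R) (W : R -> Omega' -> R)
  (W_wiener : wiener_process P' W)
  (WdW : Omega' -> R)
  (WdW_ito : is_ito_integral P' W W WdW) :
  (forall u : R, 0 <= u ->
    cvg_in_distribution P0
      (fun T w => local_LR S psi T u (fun t => X T t w))
      P'
      (fun w => expR (- u * WdW w
         - u ^+ 2 / 2 * \int[lebesgue_measure]_(s in `[0, 1]) W s w ^+ 2))) /\
  (forall u : R -> R,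
    (\forall T \near +oo, local_param_set S T (u T)) ->
    (exists C : R, \forall T \near +oo, `|u T| <= C) ->
    cvg0_in_probability P0
      (fun T w => quadratic_logLR S T (u T) (fun t => X T t w)
                  - local_logLR S psi T (u T) (fun t => X T t w))).
Proof.
split => [u u0|u uU uC].
  exact: (local_LR_cvg S_gt0 psi_gt0 psi_C1 psi0 dpsi0 X_poisson W_wiener u0 WdW_ito).
exact: (quadratic_approximation S_gt0 psi_gt0 psi_C1 psi0 dpsi0 X_poisson uU uC).
Qed.
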